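(* Assume $\|X\|/p\le\lambda\le 2\bar\lambda$ with $\bar\lambda=2\|X\|\sqrt{\log p}$, and that there are constants $A_1,A_2,A_3,A_4>0$ (not depending on $p$) such that $A_1p^{-A_3}\pi_p(s-1)\le\pi_p(s)\le A_2p^{-A_4}\pi_p(s-1)$ for $s=1,\dots,p$. Then there exists a constant $M$ such that, as $n,p\to\infty$, uniformly over $\beta^0,\beta^*\in\mathbb R^p$ with $|S_*|\le|S_0|$ (where $S_*=S_{\beta^*}$, $S_0=S_{\beta^0}$), \begin{align*} &\mathbb E_{\beta^0}\Pi\Big(\beta:\|X(\beta-\beta^0)\|_2>\frac{M}{\bar\psi(S_0)}\Big[\|X(\beta^*-\beta^0)\|_2+\frac{\sqrt{|S_*|\log p}}{\phi(S_* )}\Big]\ \Big|\ Y\Big)\to0,\\ &\mathbb E_{\beta^0}\Pi\Big(\beta:\|\beta-\beta^0\|_1>\|\beta^*-\beta^0\|_1+\frac{M}{\bar\psi(S_0)^2}\Big[\frac{\|X(\beta^*-\beta^0)\|_2^2}{\|X\|\sqrt{\log p}}+\frac{|S_*|\sqrt{\log p}}{\|X\|\phi(S_* )^2}\Big]\ \Big|\ Y\Big)\to0,\\ &\mathbb E_{\beta^0}\Pi\Big(\beta:\|\beta-\beta^0\|_2>\frac{M}{\|X\|\tilde\psi(S_0)^2}\Big[\|X(\beta^*-\beta^0)\|_2+\frac{\sqrt{|S_*|\log p}}{\phi(S_* )}\Big]\ \Big|\ Y\Big)\to0. \end{align*}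
   Context: Observations follow $Y=X\beta+\varepsilon$ with $X$ a deterministic real $n\times p$ matrix and $\varepsilon\sim N_n(0,I_n)$. $\mathbb E_{\beta^0}$ denotes expectation when $Y\sim N_n(X\beta^0,I_n)$. For $\beta\in\mathbb R^p$, $S_\beta=\{i:\beta_i\neq0\}$; $\beta_S=(\beta_i)_{i\in S}$. $\|X\|=\max_i\|X_{\cdot,i}\|_2$ (max column Euclidean norm). Prior $\Pi$: draw $s\sim\pi_p$ on $\{0,\dots,p\}$, then $S$ uniform among subsets of size $s$, then $\beta_i$, $i\in S$, i.i.d. with density $\frac{\lambda}{2}e^{-\lambda|x|}$, $\beta_i=0$ for $i\notin S$. Posterior $\Pi(B\mid Y)=\int_Be^{-\|Y-X\beta\|_2^2/2}d\Pi(\beta)/\int e^{-\|Y-X\beta\|_2^2/2}d\Pi(\beta)$. $\phi(S)=\inf\{\|X\beta\|_2|S|^{1/2}/(\|X\|\|\beta_S\|_1):\|\beta_{S^c}\|_1\le7\|\beta_S\|_1,\beta_S\ne0\}$; $\bar\phi(s)=\inf\{\|X\beta\|_2|S_\beta|^{1/2}/(\|X\|\|\beta\|_1):0\ne|S_\beta|\le s\}$; $\tilde\phi(s)=\inf\{\|X\beta\|_2/(\|X\|\|\beta\|_2):0\ne|S_\beta|\le s\}$; $\bar\psi(S)=\bar\phi\big((2+\frac{3}{A_4}+\frac{33}{\phi(S)^2}\frac{\lambda}{\bar\lambda})|S|\big)$, $\tilde\psi(S)=\tilde\phi\big((2+\frac{3}{A_4}+\frac{33}{\phi(S)^2}\frac{\lambda}{\bar\lambda})|S|\big)$.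 Asymptotics: $n,p\to\infty$ with $X,\lambda,\pi_p$ depending on $n,p$ subject to the assumptions (constants $A_i$ fixed). *)

(* Defs.v *)
From HB Require Import structures.
From mathcomp Require Import all_boot all_order all_algebra.
From mathcomp Require Import all_classical all_reals all_analysis.
Set Implicit Arguments. Unset Strict Implicit. Unset Printing Implicit Defensive.
Import Order.TTheory GRing.Theory Num.Theory.
Local Open Scope classical_set_scope.
Local Open Scope ring_scope.

Section Defs.
Variable R : realType.

Definition norm2 m (v : 'cV[R]_m) : R := Num.sqrt (\sum_(i < m) v i 0 ^+ 2).
Definition norm1 m (v : 'cV[R]_m) : R := \sum_(i < m) `|v i 0|.
Definition norm1_on m (S : {set 'I_m}) (v : 'cV[R]_m) : R := \sum_(i in S) `|v i 0|.
Definition supp m (v : 'cV[R]_m) : {set 'I_m} := [set i | v i 0 != 0].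

Definition normX n p (X : 'M[R]_(n, p)) : R :=
  \big[Num.max/0]_(j < p) Num.sqrt (\sum_(i < n) X i j ^+ 2).

Definition lambda_bar n p (X : 'M[R]_(n, p)) : R :=
  2 * normX X * Num.sqrt (ln p%:R).

(** compatibility number phi(S) (infimum in the extended reals; inf of empty = +oo) *)
Definition phi n p (X : 'M[R]_(n, p)) (S : {set 'I_p}) : \bar R :=
  ereal_inf [set ((norm2 (X *m b) * Num.sqrt (#|S|%:R)
                   / (normX X * norm1_on S b))%:E)%E
            | b in [set b : 'cV[R]_p | norm1_on (~: S) b <= 7 * norm1_on S b
                                       /\ norm1_on S b != 0]].

Definition phibar n p (X : 'M[R]_(n, p)) (s : \bar R) : \bar R :=
  ereal_inf [set ((norm2 (X *m b) * Num.sqrt (#|supp b|%:R)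
                   / (normX X * norm1 b))%:E)%E
            | b in [set b : 'cV[R]_p | (0 < #|supp b|)%N /\ ((#|supp b|%:R)%:E <= s)%E]].

Definition phitilde n p (X : 'M[R]_(n, p)) (s : \bar R) : \bar R :=
  ereal_inf [set ((norm2 (X *m b) / (normX X * norm2 b))%:E)%E
            | b in [set b : 'cV[R]_p | (0 < #|supp b|)%N /\ ((#|supp b|%:R)%:E <= s)%E]].

(** the argument (2 + 3/A4 + 33/phi(S)^2 * lambda/bar lambda) |S|, in the extended reals
    (with 1/0 = +oo, 1/+oo = 0) *)
Definition psi_arg n p (X : 'M[R]_(n, p)) (A4 lam : R) (S : {set 'I_p}) : \bar R :=
  (((2 + 3 / A4)%:E + (33 * (lam / lambda_bar X))%:E * (phi X S * phi X S)^-1)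
     * (#|S|%:R)%:E)%E.

Definition psibar n p (X : 'M[R]_(n, p)) (A4 lam : R) (S : {set 'I_p}) : \bar R :=
  phibar X (psi_arg X A4 lam S).
Definition psitilde n p (X : 'M[R]_(n, p)) (A4 lam : R) (S : {set 'I_p}) : \bar R :=
  phitilde X (psi_arg X A4 lam S).

Definition setc m (b : 'cV[R]_m) (i : 'I_m) (x : R) : 'cV[R]_m :=
  \col_j (if j == i then x else b j 0).

Fixpoint iint m (s : seq 'I_m) (f : 'cV[R]_m -> \bar R) (b : 'cV[R]_m) : \bar R :=
  match s with
  | [::] => f b
  | i :: s' => (\int[@lebesgue_measure R]_(x in setT) iint s' f (setc b i x))%E
  end.

Definition laplace (lam x : R) : R := lam / 2 * expR (- (lam * `|x|)).

(** Integral of a nonnegative g against the prior Pi (with prior pi on sizes):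
    sum over supports S of pi(|S|)/C(p,|S|) times the integral over R^S of
    g (with beta = 0 off S) against the product Laplace density. *)
Definition prior_int p (pi : nat -> R) (lam : R) (g : 'cV[R]_p -> \bar R) : \bar R :=
  (\sum_(S : {set 'I_p})
     (pi #|S| / 'C(p, #|S|)%:R)%:E *
     iint (enum S) (fun b => g b * (\prod_(i in S) laplace lam (b i 0))%:E) 0)%E.

Definition likelihood n p (X : 'M[R]_(n, p)) (Y : 'cV[R]_n) (b : 'cV[R]_p) : R :=
  expR (- (norm2 (Y - X *m b) ^+ 2 / 2)).

Definition posterior n p (X : 'M[R]_(n, p)) (pi : nat -> R) (lam : R)
    (B : set 'cV[R]_p) (Y : 'cV[R]_n) : R :=
  fine (prior_int pi lam (fun b => ((\1_B b : R) * likelihood X Y b)%:E))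
  / fine (prior_int pi lam (fun b => (likelihood X Y b)%:E)).

Definition gauss_density n (mu y : 'cV[R]_n) : R :=
  (2 * pi) `^ (- (n%:R / 2)) * expR (- (norm2 (y - mu) ^+ 2 / 2)).

Definition post_expect n p (X : 'M[R]_(n, p)) (pi : nat -> R) (lam : R)
    (beta0 : 'cV[R]_p) (B : set 'cV[R]_p) : \bar R :=
  iint (enum 'I_n)
    (fun y => (gauss_density (X *m beta0) y * posterior X pi lam B y)%:E) 0.

End Defs.

(* Main.v *)
Require Import Defs.
From HB Require Import structures.
From mathcomp Require Import all_boot all_order all_algebra.
From mathcomp Require Import all_classical all_reals all_analysis.
From mathcomp Require Import measurable_realfun ring lra.
Import Order.TTheory GRing.Theory Num.Theory.
Local Open Scope classical_set_scope.
Local Open Scope ring_scope.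
Set Implicit Arguments. Unset Strict Implicit. Unset Printing Implicit Defensive.

(** The posterior is compared, through the evidence, with its mass on a small box
    around betas. For a model S, the likelihood ratio at b - betas = d contains the
    factor exp <eps, X d>; the power 1 - alpha of it is integrated against the noise
    (a Gaussian shift), while the power alpha is bounded pathwise by
    |X d|^2/4 plus the squared projection of eps on the columns indexed by S, which is
    at most a multiple of |S| log p for all S at once. With alpha a small constant
    depending on A4, the prior decay p^(-A4 |S|) absorbs this, and the quadratic gain
    alpha |X d|^2 together with the compatibility number controls the shrinkage term
    lam (|betas|_1 - |b|_1). So with high probability
    |X d|^2 + lam |d|_1 + |supp b| log p is at most a constant multiple of
    |X (betas - beta0)|^2 + |supp betas| log p / phi^2, which gives prediction.

    Write t = lam / lambda_bar. If t is small with respect to A4, the same bound with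
    betas := beta0 shows that |supp b| + |supp beta0| is below the argument of psibar
    and psitilde, which then convert the prediction error into the other two losses.
    If t is bounded below, the bound on lam |d|_1 is the l1 loss, and a Maurey
    sparsification of d allows psitilde to be used although d may be less sparse than
    its argument permits. *)

(** * Iterated integrals *)

(** The slab rate may be as small as [normX X / p], so the penalty cannot be relied on to beat the
    noise. Only the prior decay in the model size can, which is why the noise is measured by
    projections, at a price proportional to |S| log p, and why that price is scaled down by [alpha].
    The full likelihood ratio has expectation one and leaves no quadratic gain; giving up a fraction
    [alpha] of its power frees about alpha |X d|^2, which is shared between the noise, the cross
    term with X (beta0 - betas), the shrinkage and the final gain.

    The posterior of an arbitrary set is a quotient whose measurability in Y is never established.
    It is bounded pointwise by a measurable [J], and only monotonicity of the outer integral is used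
    before passing to [J].

    The threshold on t comes from a mismatch: shrinkage costs a multiple of t^2 / (alpha phi^2) per
    unit of |S0| log p, whereas the argument of psibar offers a term linear in t. The quadratic cost
    fits once t is at most alpha A4. The constants A1, A2 and the factors polynomial in log p are
    absorbed by a small power p^delta, so the final M depends on A3 and A4 only. *)

Section IteratedIntegrals.
Context {R : realType}.
Local Open Scope ereal_scope.
Notation leb := (@lebesgue_measure R).

Definition coord_meas d (T : measurableType d) m (g : T -> 'cV[R]_m) :=
  forall i, measurable_fun [set: T] (fun t => g t i 0%R).

(* Measurability is tested along coordinatewise measurable maps; this avoids
   choosing a sigma-algebra on column vectors and is stable under [iint]. *)
Definition jmeas n p (f : 'cV[R]_n -> 'cV[R]_p -> \bar R) :=
  forall d (T : measurableType d) (g : T -> 'cV[R]_n) (h : T -> 'cV[R]_p),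
  coord_meas g -> coord_meas h -> measurable_fun [set: T] (fun t => f (g t) (h t)).

Definition rmeas n p (f : 'cV[R]_n -> 'cV[R]_p -> R) :=
  forall d (T : measurableType d) (g : T -> 'cV[R]_n) (h : T -> 'cV[R]_p),
  coord_meas g -> coord_meas h -> measurable_fun [set: T] (fun t => f (g t) (h t)).

(** The integral of a nonnegative function is a supremum over the simple functions below it, hence
    monotone without measurability. This is what allows posteriors of arbitrary sets to be
    integrated. *)
Lemma ge0_le_integral_nonmeas (f g : R -> \bar R) :
  (forall x, 0 <= f x) -> (forall x, f x <= g x) ->
  \int[leb]_(x in setT) f x <= \int[leb]_(x in setT) g x.
Proof.
move=> f0 fg; have g0 x : 0 <= g x := le_trans (f0 x) (fg x).
rewrite !ge0_integralE// !patch_setT.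
apply: le_ereal_sup => _ [h hf <-]; exists h => // x.
exact: le_trans (hf x) (fg x).
Qed.

Lemma setcE m (b : 'cV[R]_m) i x j : setc b i x j 0%R = if j == i then x else b j 0%R.
Proof. by rewrite mxE. Qed.

Lemma coord_meas_setc d (T : measurableType d) m (h : T -> 'cV[R]_m) i :
  coord_meas h ->
  coord_meas (fun z : T * measurableTypeR R => setc (h z.1) i z.2).
Proof.
move=> mh j; have [->|ji] := eqVneq j i.
  by under eq_fun do rewrite setcE eqxx; exact: measurable_snd.
under eq_fun do rewrite setcE (negPf ji).
by apply: (measurableT_comp (mh j)); exact: measurable_fst.
Qed.

Lemma coord_meas_fst d (T : measurableType d) m (h : T -> 'cV[R]_m) :
  coord_meas h -> coord_meas (fun z : T * measurableTypeR R => h z.1).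
Proof. by move=> mh j; apply: (measurableT_comp (mh j)); exact: measurable_fst. Qed.

Lemma iint_ge0 m (s : seq 'I_m) (f : 'cV[R]_m -> \bar R) b :
  (forall b, 0 <= f b) -> 0 <= iint s f b.
Proof.
by move=> f0; elim: s b => //= i s IH b; apply: integral_ge0 => x _; exact: IH.
Qed.

Lemma jmeas_swap n p (f : 'cV[R]_n -> 'cV[R]_p -> \bar R) :
  jmeas f -> jmeas (fun b y => f y b).
Proof. by move=> mf d T g h mg mh; exact: mf. Qed.

(** Each integration adjoins one real coordinate to the test space, and Tonelli integrates it out
    again; quantifying over all test spaces makes the induction close. *)
Lemma jmeas_iint n p (f : 'cV[R]_n -> 'cV[R]_p -> \bar R) s :
  (forall y b, 0 <= f y b) -> jmeas f -> jmeas (fun y b => iint s (f y) b).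
Proof.
move=> f0 mf; elim: s => [//|i s IH] d T g h mg mh /=.
have mF := IH _ _ _ _ (coord_meas_fst mg) (coord_meas_setc i mh).
apply: (measurable_fun_fubini_tonelli_F (m2 := leb) _ mF) => z.
by apply: iint_ge0 => b; exact: f0.
Qed.

(** Iterated integration over [s] only visits vectors that agree with [b0] off [s]. With [b0 = 0]
    this is how integrands are known to be evaluated at vectors supported in the model. *)
Lemma le_iint m (s : seq 'I_m) (f g : 'cV[R]_m -> \bar R) (b0 : 'cV[R]_m) :
  (forall b, 0 <= f b) ->
  (forall b : 'cV[R]_m, (forall i, i \notin s -> b i 0%R = b0 i 0%R) -> f b <= g b) ->
  iint s f b0 <= iint s g b0.
Proof.
move=> f0; elim: s b0 => [|i s IH] b0 fg /=; first exact: fg.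
apply: ge0_le_integral_nonmeas => x; first exact: iint_ge0.
apply: IH => b hb; apply: fg => j; rewrite inE negb_or => /andP[ji js].
by rewrite hb// setcE (negPf ji).
Qed.

Lemma eq_iint m (s : seq 'I_m) (f g : 'cV[R]_m -> \bar R) b0 :
  (forall b, f b = g b) -> iint s f b0 = iint s g b0.
Proof.
by move=> fg; elim: s b0 => [|i s IH] b0 //=; apply: eq_integral => x _; exact: IH.
Qed.

(* A single-variable function is seen as jointly measurable in a dummy variable. *)
Definition vmeas m (f : 'cV[R]_m -> \bar R) := jmeas (fun _ : 'cV[R]_0 => f).

Lemma vmeas_setc m (f : 'cV[R]_m -> \bar R) s b i :
  (forall b, 0 <= f b) -> vmeas f ->
  measurable_fun [set: measurableTypeR R] (fun x => iint s f (setc b i x)).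
Proof.
move=> f0 mf.
apply: (@jmeas_iint _ _ (fun _ : 'cV[R]_0 => f) s (fun _ => f0) mf _ _ (fun=> 0%R)).
  by move=> [].
move=> j; have [->|ji] := eqVneq j i.
  by under eq_fun do rewrite setcE eqxx; exact: measurable_id.
by under eq_fun do rewrite setcE (negPf ji); exact: measurable_cst.
Qed.

Lemma iintD m (s : seq 'I_m) (f g : 'cV[R]_m -> \bar R) b :
  (forall b, 0 <= f b) -> (forall b, 0 <= g b) -> vmeas f -> vmeas g ->
  iint s (fun b => f b + g b) b = iint s f b + iint s g b.
Proof.
move=> f0 g0 mf mg; elim: s b => [//|i s IH] b /=.
under eq_integral do rewrite IH.
rewrite ge0_integralD//.
- by move=> x _; exact: iint_ge0.
- exact: vmeas_setc.
- by move=> x _; exact: iint_ge0.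
- exact: vmeas_setc.
Qed.

Lemma iintZl m (s : seq 'I_m) (f : 'cV[R]_m -> \bar R) (k : R) b :
  (0 <= k)%R -> (forall b, 0 <= f b) -> vmeas f ->
  iint s (fun b => k%:E * f b) b = k%:E * iint s f b.
Proof.
move=> k0 f0 mf; elim: s b => [//|i s IH] b /=.
under eq_integral do rewrite IH.
rewrite ge0_integralZl_EFin//.
- by move=> x _; exact: iint_ge0.
- exact: vmeas_setc.
Qed.

Lemma vmeas_sum m (I : Type) (r : seq I) (P : pred I) (F : I -> 'cV[R]_m -> \bar R) :
  (forall i b, 0 <= F i b) -> (forall i, P i -> vmeas (F i)) ->
  vmeas (fun b => \sum_(i <- r | P i) F i b).
Proof.
move=> F0 mF d T g h mg mh.
elim: r => [|i r IH]; first by under eq_fun do rewrite big_nil; exact: measurable_cst.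
case Pi : (P i); last by under eq_fun do rewrite big_cons Pi.
under eq_fun do rewrite big_cons Pi.
by apply: emeasurable_funD => //; apply: (mF _ Pi _ _ g).
Qed.

Lemma iint_sum m (s : seq 'I_m) (I : Type) (r : seq I) (P : pred I)
    (F : I -> 'cV[R]_m -> \bar R) b :
  (forall i b, 0 <= F i b) -> (forall i, P i -> vmeas (F i)) ->
  iint s (fun b => \sum_(i <- r | P i) F i b) b = \sum_(i <- r | P i) iint s (F i) b.
Proof.
move=> F0 mF; elim: r => [|i r IH].
  rewrite big_nil; under eq_iint do rewrite big_nil.
  elim: s b => [//|i s IH] b /=.
  by under eq_integral do rewrite IH; rewrite integral0.
rewrite big_cons; case Pi : (P i).
  rewrite -IH -iintD//; last 2 first.
  - exact: mF.
  - exact: vmeas_sum.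
  - by apply: eq_iint => b'; rewrite big_cons Pi.
  - by move=> b'; apply: sume_ge0.
by rewrite -IH; apply: eq_iint => b'; rewrite big_cons Pi.
Qed.

Lemma jmeas_vmeas n p (f : 'cV[R]_n -> 'cV[R]_p -> \bar R) y : jmeas f -> vmeas (f y).
Proof. by move=> mf d T g h mg mh; apply: mf => // i; exact: measurable_cst. Qed.

Lemma iint_integral n p (f : 'cV[R]_n -> 'cV[R]_p -> \bar R) i y s' b :
  (forall y b, 0 <= f y b) -> jmeas f ->
  \int[leb]_(x in setT) iint s' (f (setc y i x)) b =
  iint s' (fun b => \int[leb]_(x in setT) f (setc y i x) b) b.
Proof.
move=> f0 mf; elim: s' b => [//|j s' IH] b /=.
under [RHS]eq_integral do rewrite -IH.
apply: (@fubini_tonelli _ _ _ _ _ leb leb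
  (fun z => iint s' (f (setc y i z.1)) (setc b j z.2))).
- have mi := @jmeas_iint _ _ f s' f0 mf.
  apply: (mi _ _ (fun z : measurableTypeR R * measurableTypeR R => setc y i z.1)
      (fun z => setc b j z.2)) => k.
  + have [->|ki] := eqVneq k i.
      by under eq_fun do rewrite setcE eqxx; exact: measurable_fst.
    by under eq_fun do rewrite setcE (negPf ki); exact: measurable_cst.
  + have [->|ki] := eqVneq k j.
      by under eq_fun do rewrite setcE eqxx; exact: measurable_snd.
    by under eq_fun do rewrite setcE (negPf ki); exact: measurable_cst.
- by move=> z; exact: iint_ge0.
Qed.

Lemma iint_swap n p (f : 'cV[R]_n -> 'cV[R]_p -> \bar R) s s' y b :
  (forall y b, 0 <= f y b) -> jmeas f ->
  iint s (fun y => iint s' (f y) b) y = iint s' (fun b => iint s (f^~ b) y) b.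
Proof.
move=> f0 mf; elim: s y => [//|i s IH] y /=.
under eq_integral do rewrite IH.
rewrite (@iint_integral _ _ (fun y b => iint s (f^~ b) y))//.
- by move=> y' b'; exact: iint_ge0.
- apply: jmeas_swap; apply: (@jmeas_iint _ _ (fun b y => f y b)) => //.
  exact: jmeas_swap.
Qed.

(** The prefactor [C] may depend on coordinates outside [s]: after the first variable is peeled off,
    its factor is absorbed into [C] and the induction hypothesis applies. *)
Lemma iint_prod m (s : seq 'I_m) (C : 'cV[R]_m -> R) (F : 'I_m -> R -> R) (I : 'I_m -> R) b :
  uniq s ->
  (forall b, (0 <= C b)%R) ->
  (forall b b' : 'cV[R]_m, (forall i, i \notin s -> b i 0 = b' i 0)%R -> C b = C b') ->
  (forall i x, 0 <= F i x)%R ->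
  (forall i, measurable_fun [set: measurableTypeR R] (F i)) ->
  (forall i, \int[leb]_(x in setT) (F i x)%:E = (I i)%:E) ->
  iint s (fun b => (C b * \prod_(i <- s) F i (b i 0))%:E) b = (C b * \prod_(i <- s) I i)%:E.
Proof.
move=> + + + F0 mF FI; elim: s C b => [|i s IH] C b /=.
  by move=> _ _ _; rewrite !big_nil.
move=> /andP[is_ us] C0 Cs.
have E x : iint s (fun b => (C b * \prod_(i <- i :: s) F i (b i 0))%:E) (setc b i x) =
    (C b * \prod_(j <- s) I j)%:E * (F i x)%:E.
  have := IH (fun b => C b * F i (b i 0))%R (setc b i x) us.
  under eq_iint do rewrite -mulrA -[X in (_ * X)%R](big_cons _ _ _ _ (fun=> true) (fun i => F i _)).
  move=> ->.
  - rewrite setcE eqxx -EFinM; congr EFin.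
    rewrite (Cs (setc b i x) b); first ring.
    by move=> j; rewrite inE negb_or setcE => /andP[/negPf->].
  - by move=> b'; rewrite mulr_ge0.
  - move=> b1 b2 b12; rewrite (b12 i)//; congr (_ * _)%R; apply: Cs => j.
    by rewrite inE negb_or => /andP[_ /b12].
under eq_integral do rewrite E.
have I0 j : (0 <= I j)%R by rewrite -lee_fin -FI; apply: integral_ge0 => x _; rewrite lee_fin.
rewrite ge0_integralZl_EFin//.
- by rewrite FI big_cons -EFinM; congr EFin; ring.
- by move=> x _; rewrite lee_fin.
- by apply/measurable_EFinP; exact: mF.
- by rewrite mulr_ge0 ?prodr_ge0.
Qed.

End IteratedIntegrals.

(** * Euclidean geometry *)

Section Dot.
Context {R : realType}.

Definition dot m (u v : 'cV[R]_m) : R := \sum_(i < m) u i 0 * v i 0.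

Lemma dotC m (u v : 'cV[R]_m) : dot u v = dot v u.
Proof. by apply: eq_bigr => i _; rewrite mulrC. Qed.

Lemma dotDl m (u v w : 'cV[R]_m) : dot (u + v) w = dot u w + dot v w.
Proof. by rewrite /dot -big_split; apply: eq_bigr => i _; rewrite mxE mulrDl. Qed.

Lemma dotZl m a (u v : 'cV[R]_m) : dot (a *: u) v = a * dot u v.
Proof. by rewrite /dot mulr_sumr; apply: eq_bigr => i _; rewrite mxE mulrA. Qed.

Lemma dotNl m (u v : 'cV[R]_m) : dot (- u) v = - dot u v.
Proof. by rewrite -scaleN1r dotZl mulN1r. Qed.

Lemma dotBl m (u v w : 'cV[R]_m) : dot (u - v) w = dot u w - dot v w.
Proof. by rewrite dotDl dotNl. Qed.

Lemma dotDr m (u v w : 'cV[R]_m) : dot w (u + v) = dot w u + dot w v.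
Proof. by rewrite dotC dotDl !(dotC w). Qed.

Lemma dotZr m a (u v : 'cV[R]_m) : dot u (a *: v) = a * dot u v.
Proof. by rewrite dotC dotZl dotC. Qed.

Lemma dotBr m (u v w : 'cV[R]_m) : dot w (u - v) = dot w u - dot w v.
Proof. by rewrite dotC dotBl !(dotC w). Qed.

Lemma dot0l m (u : 'cV[R]_m) : dot 0 u = 0.
Proof. by rewrite -(scale0r u) dotZl mul0r. Qed.

Lemma dot_sumr m I (r : seq I) (P : pred I) (F : I -> 'cV[R]_m) u :
  dot u (\sum_(i <- r | P i) F i) = \sum_(i <- r | P i) dot u (F i).
Proof.
elim/big_rec2: _ => [|i x y _ <-]; first by rewrite dotC dot0l.
by rewrite dotDr.
Qed.

Lemma dot_ge0 m (u : 'cV[R]_m) : 0 <= dot u u.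
Proof. by apply: sumr_ge0 => i _; rewrite -expr2 sqr_ge0. Qed.

Lemma norm2_sqr m (u : 'cV[R]_m) : norm2 u ^+ 2 = dot u u.
Proof. by rewrite sqr_sqrtr; [exact: eq_bigr|exact: dot_ge0]. Qed.

Lemma norm2_ge0 m (u : 'cV[R]_m) : 0 <= norm2 u.
Proof. exact: sqrtr_ge0. Qed.

(** Expansion of the squared norm of 2 c v - u. The free weight c is what later distributes the
    quadratic budget. *)
Lemma dot_le m (u v : 'cV[R]_m) c : 0 < c -> dot u v <= c * norm2 v ^+ 2 + norm2 u ^+ 2 / (4 * c).
Proof.
move=> c0; have := dot_ge0 ((2 * c) *: v - u).
rewrite !norm2_sqr dotBl !dotBr !dotZl !dotZr (dotC v u) => h.
have -> : c * dot v v + dot u u / (4 * c) = dot u v +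
  (2 * c * (2 * c * dot v v) - 2 * c * dot u v - (2 * c * dot u v - dot u u)) / (4 * c).
  by field; lra.
by rewrite lerDl divr_ge0//; lra.
Qed.

Lemma CauchySchwarz m (u v : 'cV[R]_m) : dot u v <= norm2 u * norm2 v.
Proof.
have [v0|v0] := eqVneq (norm2 v) 0.
  rewrite v0 mulr0; have /psumr_eq0P vz : \sum_(i < m) v i 0 ^+ 2 = 0.
    by rewrite -[LHS]/(dot v v) -norm2_sqr v0 expr0n.
  rewrite /dot big1// => i _; have /eqP := vz (fun i _ => sqr_ge0 _) i isT.
  by rewrite sqrf_eq0 => /eqP ->; rewrite mulr0.
have {}v0 : 0 < norm2 v by rewrite lt_def v0 norm2_ge0.
have [u0|u0] := eqVneq (norm2 u) 0.
  rewrite u0 mul0r; have /psumr_eq0P uz : \sum_(i < m) u i 0 ^+ 2 = 0.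
    by rewrite -[LHS]/(dot u u) -norm2_sqr u0 expr0n.
  rewrite /dot big1// => i _; have /eqP := uz (fun i _ => sqr_ge0 _) i isT.
  by rewrite sqrf_eq0 => /eqP ->; rewrite mul0r.
have {}u0 : 0 < norm2 u by rewrite lt_def u0 norm2_ge0.
(* The weight minimising the right-hand side of [dot_le]. *)
have c0 : 0 < norm2 u / (2 * norm2 v) by rewrite divr_gt0// mulr_gt0.
apply: le_trans (dot_le u v c0) _; rewrite le_eqVlt; apply/orP; left; apply/eqP.
by field; rewrite !gt_eqF.
Qed.

Lemma norm2_triangle m (u v : 'cV[R]_m) : norm2 (u + v) <= norm2 u + norm2 v.
Proof.
rewrite -(@ler_pXn2r _ 2)// ?nnegrE ?addr_ge0 ?norm2_ge0//.
rewrite norm2_sqr sqrrD !norm2_sqr dotDl !dotDr (dotC v u).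
have := CauchySchwarz u v; rewrite mulr2n; lra.
Qed.

Lemma norm2Z m a (u : 'cV[R]_m) : norm2 (a *: u) = `|a| * norm2 u.
Proof.
apply/eqP; rewrite -(@eqrXn2 _ 2)// ?mulr_ge0 ?norm2_ge0//.
by rewrite exprMn !norm2_sqr dotZl dotZr mulrA real_normK ?num_real// expr2.
Qed.

Lemma norm2N m (u : 'cV[R]_m) : norm2 (- u) = norm2 u.
Proof. by rewrite -scaleN1r norm2Z normrN1 mul1r. Qed.

Lemma norm2_0 m : norm2 (0 : 'cV[R]_m) = 0.
Proof. by apply/eqP; rewrite -sqrf_eq0 norm2_sqr dot0l. Qed.

Lemma norm2_eq0 m (u : 'cV[R]_m) : norm2 u = 0 -> u = 0.
Proof.
move=> u0; have /psumr_eq0P uz : \sum_(i < m) u i 0 ^+ 2 = 0.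
  by rewrite -[LHS]/(dot u u) -norm2_sqr u0 expr0n.
apply/colP => i; rewrite mxE; apply/eqP.
by rewrite -sqrf_eq0; apply/eqP; apply: uz => // j _; exact: sqr_ge0.
Qed.

End Dot.

(** * Measurable integrands *)

Section Measurable.
Context {R : realType}.

Lemma rmeas_EFin n p (f : 'cV[R]_n -> 'cV[R]_p -> R) :
  rmeas f -> jmeas (fun y b => (f y b)%:E).
Proof. by move=> mf d T g h mg mh; apply/measurable_EFinP; exact: mf. Qed.

Lemma rmeas_cst n p (c : R) : rmeas (fun (_ : 'cV[R]_n) (_ : 'cV[R]_p) => c).
Proof. by move=> d T g h _ _; exact: measurable_cst. Qed.

Lemma rmeasD n p (f g : 'cV[R]_n -> 'cV[R]_p -> R) :
  rmeas f -> rmeas g -> rmeas (fun y b => f y b + g y b).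
Proof. by move=> mf mg d T g0 h0 mg0 mh0; apply: measurable_funD; [exact: mf|exact: mg]. Qed.

Lemma rmeasM n p (f g : 'cV[R]_n -> 'cV[R]_p -> R) :
  rmeas f -> rmeas g -> rmeas (fun y b => f y b * g y b).
Proof. by move=> mf mg d T g0 h0 mg0 mh0; apply: measurable_funM; [exact: mf|exact: mg]. Qed.

Lemma rmeas_comp n p (F : R -> R) (f : 'cV[R]_n -> 'cV[R]_p -> R) :
  measurable_fun [set: measurableTypeR R] F -> rmeas f -> rmeas (fun y b => F (f y b)).
Proof. by move=> mF mf d T g0 h0 mg0 mh0; apply: (measurableT_comp mF); exact: mf. Qed.

Lemma rmeasN n p (f : 'cV[R]_n -> 'cV[R]_p -> R) :
  rmeas f -> rmeas (fun y b => - f y b).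
Proof. by apply: rmeas_comp; apply: oppr_measurable. Qed.

Lemma rmeas_expR n p (f : 'cV[R]_n -> 'cV[R]_p -> R) :
  rmeas f -> rmeas (fun y b => expR (f y b)).
Proof. by apply: rmeas_comp; exact: measurable_expR. Qed.

Lemma rmeas_sum n p (I : Type) (r : seq I) (P : pred I) (F : I -> 'cV[R]_n -> 'cV[R]_p -> R) :
  (forall i, rmeas (F i)) -> rmeas (fun y b => \sum_(i <- r | P i) F i y b).
Proof.
move=> mF; elim: r => [|i r IH] d T g h mg mh.
  by under eq_fun do rewrite big_nil; exact: measurable_cst.
case Pi : (P i); under eq_fun do rewrite big_cons Pi.
  by apply: measurable_funD; [exact: mF|exact: IH].
exact: IH.
Qed.

Lemma rmeas_prod n p (I : Type) (r : seq I) (P : pred I) (F : I -> 'cV[R]_n -> 'cV[R]_p -> R) :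
  (forall i, rmeas (F i)) -> rmeas (fun y b => \prod_(i <- r | P i) F i y b).
Proof.
move=> mF; elim: r => [|i r IH] d T g h mg mh.
  by under eq_fun do rewrite big_nil; exact: measurable_cst.
case Pi : (P i); under eq_fun do rewrite big_cons Pi.
  by apply: measurable_funM; [exact: mF|exact: IH].
exact: IH.
Qed.

Definition vecmeas n p k (f : 'cV[R]_n -> 'cV[R]_p -> 'cV[R]_k) :=
  forall i, rmeas (fun y b => f y b i 0).

Lemma vecmeas_fst n p : vecmeas (fun (y : 'cV[R]_n) (_ : 'cV[R]_p) => y).
Proof. by move=> i d T g h mg mh; exact: mg. Qed.

Lemma vecmeas_snd n p : vecmeas (fun (_ : 'cV[R]_n) (b : 'cV[R]_p) => b).
Proof. by move=> i d T g h mg mh; exact: mh. Qed.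

Lemma vecmeas_cst n p k (v : 'cV[R]_k) : vecmeas (fun (_ : 'cV[R]_n) (_ : 'cV[R]_p) => v).
Proof. by move=> i; exact: rmeas_cst. Qed.

Lemma vecmeasD n p k (f g : 'cV[R]_n -> 'cV[R]_p -> 'cV[R]_k) :
  vecmeas f -> vecmeas g -> vecmeas (fun y b => f y b + g y b).
Proof.
move=> mf mg i; have := rmeasD (mf i) (mg i).
by congr rmeas; apply/funext => y; apply/funext => b; rewrite mxE.
Qed.

Lemma vecmeasZ n p k a (f : 'cV[R]_n -> 'cV[R]_p -> 'cV[R]_k) :
  rmeas a -> vecmeas f -> vecmeas (fun y b => a y b *: f y b).
Proof.
move=> ma mf i; have := rmeasM ma (mf i).
by congr rmeas; apply/funext => y; apply/funext => b; rewrite mxE.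
Qed.

Lemma vecmeasN n p k (f : 'cV[R]_n -> 'cV[R]_p -> 'cV[R]_k) :
  vecmeas f -> vecmeas (fun y b => - f y b).
Proof.
move=> mf i; have := rmeasN (mf i).
by congr rmeas; apply/funext => y; apply/funext => b; rewrite mxE.
Qed.

Lemma vecmeasB n p k (f g : 'cV[R]_n -> 'cV[R]_p -> 'cV[R]_k) :
  vecmeas f -> vecmeas g -> vecmeas (fun y b => f y b - g y b).
Proof. by move=> mf mg; apply: vecmeasD => //; exact: vecmeasN. Qed.

Lemma vecmeas_mulmx n p k l (A : 'M[R]_(l, k)) (f : 'cV[R]_n -> 'cV[R]_p -> 'cV[R]_k) :
  vecmeas f -> vecmeas (fun y b => A *m f y b).
Proof.
move=> mf i; have : rmeas (fun y b => \sum_(j < k) A i j * f y b j 0).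
  by apply: rmeas_sum => j; apply: rmeasM => //; exact: rmeas_cst.
by congr rmeas; apply/funext => y; apply/funext => b; rewrite mxE.
Qed.

Lemma rmeas_dot n p k (f g : 'cV[R]_n -> 'cV[R]_p -> 'cV[R]_k) :
  vecmeas f -> vecmeas g -> rmeas (fun y b => dot (f y b) (g y b)).
Proof. by move=> mf mg; apply: rmeas_sum => i; exact: rmeasM. Qed.

Lemma rmeas_norm2_sqr n p k (f : 'cV[R]_n -> 'cV[R]_p -> 'cV[R]_k) :
  vecmeas f -> rmeas (fun y b => norm2 (f y b) ^+ 2).
Proof.
move=> mf; have := rmeas_dot mf mf.
by congr rmeas; apply/funext => y; apply/funext => b; rewrite norm2_sqr.
Qed.

Lemma rmeas_gauss n p k (mu f : 'cV[R]_n -> 'cV[R]_p -> 'cV[R]_k) :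
  vecmeas mu -> vecmeas f -> rmeas (fun y b => gauss_density (mu y b) (f y b)).
Proof.
move=> mmu mf; apply: rmeasM; first exact: rmeas_cst.
apply: rmeas_expR; apply: rmeasN; apply: rmeasM; last exact: rmeas_cst.
exact: rmeas_norm2_sqr (vecmeasB mf mmu).
Qed.

End Measurable.

(** * Gaussian integrals *)

Section Gauss.
Context {R : realType}.
Notation leb := (@lebesgue_measure R).

Lemma gauss_density_prod n (mu y : 'cV[R]_n) :
  gauss_density mu y = \prod_(i < n) normal_pdf (mu i 0) 1 (y i 0).
Proof.
under eq_bigr do rewrite normal_pdfE ?oner_eq0//.
rewrite big_split/= /gauss_density; congr (_ * _).
  rewrite prodr_const card_ord /normal_peak expr1n mul1r powRN (mulrC n%:R) powRrM.
  rewrite powR12_sqrt ?mulr_ge0 ?pi_ge0// powR_mulrn ?sqrtr_ge0// -exprVn.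
  by rewrite -(mulr_natl pi).
rewrite norm2_sqr /dot mulr_suml -sumrN expR_sum; apply: eq_bigr => i _.
by rewrite /normal_fun !mxE expr1n mulr2n -expr2 mulNr.
Qed.

Lemma gauss_density_ge0 n (mu y : 'cV[R]_n) : 0 <= gauss_density mu y.
Proof. by rewrite mulr_ge0 ?powR_ge0 ?expR_ge0. Qed.

(** Cameron-Martin: an exponential tilt of the Gaussian is a shift of its mean, so its total mass is
    one whatever [v] is. *)
Lemma gauss_density_shift n (mu v y : 'cV[R]_n) :
  gauss_density mu y * expR (dot (y - mu) v - dot v v / 2) = gauss_density (mu + v) y.
Proof.
rewrite /gauss_density -mulrA -expRD; congr (_ * expR _).
have -> : y - (mu + v) = (y - mu) - v by rewrite opprD addrA.
rewrite !norm2_sqr; move: (y - mu) => e.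
rewrite dotBl !dotBr (dotC v e); lra.
Qed.

Lemma iint_gauss n (mu y0 : 'cV[R]_n) :
  iint (enum 'I_n) (fun y => (gauss_density mu y)%:E) y0 = 1%E.
Proof.
have := @iint_prod R n (enum 'I_n) (fun=> 1) (fun i => normal_pdf (mu i 0) 1) (fun=> 1) y0.
rewrite enum_uniq mul1r big1// => <-//.
- by apply: eq_iint => y; rewrite mul1r gauss_density_prod big_enum.
- by move=> i x; exact: normal_pdf_ge0.
- by move=> i; exact: measurable_normal_pdf.
- by move=> i; exact: integral_normal_pdf.
Qed.

Lemma iint_gauss_exp n (mu v y0 : 'cV[R]_n) :
  iint (enum 'I_n) (fun y => (gauss_density mu y * expR (dot (y - mu) v - dot v v / 2))%:E) y0
  = 1%E.
Proof. by under eq_iint do rewrite gauss_density_shift; exact: iint_gauss. Qed.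

Fixpoint orthonormal_seq n (us : seq 'cV[R]_n) : Prop :=
  if us is u :: us' then
    [/\ dot u u = 1, (forall v, v \in us' -> dot u v = 0) & orthonormal_seq us']
  else True.

Definition qform n (us : seq 'cV[R]_n) (e : 'cV[R]_n) : R := \sum_(u <- us) dot e u ^+ 2.

Lemma normal_pdf_exp (a g : R) : normal_pdf 0 1 g * expR (g * a) = expR (a ^+ 2 / 2) * normal_pdf a 1 g.
Proof.
rewrite !normal_pdfE ?oner_eq0// mulrCA -mulrA; congr (_ * _).
rewrite /normal_fun -!expRD; congr expR; by field.
Qed.

(** Since - g^2/2 + g^2/4 = - g^2/4, the factor doubles the variance; the constant is the ratio of
    the two normalisations. *)
Lemma normal_pdf_exp_sqr (g : R) :
  normal_pdf 0 1 g * expR (g ^+ 2 / 4) = Num.sqrt 2 * normal_pdf 0 (Num.sqrt 2) g.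
Proof.
have s20 : Num.sqrt 2 != 0 :> R by rewrite sqrtr_eq0 -ltNge.
rewrite !normal_pdfE ?oner_eq0// -mulrA [RHS]mulrA; congr (_ * _).
  rewrite /normal_peak expr1n mul1r sqr_sqrtr// -mulrnAr sqrtrM// invfM mulrA divff//.
  by rewrite mul1r.
rewrite /normal_fun -!expRD sqr_sqrtr//; congr expR; by field.
Qed.

Lemma rmeas_qform n p k us (f : 'cV[R]_n -> 'cV[R]_p -> 'cV[R]_k) :
  vecmeas f -> rmeas (fun y b => qform us (f y b)).
Proof.
move=> mf; apply: rmeas_sum => u.
have := rmeas_dot mf (vecmeas_cst u) => m1.
have := rmeasM m1 m1.
by congr rmeas; apply/funext => y; apply/funext => b; rewrite expr2.
Qed.

(* Induction on [us]: the factor exp(<e,u>^2/4) is an average of exp(g<e,u>/sqrt 2)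
   over a standard Gaussian g, and each such exponential shifts the mean along u,
   which is orthogonal to the remaining vectors. *)
Lemma iint_gauss_qform n (us : seq 'cV[R]_n) (mu y0 : 'cV[R]_n) : orthonormal_seq us ->
  iint (enum 'I_n) (fun y => (gauss_density mu y * expR (qform us (y - mu) / 4))%:E) y0
  = (Num.sqrt 2 ^+ size us)%:E.
Proof.
elim: us mu => [|u us IH] mu /=.
  move=> _; under eq_iint do rewrite /qform big_nil mul0r expR0 mulr1.
  exact: iint_gauss.
move=> [uu uus ous].
(* The auxiliary Gaussian is stored as a vector of length one so that [iint_swap] exchanges it with
   [y]. *)
pose F (y : 'cV[R]_n) (g : 'cV[R]_1) := (gauss_density mu y * expR (qform us (y - mu) / 4) *
  (normal_pdf 0 1 (g 0 0) * expR (g 0 0 * (dot (y - mu) u / Num.sqrt 2))))%:E.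
have F0 y g : (0 <= F y g)%E.
  by rewrite /F lee_fin mulr_ge0 // mulr_ge0 ?gauss_density_ge0 ?expR_ge0 ?normal_pdf_ge0.
have s2 : Num.sqrt 2 ^+ 2 = 2 :> R by rewrite sqr_sqrtr.
have s20 : Num.sqrt 2 != 0 :> R by rewrite sqrtr_eq0 -ltNge.
have mg : rmeas (fun (y : 'cV[R]_n) (g : 'cV[R]_1) => g 0 0) by exact: (vecmeas_snd 0).
have my : vecmeas (fun (y : 'cV[R]_n) (g : 'cV[R]_1) => y - mu).
  by apply: vecmeasB; [exact: vecmeas_fst|exact: vecmeas_cst].
have mF : jmeas F.
  apply: rmeas_EFin; apply: rmeasM; apply: rmeasM.
  - by apply: rmeas_gauss; [exact: vecmeas_cst|exact: vecmeas_fst].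
  - apply: rmeas_expR; apply: rmeasM; [exact: rmeas_qform|exact: rmeas_cst].
  - apply: (rmeas_comp (F := normal_pdf 0 1)) mg; exact: measurable_normal_pdf.
  - apply: rmeas_expR; apply: rmeasM => //; apply: rmeasM; last exact: rmeas_cst.
    by apply: rmeas_dot => //; exact: vecmeas_cst.
transitivity (iint (enum 'I_n) (fun y => iint [:: 0] (F y) 0) y0).
  apply: eq_iint => y /=; rewrite /F.
  under eq_integral do rewrite setcE eqxx normal_pdf_exp mulrA EFinM.
  rewrite ge0_integralZl_EFin//.
  - rewrite integral_normal_pdf mule1 -mulrA -expRD; congr (_ * expR _)%:E.
    rewrite /qform big_cons expr_div_n s2; lra.
  - by move=> x _; rewrite lee_fin normal_pdf_ge0.
  - by apply/measurable_EFinP; exact: measurable_normal_pdf.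
  - by rewrite mulr_ge0 ?expR_ge0// mulr_ge0 ?gauss_density_ge0 ?expR_ge0.
rewrite (iint_swap (enum 'I_n) [:: 0] y0 0 F0 mF) /=.
have E x : iint (enum 'I_n) (F^~ (setc 0 0 x)) y0 =
    ((Num.sqrt 2 ^+ size us * Num.sqrt 2)%:E * (normal_pdf 0 (Num.sqrt 2) x)%:E)%E.
  pose v := (x / Num.sqrt 2) *: u.
  have vv : dot v v = x ^+ 2 / 2 by rewrite dotZl dotZr uu mulr1 -expr2 expr_div_n s2.
  transitivity (iint (enum 'I_n) (fun y => (normal_pdf 0 1 x * expR (x ^+ 2 / 4))%:E *
     (gauss_density (mu + v) y * expR (qform us (y - (mu + v)) / 4))%:E)%E y0).
    apply: eq_iint => y; rewrite /F setcE eqxx -EFinM -gauss_density_shift; congr EFin.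
    have -> : qform us (y - (mu + v)) = qform us (y - mu).
      apply: eq_big_seq => w wus; congr (_ ^+ 2).
      by rewrite opprD addrA (dotBl (y - mu)) /v dotZl uus// mulr0 subr0.
    rewrite vv dotZr.
    have -> : x / Num.sqrt 2 * dot (y - mu) u - x ^+ 2 / 2 / 2 =
      x * (dot (y - mu) u / Num.sqrt 2) - x ^+ 2 / 4 by field.
    rewrite expRD expRN; field; exact: lt0r_neq0 (expR_gt0 _).
  rewrite iintZl.
  - by rewrite IH// normal_pdf_exp_sqr -!EFinM; congr EFin; ring.
  - by rewrite mulr_ge0 ?expR_ge0 ?normal_pdf_ge0.
  - by move=> y; rewrite lee_fin mulr_ge0 ?gauss_density_ge0 ?expR_ge0.
  - apply: rmeas_EFin; apply: rmeasM.
      by apply: rmeas_gauss; [exact: vecmeas_cst|exact: vecmeas_snd].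
    apply: rmeas_expR; apply: rmeasM; last exact: rmeas_cst.
    by apply: rmeas_qform; apply: vecmeasB; [exact: vecmeas_snd|exact: vecmeas_cst].
under eq_integral do rewrite E.
rewrite ge0_integralZl_EFin//.
- by rewrite integral_normal_pdf mule1 exprSr.
- by move=> x _; rewrite lee_fin normal_pdf_ge0.
- by apply/measurable_EFinP; exact: measurable_normal_pdf.
Qed.

End Gauss.

(** * The Laplace integral *)

Section LaplaceIntegral.
Import numFieldNormedType.Exports.
Context {R : realType}.
Notation leb := (@lebesgue_measure R).

Lemma continuous_exp_affine (c a : R) : continuous (fun z : R => expR (- c * (z - a))).
Proof.
move=> z; apply: (@continuous_comp R R R (fun z => - c * (z - a)) expR); last exact: continuous_expR.
by apply: cvgM; [exact: cvg_cst|apply: cvgB; [exact: cvg_id|exact: cvg_cst]].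
Qed.

Lemma integral_exp_itvcy (c a : R) : 0 < c ->
  (\int[leb]_(x in `[a, +oo[) (expR (- c * (x - a)))%:E = (c^-1)%:E)%E.
Proof.
move=> c0; pose F (x : R) := - c^-1 * expR (- c * (x - a)).
have cF : continuous F.
  by move=> z; apply: cvgM; [exact: cvg_cst|exact: continuous_exp_affine].
have dF (x : R) : is_derive x 1 F (expR (- c * (x - a))).
  apply: is_derive_eq; rewrite /GRing.scale/=; field; lra.
rewrite (@ge0_continuous_FTC2y _ _ F _ 0).
- by rewrite /F subrr mulr0 expR0 sub0e -EFinN mulr1 opprK.
- by move=> x _; exact: expR_ge0.
- by apply: continuous_subspaceT; exact: continuous_exp_affine.
- rewrite -(mulr0 (- c^-1 * expR (c * a))).
  rewrite (_ : F = (fun x => (- c^-1 * expR (c * a)) * expR (- (c * x)))); last first.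
    by apply/funext => x; rewrite /F -mulrA -expRD; congr (_ * expR _); ring.
  apply: cvgM; first exact: cvg_cst.
  apply: (@cvg_comp _ _ _ (fun x => c * x) (fun z => expR (- z)) _ (pinfty_nbhs R));
    last exact: cvgr_expR.
  exact: gt0_cvgMry.
- by move=> x _; apply: ex_derive.
- by apply/cvg_at_right_filter; exact: cF.
- by move=> x _; rewrite derive1E derive_val.
Qed.

Lemma integral_laplace (c a : R) : 0 < c ->
  (\int[leb]_(x in setT) (expR (- (c * `|x - a|)))%:E = (2 / c)%:E)%E.
Proof.
move=> c0; pose f (x : R) := expR (- (c * `|x - a|)).
have mf : measurable_fun setT (EFin \o f).
  apply/measurable_EFinP; apply: (measurableT_comp (@measurable_expR R)).
  apply: (measurableT_comp (@oppr_measurable R setT)).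
  apply: measurable_funM; first exact: measurable_cst.
  apply: (measurableT_comp (@normr_measurable R setT)).
  by apply: measurable_funB; [exact: measurable_id|exact: measurable_cst].
rewrite -(setUv `[a, +oo[%classic) ge0_integral_setU//=; last 3 first.
  exact: measurableC.
  by rewrite setUv.
  exact/disj_setPCl.
have -> : (\int[leb]_(x in `[a, +oo[) (expR (- (c * `|x - a|)))%:E = (c^-1)%:E)%E.
  rewrite -(integral_exp_itvcy a c0); apply: eq_integral => x.
  by rewrite inE/= in_itv/= andbT => ax; rewrite ger0_norm ?subr_ge0// mulNr.
rewrite setCitvr (integral_itv_bndo_bndc (f := EFin \o f)); last exact: measurable_funTS.
have cf : continuous f.
  move=> z; apply: (@continuous_comp R R R (fun z => - (c * `|z - a|)) expR); last exact: continuous_expR.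
  apply: cvgN; apply: cvgM; first exact: cvg_cst.
  by apply: cvg_norm; apply: cvgB; [exact: cvg_id|exact: cvg_cst].
(* The reflection x -> -x turns the left half-line into [-a, +oo[, where the previous lemma
   applies. *)
rewrite -{1}(opprK a) ge0_integration_by_substitutionNy; last 2 first.
  by apply: continuous_subspaceT.
  by move=> x _; exact: expR_ge0.
have -> : (\int[leb]_(x in `[(- a)%R, +oo[) ((f \o -%R) x)%:E = (c^-1)%:E)%E.
  rewrite -(integral_exp_itvcy (- a) c0); apply: eq_integral => x.
  rewrite inE/= in_itv/= andbT => ax; rewrite /f/= -opprD normrN ger0_norm; last lra.
  by congr (expR _)%:E; ring.
by rewrite -EFinD; congr EFin; field; lra.
Qed.

End LaplaceIntegral.

(** * Projections on column spans *)

Section Projection.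
Context {R : realType}.

Lemma orthonormal_coord n (us : seq 'cV[R]_n) (c : 'cV[R]_n -> R) u :
  orthonormal_seq us -> u \in us -> dot (\sum_(w <- us) c w *: w) u = c u.
Proof.
elim: us => [//|w us IH] [ww wus ous]; rewrite big_cons dotDl dotZl inE.
have [-> _|uw /= uus] := eqVneq u w.
  rewrite ww mulr1 dotC dot_sumr big_seq big1 ?addr0// => v vus.
  by rewrite dotZr wus// mulr0.
by rewrite wus// mulr0 add0r IH.
Qed.

Lemma gram_schmidt n (vs : seq 'cV[R]_n) : exists us : seq 'cV[R]_n,
  [/\ orthonormal_seq us, (size us <= size vs)%N &
      forall v, v \in vs -> v = \sum_(u <- us) dot v u *: u].
Proof.
elim: vs => [|v vs [us [ous sus spus]]]; first by exists [::].
pose r := v - \sum_(u <- us) dot v u *: u.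
have ru u : u \in us -> dot r u = 0.
  by move=> uus; rewrite dotBl (orthonormal_coord _ ous uus) subrr.
(* A vector already in the span adds nothing to the basis; columns of X may be dependent, so the
   size is only bounded. *)
have [r0|r0] := eqVneq r 0.
  exists us; split=> //; first exact: leqW.
  move=> w; rewrite inE => /orP[/eqP->|/spus//].
  by apply/eqP; rewrite -subr_eq0 -/r r0.
have nr0 : norm2 r != 0 by apply: contra r0 => /eqP/norm2_eq0 ->.
pose u0 := (norm2 r)^-1 *: r.
have u0u u : u \in us -> dot u0 u = 0 by move=> uus; rewrite dotZl ru// mulr0.
have u0u0 : dot u0 u0 = 1 by rewrite dotZl dotZr -norm2_sqr; field.
exists (u0 :: us); split => //= w; rewrite inE big_cons => /orP[/eqP->|wvs].
  have -> : dot v u0 = norm2 r.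
    have -> : v = r + \sum_(u <- us) dot v u *: u by rewrite subrK.
    rewrite dotDl (dotC (\sum_(u <- us) _)) dot_sumr big_seq big1 => [|u uus].
      by rewrite addr0 dotZr -norm2_sqr; field.
    by rewrite dotZr u0u// mulr0.
  by rewrite scalerA mulfV// scale1r subrK.
have -> : dot w u0 = 0.
  rewrite (spus _ wvs) dotC dot_sumr big_seq big1// => u uus.
  by rewrite dotZr u0u// mulr0.
by rewrite scale0r add0r; exact: spus.
Qed.

Lemma mulmx_colE n p (X : 'M[R]_(n, p)) (b : 'cV[R]_p) :
  X *m b = \sum_(j < p) b j 0 *: col j X.
Proof.
apply/colP => i; rewrite mxE summxE; apply: eq_bigr => j _.
by rewrite !mxE mulrC.
Qed.

Lemma suppE p (b : 'cV[R]_p) i : (i \in supp b) = (b i 0 != 0).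
Proof. by rewrite inE. Qed.

Lemma notin_supp p (b : 'cV[R]_p) (S : {set 'I_p}) i : supp b \subset S -> i \notin S -> b i 0 = 0.
Proof.
by move=> /fintype.subsetP bS iS; apply/eqP/negPn; rewrite -suppE; apply: contra iS; exact: bS.
Qed.

(** In coordinates of the orthonormal system, a b <= a^2/4 + b^2 term by term. The weight 1/4 leaves
    most of the quadratic gain intact. *)
Lemma dot_span_le n (us : seq 'cV[R]_n) (e w : 'cV[R]_n) :
  w = \sum_(u <- us) dot w u *: u -> dot e w <= norm2 w ^+ 2 / 4 + qform us e.
Proof.
move=> wE; have -> : dot e w = \sum_(u <- us) dot w u * dot e u.
  by rewrite {1}wE dot_sumr; apply: eq_bigr => u _; rewrite dotZr.
have -> : norm2 w ^+ 2 = \sum_(u <- us) dot w u * dot w u.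
  by rewrite norm2_sqr {2}wE dot_sumr; apply: eq_bigr => u _; rewrite dotZr.
rewrite mulr_suml /qform -big_split/=; apply: ler_sum => u _.
have := sqr_ge0 (dot w u / 2 - dot e u); rewrite !expr2; lra.
Qed.

(* [Us S] is an orthonormal basis of the span of the columns of X indexed by S, so
   [qform (Us S) e] is the squared norm of the projection of e on that span. *)
Lemma column_projections n p (X : 'M[R]_(n, p)) : exists Us : {set 'I_p} -> seq 'cV[R]_n,
  forall S, [/\ orthonormal_seq (Us S), (size (Us S) <= #|S|)%N &
    forall (b : 'cV[R]_p) e, supp b \subset S ->
      dot e (X *m b) <= norm2 (X *m b) ^+ 2 / 4 + qform (Us S) e].
Proof.
have H (S : {set 'I_p}) : exists us : seq 'cV[R]_n, [/\ orthonormal_seq us, (size us <= #|S|)%N &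
    forall (b : 'cV[R]_p) e, supp b \subset S ->
      dot e (X *m b) <= norm2 (X *m b) ^+ 2 / 4 + qform us e].
  have [us [ous sus spus]] := gram_schmidt [seq col j X | j <- enum S].
  exists us; split => //; first by rewrite size_map -cardE in sus.
  move=> b e bS; apply: dot_span_le; rewrite mulmx_colE.
  have E j : b j 0 *: col j X = \sum_(u <- us) dot (b j 0 *: col j X) u *: u.
    have [jS|/(notin_supp bS)->] := boolP (j \in S); last first.
      by rewrite scale0r big1// => u _; rewrite dot0l scale0r.
    rewrite {1}(spus (col j X)); last by apply: (map_f (fun j => col j X)); rewrite mem_enum.
    by rewrite scaler_sumr; apply: eq_bigr => u _; rewrite dotZl scalerA.
  rewrite [LHS](eq_bigr _ (fun j _ => E j)) exchange_big/=.
  by apply: eq_bigr => u _; rewrite -scaler_suml (dotC (\sum_(j < p) _)) dot_sumr;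
     congr (_ *: _); apply: eq_bigr => j _; rewrite dotC.
by exists (fun S => sval (cid (H S))) => S; case: cid.
Qed.

End Projection.

(** * Sums over models grouped by size *)

Section SubsetSums.
Context {R : realType}.

Lemma sum_set_card p (F : nat -> R) :
  \sum_(S : {set 'I_p}) F #|S| = \sum_(s < p.+1) 'C(p, s)%:R * F s.
Proof.
rewrite (partition_big (fun S : {set 'I_p} => inord #|S| : 'I_p.+1) xpredT)//=.
apply: eq_bigr => s _.
have cS (S : {set 'I_p}) : (#|S| < p.+1)%N by rewrite ltnS -[X in (_ <= X)%N]card_ord max_card.
have E (S : {set 'I_p}) : (inord #|S| == s) = (#|S| == s :> nat).
  by rewrite -val_eqE/= inordK.
under eq_bigl do rewrite E.
rewrite (eq_bigr (fun=> F s)) => [|S /eqP->//].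
rewrite sumr_const mulr_natl; have := card_draws 'I_p s; rewrite cardsE card_ord => <-.
by [].
Qed.

End SubsetSums.

(** * Posterior mass under a quiet noise *)

Section PosteriorBound.
Context {R : realType} (n p : nat) (X : 'M[R]_(n, p)) (prior : nat -> R) (lam : R).
Context (beta0 : 'cV[R]_p).
Hypothesis prior_ge0 : forall s, (s <= p)%N -> 0 <= prior s.
Hypothesis lam_gt0 : 0 < lam.
Context (Us : {set 'I_p} -> seq 'cV[R]_n).
Hypothesis UsP : forall S, [/\ orthonormal_seq (Us S), (size (Us S) <= #|S|)%N &
    forall (b : 'cV[R]_p) e, supp b \subset S ->
      dot e (X *m b) <= norm2 (X *m b) ^+ 2 / 4 + qform (Us S) e].

Notation L := (ln p%:R : R).

(** The constant 8 serves a union bound: exp (qform / 4) has expectation at most 2^|S|, exceeding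
    the threshold costs exp (- 2 |S| L), and there are at most exp (|S| L) models of the same
    size. *)
Definition quiet (y : 'cV[R]_n) :=
  forall S, qform (Us S) (y - X *m beta0) <= 8 * #|S|%:R * L.

Definition evidence (y : 'cV[R]_n) : \bar R :=
  prior_int prior lam (fun b => (likelihood X y b)%:E).

Definition set_weight (S : {set 'I_p}) : R := prior #|S| / 'C(p, #|S|)%:R.

Lemma set_weight_ge0 S : 0 <= set_weight S.
Proof. by rewrite divr_ge0// prior_ge0// -[X in (_ <= X)%N]card_ord max_card. Qed.

Lemma likelihood_ge0 y b : 0 <= likelihood X y b.
Proof. exact: expR_ge0. Qed.

Lemma laplace_ge0 x : 0 <= laplace lam x.
Proof. by rewrite /laplace mulr_ge0 ?expR_ge0// divr_ge0// ltW. Qed.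

Lemma prod_laplace_ge0 (S : {set 'I_p}) (b : 'cV[R]_p) : 0 <= \prod_(i in S) laplace lam (b i 0).
Proof. by apply: prodr_ge0 => i _; exact: laplace_ge0. Qed.

Lemma prior_int_ge0 (g : 'cV[R]_p -> \bar R) : (forall b, 0 <= g b)%E ->
  (0 <= prior_int prior lam g)%E.
Proof.
move=> g0; apply: sume_ge0 => S _; rewrite mule_ge0 ?lee_fin ?set_weight_ge0//.
by apply: iint_ge0 => b; rewrite mule_ge0 ?lee_fin ?prod_laplace_ge0.
Qed.

Lemma le_prior_int (g h : 'cV[R]_p -> \bar R) :
  (forall b, 0 <= g b)%E -> (forall b, g b <= h b)%E ->
  (prior_int prior lam g <= prior_int prior lam h)%E.
Proof.
move=> g0 gh; apply: lee_sum => S _; rewrite lee_wpmul2l ?lee_fin ?set_weight_ge0//.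
apply: le_iint => b; first by rewrite mule_ge0 ?lee_fin ?prod_laplace_ge0.
by move=> _; rewrite lee_wpmul2r ?lee_fin ?prod_laplace_ge0.
Qed.

Lemma indic_lik_ge0 (B : set 'cV[R]_p) y b : (0 <= ((\1_B b : R) * likelihood X y b)%:E)%E.
Proof. by rewrite lee_fin mulr_ge0 ?likelihood_ge0// indicE. Qed.

Lemma posterior_ge0 B y : 0 <= posterior X prior lam B y.
Proof.
rewrite divr_ge0// fine_ge0// prior_int_ge0// => b; first exact: indic_lik_ge0.
by rewrite lee_fin likelihood_ge0.
Qed.

Lemma posterior_le1 B y : posterior X prior lam B y <= 1.
Proof.
rewrite /posterior; set N := prior_int _ _ _; set D := prior_int _ _ _.
have N0 : (0 <= N)%E by apply: prior_int_ge0 => b; exact: indic_lik_ge0.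
have ND : (N <= D)%E.
  apply: le_prior_int => b; first exact: indic_lik_ge0.
  by rewrite lee_fin ler_piMl ?likelihood_ge0// indicE lern1 leq_b1.
have D0 : (0 <= D)%E := le_trans N0 ND.
case: D ND D0 => [d| |] ND D0 //=; last by rewrite invr0 mulr0.
case: N N0 ND => [a| |] //=; rewrite !lee_fin => a0 ad.
by have [->|d0] := eqVneq d 0; rewrite ?invr0 ?mulr0// ler_pdivrMr ?mul1r// lt_def d0.
Qed.

(* [J] dominates the unnormalised posterior mass of [B], relative to the evidence,
   on the event that the noise is quiet. *)
Definition dominates (B : set 'cV[R]_p) (J : {set 'I_p} -> 'cV[R]_n -> 'cV[R]_p -> R) :=
  forall y (S : {set 'I_p}) b, quiet y -> evidence y \is a fin_num -> supp b \subset S ->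
  (\1_B b : R) * likelihood X y b * \prod_(i in S) laplace lam (b i 0)
  <= fine (evidence y) * J S y b.

Lemma dominatesU B B1 B2 J1 J2 : B `<=` B1 `|` B2 ->
  dominates B1 J1 -> dominates B2 J2 -> dominates B (fun S y b => J1 S y b + J2 S y b).
Proof.
move=> BU d1 d2 y S b qy fy bS; rewrite mulrDr.
apply: le_trans (lerD (d1 y S b qy fy bS) (d2 y S b qy fy bS)).
rewrite -!mulrA -mulrDl ler_wpM2r ?mulr_ge0 ?likelihood_ge0 ?prod_laplace_ge0//.
rewrite !indicE; case: (boolP (b \in B)) => [/set_mem/BU[]/mem_set->|_]; rewrite ?lerDl ?lerDr//.
by rewrite addr_ge0.
Qed.

(** The noise is integrated inside, with [b] fixed, because the Gaussian factor of the later [J]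
    integrates exactly in that order. *)
Definition expected_mass (J : {set 'I_p} -> 'cV[R]_n -> 'cV[R]_p -> R) : \bar R :=
  (\sum_(S : {set 'I_p}) (set_weight S)%:E *
    iint (enum S) (fun b => iint (enum 'I_n)
      (fun y => (gauss_density (X *m beta0) y * J S y b)%:E) 0) 0)%E.

Lemma rmeas_gaussJ J : rmeas J -> rmeas (fun y (b : 'cV[R]_p) => gauss_density (X *m beta0) y * J y b).
Proof.
move=> mJ; apply: rmeasM => //.
by apply: rmeas_gauss; [exact: vecmeas_cst|exact: vecmeas_fst].
Qed.

Lemma expected_massD J1 J2 :
  (forall S y b, 0 <= J1 S y b) -> (forall S y b, 0 <= J2 S y b) ->
  (forall S, rmeas (J1 S)) -> (forall S, rmeas (J2 S)) ->
  expected_mass (fun S y b => J1 S y b + J2 S y b) = (expected_mass J1 + expected_mass J2)%E.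
Proof.
move=> J10 J20 mJ1 mJ2; rewrite /expected_mass -big_split/=; apply: eq_bigr => S _.
have G0 (J : {set 'I_p} -> 'cV[R]_n -> 'cV[R]_p -> R) : (forall S y b, 0 <= J S y b) -> forall y b,
    (0 <= (gauss_density (X *m beta0) y * J S y b)%:E)%E.
  by move=> J0 y b; rewrite lee_fin mulr_ge0 ?gauss_density_ge0.
have mG (J : {set 'I_p} -> 'cV[R]_n -> 'cV[R]_p -> R) : (forall S, rmeas (J S)) ->
    jmeas (fun y b => (gauss_density (X *m beta0) y * J S y b)%:E).
  by move=> mJ; apply: rmeas_EFin; exact: (rmeas_gaussJ (mJ S)).
rewrite -ge0_muleDr ?iint_ge0//; last 2 first.
- by move=> b; apply: iint_ge0 => y; exact: G0.
- by move=> b; apply: iint_ge0 => y; exact: G0.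
congr (_ * _)%E; rewrite -iintD.
- apply: eq_iint => b; rewrite -iintD.
  + by apply: eq_iint => y; rewrite mulrDr.
  + by move=> y; exact: G0.
  + by move=> y; exact: G0.
  + by apply: (jmeas_vmeas (f := fun b y => _) b); apply: jmeas_swap; exact: mG.
  + by apply: (jmeas_vmeas (f := fun b y => _) b); apply: jmeas_swap; exact: mG.
- by move=> b; apply: iint_ge0 => y; exact: G0.
- by move=> b; apply: iint_ge0 => y; exact: G0.
- have := jmeas_iint (enum 'I_n) (fun b y => G0 _ J10 y b) (jmeas_swap (mG _ mJ1)).
  by move/jmeas_swap/jmeas_vmeas; apply.
- have := jmeas_iint (enum 'I_n) (fun b y => G0 _ J20 y b) (jmeas_swap (mG _ mJ2)).
  by move/jmeas_swap/jmeas_vmeas; apply.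
Qed.

(** An exponential Markov bound for the indicator of noise that is not [quiet], measurable by
    construction. The empty model is left out: its basis is empty, so it never violates the
    threshold. *)
Definition noise_tail (y : 'cV[R]_n) : R :=
  \sum_(S : {set 'I_p} | (0 < #|S|)%N) expR (qform (Us S) (y - X *m beta0) / 4 - 2 * #|S|%:R * L).

Lemma noise_tail_ge1 y : ~ quiet y -> 1 <= noise_tail y.
Proof.
move=> /existsNP[S /negP]; rewrite -ltNge => hS.
have S0 : (0 < #|S|)%N.
  rewrite lt0n; apply: contraTneq hS => S0; rewrite S0 mulr0 mul0r -leNgt.
  have [_ + _] := UsP S; rewrite S0 leqn0 size_eq0 => /eqP->.
  by rewrite /qform big_nil.
rewrite /noise_tail (bigD1 S)//= -[leLHS]addr0 lerD//.
  by rewrite -[leLHS]expR0 ler_expR; lra.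
by apply: sumr_ge0 => T _; exact: expR_ge0.
Qed.

Lemma iint_noise_tail :
  (iint (enum 'I_n) (fun y => (gauss_density (X *m beta0) y * noise_tail y)%:E) 0 <=
   (\sum_(S : {set 'I_p} | (0 < #|S|)%N) (2 * expR (- (2 * L))) ^+ #|S|)%:E)%E.
Proof.
rewrite (@eq_iint _ _ _ _ (fun y => (\sum_(S : {set 'I_p} | (0 < #|S|)%N)
  ((expR (- (2 * #|S|%:R * L)))%:E *
   (gauss_density (X *m beta0) y * expR (qform (Us S) (y - X *m beta0) / 4))%:E))%E)); last first.
  move=> y; rewrite /noise_tail mulr_sumr -sumEFin; apply: eq_bigr => S _.
  by rewrite expRD -EFinM; congr EFin; ring.
have F0 S y : (0 <= (gauss_density (X *m beta0) y * expR (qform (Us S) (y - X *m beta0) / 4))%:E)%E.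
  by rewrite lee_fin mulr_ge0 ?gauss_density_ge0 ?expR_ge0.
have mF S : vmeas (fun y => (gauss_density (X *m beta0) y * expR (qform (Us S) (y - X *m beta0) / 4))%:E).
  apply: rmeas_EFin; apply: rmeasM.
    by apply: rmeas_gauss; [exact: vecmeas_cst|exact: vecmeas_snd].
  apply: rmeas_expR; apply: rmeasM; last exact: rmeas_cst.
  by apply: rmeas_qform; apply: vecmeasB; [exact: vecmeas_snd|exact: vecmeas_cst].
rewrite iint_sum.
- rewrite -sumEFin; apply: lee_sum => S _.
  rewrite iintZl ?expR_ge0//.
  have [oS sS _] := UsP S; rewrite (iint_gauss_qform _ _ oS) -EFinM lee_fin.
  have -> : expR (- (2 * #|S|%:R * L)) = expR (- (2 * L)) ^+ #|S|.
    by rewrite -expRM_natl; congr expR; ring.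
  rewrite exprMn mulrC ler_wpM2r ?exprn_ge0 ?expR_ge0//.
  have s22 : Num.sqrt 2 ^+ 2 = 2 :> R by rewrite sqr_sqrtr.
  have s2 : 1 <= Num.sqrt 2 :> R by rewrite -[leLHS]sqrtr1 ler_sqrt// ler1n.
  apply: (@le_trans _ _ (Num.sqrt 2 ^+ #|S|)); first exact: ler_weXn2l.
  by apply: lerXn2r; rewrite ?nnegrE ?sqrtr_ge0// -[leRHS]s22 expr2 ler_peMl ?sqrtr_ge0.
- by move=> S y; apply: mule_ge0; [rewrite lee_fin expR_ge0|exact: F0].
- move=> S _; have := mF S; rewrite /vmeas => m d T g h mg mh.
  by apply: measurable_funeM; exact: m.
Qed.

Lemma posterior_dominated B J y : (forall S y b, 0 <= J S y b) -> (forall S, rmeas (J S)) ->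
  dominates B J -> quiet y ->
  ((posterior X prior lam B y)%:E <=
   \sum_(S : {set 'I_p}) (set_weight S)%:E * iint (enum S) (fun b => (J S y b)%:E) 0)%E.
Proof.
move=> J0 mJ dBJ qy; set H := (X in (_ <= X)%E).
have H0 : (0 <= H)%E.
  apply: sume_ge0 => S _; rewrite mule_ge0 ?lee_fin ?set_weight_ge0//.
  by apply: iint_ge0 => b; rewrite lee_fin.
have D0 : (0 <= evidence y)%E by apply: prior_int_ge0 => b; rewrite lee_fin likelihood_ge0.
(* If the evidence is infinite, [fine] sends it to 0 and division by 0 gives 0, so the posterior
   vanishes and the bound is trivial. *)
have [fD|nD] := boolP (evidence y \is a fin_num); last first.
  rewrite /posterior -/(evidence y).
  have -> : fine (evidence y) = 0 by move: nD; case: (evidence y).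
  by rewrite invr0 mulr0.
rewrite /posterior -/(evidence y); set N := prior_int _ _ _.
have N0 : (0 <= N)%E by apply: prior_int_ge0 => b; exact: indic_lik_ge0.
have d0 : 0 <= fine (evidence y) by exact: fine_ge0.
have NH : (N <= (fine (evidence y))%:E * H)%E.
  rewrite /H ge0_sume_distrr; last first.
    move=> S _; rewrite mule_ge0 ?lee_fin ?set_weight_ge0//.
    by apply: iint_ge0 => b; rewrite lee_fin.
  apply: lee_sum => S _; rewrite muleCA lee_wpmul2l ?lee_fin ?set_weight_ge0//.
  rewrite -iintZl//; last 2 first.
  - by move=> b; rewrite lee_fin.
  - by apply: (jmeas_vmeas (f := fun y b => (J S y b)%:E)); exact: rmeas_EFin.
  apply: le_iint => b; first by rewrite mule_ge0 ?lee_fin ?prod_laplace_ge0// mulr_ge0 ?likelihood_ge0// indicE.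
  move=> b0; rewrite -!EFinM lee_fin; apply: dBJ => //.
  apply/fintype.subsetP => i; rewrite suppE; apply: contraR => iS.
  by rewrite b0 ?mem_enum// mxE.
have [->|dn0] := eqVneq (fine (evidence y)) 0; first by rewrite invr0 mulr0.
have dp : 0 < fine (evidence y) by rewrite lt_def dn0.
apply: (@le_trans _ _ ((fine (evidence y))^-1%:E * N)%E).
  rewrite mulrC EFinM lee_wpmul2l ?lee_fin ?invr_ge0//.
  by move: N0; case: (N).
apply: (@le_trans _ _ ((fine (evidence y))^-1%:E * ((fine (evidence y))%:E * H))%E).
  by rewrite lee_wpmul2l ?lee_fin ?invr_ge0.
by rewrite muleA -EFinM mulVf// mul1e.
Qed.

(** Where the noise is not quiet, the posterior is at most 1, hence at most [noise_tail]; elsewhere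
    it is dominated through [J]. Tonelli then moves the noise integral inside. *)
Lemma post_expect_le B J : (forall S y b, 0 <= J S y b) -> (forall S, rmeas (J S)) ->
  dominates B J ->
  (post_expect X prior lam beta0 B <=
   (\sum_(S : {set 'I_p} | (0 < #|S|)%N) (2 * expR (- (2 * L))) ^+ #|S|)%:E + expected_mass J)%E.
Proof.
move=> J0 mJ dBJ.
pose g y := gauss_density (X *m beta0) y.
have g0 y : 0 <= g y by exact: gauss_density_ge0.
pose H y : \bar R := (\sum_(S : {set 'I_p}) (set_weight S)%:E * iint (enum S) (fun b => (J S y b)%:E) 0)%E.
have iJ0 (S : {set 'I_p}) y : (0 <= iint (enum S) (fun b => (J S y b)%:E) 0)%E.
  by apply: iint_ge0 => b; rewrite lee_fin.
have wJ0 (S : {set 'I_p}) y : (0 <= (set_weight S)%:E * iint (enum S) (fun b => (J S y b)%:E) 0)%E.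
  by rewrite mule_ge0 ?lee_fin ?set_weight_ge0.
have H0 y : (0 <= H y)%E by apply: sume_ge0.
have nt0 y : 0 <= noise_tail y by apply: sumr_ge0 => S _; exact: expR_ge0.
have vg m : rmeas (fun (_ : 'cV[R]_m) (y : 'cV[R]_n) => g y).
  by apply: rmeas_gauss; [exact: vecmeas_cst|exact: vecmeas_snd].
have vJ (S : {set 'I_p}) : vmeas (fun y => iint (enum S) (fun b => (J S y b)%:E) 0).
  have := jmeas_iint (enum S) (fun y b => _ : (0 <= (J S y b)%:E)%E) (rmeas_EFin (mJ S)).
  move=> /(_ (fun y b => J0 S y b))/jmeas_swap/jmeas_vmeas; apply.
have vgJ (S : {set 'I_p}) : vmeas (fun y => (g y)%:E * iint (enum S) (fun b => (J S y b)%:E) 0)%E.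
  move=> d T h1 h2 m1 m2; apply: emeasurable_funM; last exact: (vJ S _ _ h1).
  exact: (rmeas_EFin (vg 0)).
apply: (@le_trans _ _ (iint (enum 'I_n) (fun y => (g y * noise_tail y)%:E + (g y)%:E * H y)%E 0)).
  apply: le_iint => [y|y _]; first by rewrite lee_fin mulr_ge0 ?posterior_ge0.
  have [qy|nqy] := pselect (quiet y).
    rewrite -[leLHS]add0e; apply: leeD; first by rewrite lee_fin mulr_ge0.
    by rewrite EFinM; apply: lee_wpmul2l; [rewrite lee_fin|exact: posterior_dominated].
  rewrite -[leLHS]adde0 leeD ?mule_ge0 ?lee_fin// ler_wpM2l//.
  exact: le_trans (posterior_le1 _ _) (noise_tail_ge1 nqy).
have E y : ((g y)%:E * H y = \sum_(S : {set 'I_p}) (set_weight S)%:E *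
    ((g y)%:E * iint (enum S) (fun b => (J S y b)%:E) 0))%E.
  by rewrite ge0_sume_distrr//; apply: eq_bigr => S _; rewrite muleCA.
rewrite iintD.
- apply: leeD; first exact: iint_noise_tail.
  under eq_iint do rewrite E.
  rewrite iint_sum//; last 2 first.
  + by move=> S y; rewrite !mule_ge0 ?lee_fin ?set_weight_ge0.
  + move=> S _ d T h1 h2 m1 m2; apply: measurable_funeM; exact: (vgJ S _ _ h1).
  apply: lee_sum => S _; rewrite iintZl ?set_weight_ge0//; last first.
    by move=> y; rewrite mule_ge0 ?lee_fin.
  rewrite lee_wpmul2l ?lee_fin ?set_weight_ge0//.
  rewrite -(@iint_swap _ _ _ (fun y b => (gauss_density (X *m beta0) y * J S y b)%:E)).
  + rewrite le_eqVlt; apply/orP; left; apply/eqP; apply: eq_iint => y.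
    rewrite -iintZl//; last 2 first.
    * by move=> b; rewrite lee_fin.
    * by apply: (jmeas_vmeas (f := fun y b => (J S y b)%:E)); exact: rmeas_EFin.
  + by move=> y b; rewrite lee_fin mulr_ge0.
  + by apply: rmeas_EFin; exact: (rmeas_gaussJ (mJ S)).
- by move=> y; rewrite lee_fin mulr_ge0.
- by move=> y; rewrite mule_ge0 ?lee_fin.
- apply: rmeas_EFin; apply: rmeasM; first exact: vg.
  apply: rmeas_sum => S; apply: rmeas_expR; apply: rmeasD; last exact: rmeas_cst.
  apply: rmeasM; last exact: rmeas_cst.
  by apply: rmeas_qform; apply: vecmeasB; [exact: vecmeas_snd|exact: vecmeas_cst].
- have -> : (fun y => (g y)%:E * H y)%E = (fun y => \sum_(S : {set 'I_p}) (set_weight S)%:E *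
    ((g y)%:E * iint (enum S) (fun b => (J S y b)%:E) 0))%E by apply/funext.
  apply: vmeas_sum; first by move=> S y; rewrite !mule_ge0 ?lee_fin ?set_weight_ge0.
  by move=> S _ d T h1 h2 m1 m2; apply: measurable_funeM; exact: (vgJ S _ _ h1).
Qed.

End PosteriorBound.

(** * Norm inequalities for sparse vectors *)

Section Norms.
Context {R : realType}.

Lemma norm1_ge0 p (b : 'cV[R]_p) : 0 <= norm1 b.
Proof. by apply: sumr_ge0. Qed.

Lemma norm1_on_ge0 p (S : {set 'I_p}) (b : 'cV[R]_p) : 0 <= norm1_on S b.
Proof. by apply: sumr_ge0. Qed.

Lemma norm1_split p (S : {set 'I_p}) (b : 'cV[R]_p) :
  norm1 b = norm1_on S b + norm1_on (~: S) b.
Proof.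
rewrite /norm1 (bigID (mem S))/=; congr (_ + _).
by apply: eq_bigl => i; rewrite inE.
Qed.

Lemma norm1_on_supp p (S : {set 'I_p}) (b : 'cV[R]_p) : supp b \subset S -> norm1_on S b = norm1 b.
Proof.
move=> bS; rewrite (norm1_split S) [X in _ + X]big1 ?addr0// => i.
by rewrite inE => /(notin_supp bS)->; rewrite normr0.
Qed.

Lemma norm1_triangle p (u v : 'cV[R]_p) : norm1 (u + v) <= norm1 u + norm1 v.
Proof. by rewrite /norm1 -big_split; apply: ler_sum => i _; rewrite mxE ler_normD. Qed.

Lemma norm1_sub p (u v : 'cV[R]_p) : norm1 (u - v) = norm1 (v - u).
Proof. by apply: eq_bigr => i _; rewrite !mxE distrC. Qed.

Lemma norm2_sum_le n I (r : seq I) (P : pred I) (F : I -> 'cV[R]_n) :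
  norm2 (\sum_(i <- r | P i) F i) <= \sum_(i <- r | P i) norm2 (F i).
Proof.
elim/big_rec2: _ => [|i x y _ h]; first by rewrite norm2_0.
by apply: le_trans (norm2_triangle _ _) _; rewrite lerD2l.
Qed.

Lemma norm2_mulmx_le n p (X : 'M[R]_(n, p)) (N : R) (b : 'cV[R]_p) :
  (forall j, norm2 (col j X) <= N) -> norm2 (X *m b) <= N * norm1 b.
Proof.
move=> XN; rewrite mulmx_colE; apply: le_trans (norm2_sum_le _ _ _) _.
rewrite /norm1 mulr_sumr; apply: ler_sum => j _.
by rewrite norm2Z mulrC ler_wpM2r.
Qed.

Lemma supp_sub_subset p (b c : 'cV[R]_p) (S : {set 'I_p}) :
  supp b \subset S -> supp c \subset S -> supp (b - c) \subset S.
Proof.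
move=> bS cS; apply/fintype.subsetP => i; rewrite suppE; apply: contraR => iS.
by rewrite !mxE (notin_supp bS iS) (notin_supp cS iS) subrr.
Qed.

End Norms.

(** * The evidence and the dominating function *)

Section EvidenceBounds.
Context {R : realType} (n p : nat) (X : 'M[R]_(n, p)) (prior : nat -> R) (lam : R).
Context (beta0 : 'cV[R]_p).
Hypothesis prior_ge0 : forall s, (s <= p)%N -> 0 <= prior s.
Hypothesis lam_gt0 : 0 < lam.
Context (Us : {set 'I_p} -> seq 'cV[R]_n).
Hypothesis UsP : forall S, [/\ orthonormal_seq (Us S), (size (Us S) <= #|S|)%N &
    forall (b : 'cV[R]_p) e, supp b \subset S ->
      dot e (X *m b) <= norm2 (X *m b) ^+ 2 / 4 + qform (Us S) e].
Notation L := (ln p%:R : R).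
Context (N : R).
Hypothesis N_gt0 : 0 < N.
Hypothesis XN : forall j, norm2 (col j X) <= N.
Hypothesis p_gt0 : (0 < p)%N.
Hypothesis lam_lo : N / p%:R <= lam.
Hypothesis lam_hi : lam <= 4 * N * Num.sqrt L.
Context (bs : 'cV[R]_p).
Notation quiet := (quiet X beta0 Us).
Notation evidence := (evidence X prior lam).
Notation set_weight := (set_weight prior).
Notation s := #|supp bs|.
Notation Delta := (norm2 (X *m (bs - beta0))).

Let L_ge0 : 0 <= L.
Proof. by rewrite ln_ge0// ler1n. Qed.

(** The projection bound for the model {j}, tested on the vectors with entry 1/N or -1/N at j: their
    image has norm at most 1, which gives 1/4 + 8 L. *)
Lemma col_noise y j : quiet y -> `|dot (y - X *m beta0) (col j X)| <= N * (1 + 8 * L).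
Proof.
move=> qy; set e := y - _.
have H (c : R) : `|c| = N^-1 -> c * dot e (col j X) <= 1 + 8 * L.
  move=> cN; pose b : 'cV[R]_p := c *: delta_mx j 0.
  have Xb : X *m b = c *: col j X by rewrite -scalemxAr colE.
  have bS : supp b \subset [set j]%SET.
    apply/fintype.subsetP => i; rewrite suppE inE; apply: contraR => /negPf ij.
    by rewrite !mxE ij mulr0.
  have [_ _ /(_ b e bS)] := UsP [set j]%SET.
  have := qy [set j]%SET; rewrite cards1 -/e Xb dotZr norm2Z cN exprMn.
  have : (N^-1) ^+ 2 * norm2 (col j X) ^+ 2 <= 1.
    rewrite -exprMn; apply: exprn_ile1; last by rewrite ler_pdivrMl// mulr1.
    by rewrite mulr_ge0 ?norm2_ge0// invr_ge0 ltW.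
  lra.
have NV : 0 < N^-1 by rewrite invr_gt0.
rewrite ler_norml; apply/andP; split.
  have := H (- N^-1); rewrite normrN gtr0_norm// => /(_ erefl).
  by move=> h; rewrite lerNl -ler_pdivrMl// mulrN -mulNr.
have := H N^-1; rewrite gtr0_norm// => /(_ erefl).
by rewrite ler_pdivrMl.
Qed.

Lemma noise_l1 y u : quiet y -> `|dot (y - X *m beta0) (X *m u)| <= N * (1 + 8 * L) * norm1 u.
Proof.
move=> qy; rewrite (mulmx_colE X u) dot_sumr; apply: le_trans (ler_norm_sum _ _ _) _.
rewrite /norm1 mulr_sumr; apply: ler_sum => j _.
by rewrite dotZr normrM mulrC ler_wpM2r// col_noise.
Qed.

Lemma likelihood_shift y b : likelihood X y b = expR (- (norm2 (y - X *m bs) ^+ 2 / 2)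
  + dot (y - X *m beta0) (X *m (b - bs)) + dot (X *m (beta0 - bs)) (X *m (b - bs))
  - norm2 (X *m (b - bs)) ^+ 2 / 2).
Proof.
rewrite /likelihood; congr expR.
have -> : y - X *m b = (y - X *m bs) - X *m (b - bs) by rewrite mulmxBr opprB addrA subrK.
have -> : dot (X *m (beta0 - bs)) (X *m (b - bs)) =
    dot (y - X *m bs) (X *m (b - bs)) - dot (y - X *m beta0) (X *m (b - bs)).
  by rewrite -dotBl mulmxBr; congr dot; rewrite opprB [RHS]addrC addrA subrK.
move: (y - X *m bs) (X *m (b - bs)) => e v.
rewrite !norm2_sqr dotBl !dotBr (dotC v e); lra.
Qed.

(** Cost of the box around [bs]. Each coordinate pays the box width times the Laplace density, with
    exp (- 1) for the variation of that density over the box. In exp (- 2), one unit covers the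
    noise and one the quadratic term in X (b - bs); Delta^2 / 2 comes from the cross term. *)
Notation prior_floor := (set_weight (supp bs) *
  (expR (- 1) / (p%:R * s%:R * (1 + 8 * L))) ^+ s * expR (- 2 - Delta ^+ 2 / 2)).

Lemma integral_box (c a h : R) : 0 <= c -> 0 <= h ->
  (\int[@lebesgue_measure R]_(x in setT) (c * \1_(`[a - h, a + h]%classic) x)%:E = (c * (2 * h))%:E)%E.
Proof.
move=> c0 h0; under eq_integral do rewrite EFinM.
have mI : measurable (`[a - h, a + h]%classic : set (measurableTypeR R)) by exact: measurable_itv.
rewrite ge0_integralZl_EFin//.
- rewrite integral_indic//= setIT lebesgue_measure_itv/= lte_fin.
  case: ifPn => [_|]; first by rewrite -EFinB -EFinM; congr EFin; ring.
  by rewrite -leNgt => ?; rewrite (_ : h = 0) ?mulr0 ?mule0 ?mulr0//; lra.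
- by apply/measurable_EFinP; exact: measurable_indic.
Qed.

(* The evidence is bounded below by its part on a small box around [bs]. *)
Lemma evidence_ge y : quiet y ->
  ((prior_floor * expR (- (norm2 (y - X *m bs) ^+ 2 / 2) - lam * norm1 bs))%:E <= evidence y)%E.
Proof.
move=> qy; set C := - (norm2 (y - X *m bs) ^+ 2 / 2) - lam * norm1 bs.
(* The width makes s h N (1 + 8 L) at most 1, which bounds the noise term, the norm of X (b - bs)
   and [lam * h] by 1 at once. For s = 0 the inverse of 0 gives h = 0 and all products are empty. *)
pose h : R := (s%:R * N * (1 + 8 * L))^-1.
have L0 : 0 <= L := L_ge0.
have L8 : 0 < 1 + 8 * L by lra.
have h0 : 0 <= h by rewrite invr_ge0 !mulr_ge0// ltW.
have sh : s%:R * h * (N * (1 + 8 * L)) <= 1.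
  rewrite /h; have [->|s0] := eqVneq s 0%N; first by rewrite !mul0r.
  have s0' : s%:R != 0 :> R by rewrite pnatr_eq0.
  by rewrite le_eqVlt; apply/orP; left; apply/eqP; field; rewrite s0' !gt_eqF.
have lh i : i \in supp bs -> lam * h <= 1 /\ (p%:R * s%:R * (1 + 8 * L))^-1 <= lam * h.
  move=> iS; have s1 : 1 <= s%:R :> R by rewrite ler1n; apply/card_gt0P; exists i.
  have p1 : 0 < p%:R :> R by rewrite ltr0n.
  have s0' : 0 < s%:R :> R by lra.
  split.
    rewrite /h ler_pdivrMr ?mul1r ?mulr_gt0//.
    have q2 : Num.sqrt L ^+ 2 = L by rewrite sqr_sqrtr.
    have q3 : 4 * Num.sqrt L <= 1 + 8 * L.
      by have := sqr_ge0 (2 * Num.sqrt L - 1); rewrite sqrrB exprMn q2; lra.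
    apply: le_trans lam_hi _; apply: (@le_trans _ _ (N * (1 + 8 * L))).
      by rewrite (_ : 4 * N * Num.sqrt L = N * (4 * Num.sqrt L)) ?ler_pM2l//; ring.
    by rewrite ler_wpM2r ?(ltW L8)// ler_peMl ?(ltW N_gt0).
  (* The lower bound on [lam] enters here: it keeps the slab mass of the box from being smaller than
     an inverse polynomial in p and s, up to the factor 1 + 8 L. *)
  rewrite /h; apply: (@le_trans _ _ (N / p%:R * (s%:R * N * (1 + 8 * L))^-1)).
    by rewrite le_eqVlt; apply/orP; left; apply/eqP; field; rewrite !gt_eqF.
  by rewrite ler_wpM2r// ltW.
apply: (@le_trans _ _ ((set_weight (supp bs))%:E *
    iint (enum (supp bs)) (fun b => (likelihood X y b)%:E * (\prod_(i in supp bs) laplace lam (b i 0))%:E) 0)%E); last first.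
  rewrite /evidence /prior_int (bigD1 (supp bs))//= leeDl//.
  apply: sume_ge0 => S _; rewrite mule_ge0 ?lee_fin ?set_weight_ge0//.
  by apply: iint_ge0 => b; rewrite mule_ge0 ?lee_fin ?prod_laplace_ge0// likelihood_ge0.
rewrite -!(mulrA (set_weight _)) EFinM; apply: lee_wpmul2l.
  by rewrite lee_fin set_weight_ge0.
pose c := lam / 2 * expR (-1).
have c0 : 0 <= c by rewrite mulr_ge0 ?expR_ge0// divr_ge0// ltW.
pose F (i : 'I_p) (x : R) : R := c * \1_(`[bs i 0 - h, bs i 0 + h]%classic) x.
have F0 i x : 0 <= F i x by rewrite mulr_ge0// indicE.
have := @iint_prod R p (enum (supp bs)) (fun=> expR (C - 2 - Delta ^+ 2 / 2)) F (fun=> c * (2 * h)) 0.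
move=> /(_ (enum_uniq _) (fun=> expR_ge0 _) (fun _ _ _ => erefl) F0) E.
apply: (@le_trans _ _ (expR (C - 2 - Delta ^+ 2 / 2) * \prod_(i <- enum (supp bs)) (c * (2 * h)))%:E).
  rewrite lee_fin big_enum/= prodr_const -mulrA -expRD [leRHS]mulrC.
  have -> : - 2 - Delta ^+ 2 / 2 + C = C - 2 - Delta ^+ 2 / 2 by ring.
  rewrite ler_wpM2r ?expR_ge0//.
  have [s0|] := eqVneq s 0%N; first by rewrite s0 !expr0.
  rewrite -lt0n => /card_gt0P[i iS]; have [_ l2] := lh i iS.
  apply: lerXn2r; rewrite ?nnegrE.
  - by rewrite mulr_ge0 ?expR_ge0// invr_ge0 !mulr_ge0// ltW.
  - by apply: mulr_ge0 => //; exact: mulr_ge0.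
  rewrite /c (_ : _ * (2 * h) = expR (-1) * (lam * h)); last by field.
  by rewrite ler_wpM2l ?expR_ge0.
rewrite -E; last 2 first.
- move=> i; apply: measurable_funM; first exact: measurable_cst.
  by apply: measurable_indic; exact: measurable_itv.
- by move=> i; exact: integral_box.
apply: le_iint => b; first by rewrite lee_fin mulr_ge0 ?expR_ge0// prodr_ge0.
move=> b0; rewrite big_enum/= -EFinM lee_fin.
have bS : supp b \subset supp bs.
  apply/fintype.subsetP => i; rewrite suppE; apply: contraR => iS.
  by rewrite b0 ?mem_enum// mxE.
have [hb|] := boolP [forall i in supp bs, `|b i 0 - bs i 0| <= h]; last first.
  rewrite negb_forall => /existsP[i]; rewrite negb_imply => /andP[iS hi].
  rewrite (bigD1 i)//= {1}/F indicE memNset ?mulr0 ?mul0r ?mulr0.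
    by rewrite mulr_ge0 ?likelihood_ge0 ?prod_laplace_ge0.
  by rewrite /= in_itv/= -ler_distl; exact/negP.
have {}hb i : i \in supp bs -> `|b i 0 - bs i 0| <= h by move=> iS; exact: (implyP (forallP hb i)).
have uS : supp (b - bs) \subset supp bs by exact: supp_sub_subset.
have u1 : norm1 (b - bs) <= s%:R * h.
  rewrite -(norm1_on_supp uS) /norm1_on mulr_natl -sumr_const.
  by apply: ler_sum => i iS; rewrite !mxE hb.
have Nu : N * (1 + 8 * L) * norm1 (b - bs) <= 1.
  apply: le_trans sh; rewrite mulrC ler_wpM2r// mulr_ge0// ltW//.
have Xu : norm2 (X *m (b - bs)) <= 1.
  apply: le_trans (norm2_mulmx_le _ XN) (le_trans _ Nu).
  by rewrite ler_wpM2r ?norm1_ge0// ler_peMr ?(ltW N_gt0)//; lra.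
have hX : - dot (X *m (beta0 - bs)) (X *m (b - bs)) <=
    norm2 (X *m (b - bs)) ^+ 2 / 2 + Delta ^+ 2 / 2.
  rewrite -dotNl -mulmxN opprB.
  have := @dot_le R n (X *m (bs - beta0)) (X *m (b - bs)) (1 / 2) _; lra.
have Xu2 : norm2 (X *m (b - bs)) ^+ 2 <= 1 by rewrite expr_le1 ?norm2_ge0.
have nz := noise_l1 (b - bs) qy; rewrite ler_norml in nz; case/andP: nz => nz _.
rewrite likelihood_shift.
set E1 := (X in _ <= X * \prod_(i in supp bs) laplace _ _).
have HP : expR (- (lam * norm1 bs)) * c ^+ s <= \prod_(i in supp bs) laplace lam (b i 0).
  rewrite -[norm1 bs](norm1_on_supp (subxx _)) /norm1_on mulr_sumr -sumrN expR_sum.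
  rewrite -prodr_const -big_split/=; apply: ler_prod => i iS.
  rewrite mulr_ge0 ?expR_ge0//= /laplace /c mulrCA ler_wpM2l ?divr_ge0// ?(ltW lam_gt0)//.
  rewrite -expRD ler_expR; have [l1 _] := lh i iS.
  have : lam * `|b i 0| <= lam * (`|bs i 0| + h).
    rewrite ler_pM2l//; have := ler_normD (bs i 0) (b i 0 - bs i 0).
    by rewrite addrC subrK => /le_trans; apply; rewrite lerD2l hb.
  by rewrite mulrDr => h1; lra.
have PF : \prod_(i in supp bs) F i (b i 0) = c ^+ s.
  rewrite -prodr_const; apply: eq_bigr => i iS.
  by rewrite /F indicE mem_set ?mulr1//= in_itv/= -ler_distl hb.
rewrite PF; apply: (@le_trans _ _ (E1 * (expR (- (lam * norm1 bs)) * c ^+ s))); last first.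
  by apply: ler_wpM2l; [exact: expR_ge0|exact: HP].
rewrite mulrA ler_wpM2r ?exprn_ge0// -expRD ler_expR /C; lra.
Qed.

Variables (alpha Gamma : R) (v : nat -> R).
Hypothesis alpha01 : 0 < alpha <= 1 / 2.
Hypothesis v_ge0 : forall k, 0 <= v k.
Hypothesis weight_gt0 : 0 < set_weight (supp bs).
(** Shrinkage contributes coefficients 1 on the support of [bs] and -1 off it. Two further terms
    (lam / 8) |d|_1 are added: one recentres the Laplace density at [bs], one is kept as a gain.
    This gives 5/4 and -3/4. *)
Hypothesis cone : forall d : 'cV[R]_p,
  lam * (5 / 4 * norm1_on (supp bs) d - 3 / 4 * norm1_on (~: supp bs) d)
  <= alpha / 8 * norm2 (X *m d) ^+ 2 + Gamma.

Definition dom_const := expR (Delta ^+ 2 / alpha + Gamma + 8 * alpha * s%:R * L) / prior_floor.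

(** The exponential is the tilt of power 1 - alpha, of mean one; the product is a flattened Laplace
    density centred at [bs], of mass 8 per coordinate; exp (8 alpha |S| L) pays for the pathwise
    part of the noise. The weight [v] on model sizes is free and encodes a Markov inequality. *)
Definition dom_fun (S : {set 'I_p}) (y : 'cV[R]_n) (b : 'cV[R]_p) : R :=
  dom_const * (v #|S| * expR (8 * alpha * #|S|%:R * L)) *
  expR (dot (y - X *m beta0) ((1 - alpha) *: (X *m (b - bs)))
    - dot ((1 - alpha) *: (X *m (b - bs))) ((1 - alpha) *: (X *m (b - bs))) / 2) *
  \prod_(i in S) (lam / 2 * expR (- (lam / 8 * `|b i 0 - bs i 0|))).

Lemma prior_floor_gt0 : 0 < prior_floor.
Proof.
have L0 : 0 <= L := L_ge0.
apply: mulr_gt0; last exact: expR_gt0.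
apply: mulr_gt0; first exact: weight_gt0.
have [s0|s0] := posnP s; first by rewrite s0 expr0 ltr01.
apply: exprn_gt0; apply: divr_gt0; first exact: expR_gt0.
by apply: mulr_gt0; [rewrite mulr_gt0 ?ltr0n|lra].
Qed.

Lemma dom_const_gt0 : 0 < dom_const.
Proof. by rewrite divr_gt0 ?expR_gt0// prior_floor_gt0. Qed.

Lemma dom_fun_ge0 S y b : 0 <= dom_fun S y b.
Proof.
rewrite /dom_fun; apply: mulr_ge0; last first.
  by apply: prodr_ge0 => i _; rewrite mulr_ge0 ?expR_ge0// divr_ge0// ltW.
by rewrite mulr_ge0 ?expR_ge0// mulr_ge0 ?(ltW dom_const_gt0)// mulr_ge0 ?expR_ge0.
Qed.

Lemma rmeas_dom_fun S : rmeas (dom_fun S).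
Proof.
have mX : vecmeas (fun (_ : 'cV[R]_n) (b : 'cV[R]_p) => (1 - alpha) *: (X *m (b - bs))).
  apply: vecmeasZ; first exact: rmeas_cst.
  by apply: vecmeas_mulmx; apply: vecmeasB; [exact: vecmeas_snd|exact: vecmeas_cst].
apply: rmeasM; first (apply: rmeasM; first exact: rmeas_cst).
  apply: rmeas_expR; apply: rmeasD.
    by apply: rmeas_dot => //; apply: vecmeasB; [exact: vecmeas_fst|exact: vecmeas_cst].
  by apply: rmeasN; apply: rmeasM; [exact: rmeas_dot|exact: rmeas_cst].
apply: rmeas_prod => i; apply: rmeasM; first exact: rmeas_cst.
apply: rmeas_expR; apply: rmeasN; apply: rmeasM; first exact: rmeas_cst.
apply: (rmeas_comp (F := fun x => `|x|)); first exact: (@normr_measurable R setT).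
by apply: rmeasD; [exact: (vecmeas_snd i)|exact: rmeas_cst].
Qed.

(** The condition on [B] says that on [B] the retained gain, weighted by [v], is at least 1, so it
    may be inserted as a factor; the rest compares exponents. *)
Lemma dominates_dom_fun B :
  (forall (S : {set 'I_p}) b, b \in B -> supp b \subset S ->
     1 <= expR (alpha / 8 * norm2 (X *m (b - bs)) ^+ 2 + lam / 8 * norm1 (b - bs)) * v #|S|) ->
  dominates X prior lam beta0 Us B dom_fun.
Proof.
move=> HB y S b qy fD bS.
have [bB|bB] := boolP (b \in B); last first.
  rewrite indicE (negPf bB) !mul0r mulr_ge0 ?dom_fun_ge0// fine_ge0// prior_int_ge0// => b'.
  by rewrite lee_fin likelihood_ge0.
rewrite indicE bB mul1r.
have pf := prior_floor_gt0.
have ev := evidence_ge qy; rewrite -(fineK fD) lee_fin in ev.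
apply: le_trans (ler_wpM2r (dom_fun_ge0 S y b) ev).
set d := b - bs; set w := X *m d; set e := y - X *m beta0.
have [a0 a1] := andP alpha01.
have dS : supp d \subset S :|: supp bs.
  by apply: supp_sub_subset; [exact: (fintype.subset_trans bS (finset.subsetUl _ _))|exact: finset.subsetUr].
(* The difference d lives on the union of both supports, so the noise is projected on the columns of
   that union. *)
have nz : dot e w <= norm2 w ^+ 2 / 4 + 8 * (#|S|%:R + s%:R) * L.
  have [_ _ /(_ d e dS)] := UsP (S :|: supp bs); move=> h; apply: le_trans h _.
  rewrite lerD2l; apply: le_trans (qy _) _; rewrite ler_wpM2r// ler_wpM2l//.
  by rewrite -natrD ler_nat (leq_trans (leq_card_setU _ _)).
have hX : dot (X *m (beta0 - bs)) w <= alpha / 4 * norm2 w ^+ 2 + Delta ^+ 2 / alpha.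
  have := @dot_le R n (X *m (beta0 - bs)) w (alpha / 4) _.
  have -> : 4 * (alpha / 4) = alpha by field.
  have -> : norm2 (X *m (beta0 - bs)) = Delta by rewrite -norm2N -mulmxN opprB.
  by apply; lra.
have HP : \prod_(i in S) laplace lam (b i 0) =
    \prod_(i in S) (lam / 2 * expR (- (lam / 8 * `|b i 0 - bs i 0|))) *
    expR (- (lam * norm1 b) + lam / 8 * norm1_on S d).
  rewrite -(norm1_on_supp bS) /norm1_on !mulr_sumr -sumrN -big_split/= expR_sum -big_split/=.
  apply: eq_bigr => i _; rewrite /laplace -[RHS]mulrA -expRD; congr (_ * expR _).
  by rewrite /d !mxE; ring.
rewrite likelihood_shift HP -/d -/w -/e.
have P0 : 0 <= \prod_(i in S) (lam / 2 * expR (- (lam / 8 * `|b i 0 - bs i 0|))).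
  by apply: prodr_ge0 => i _; rewrite mulr_ge0 ?expR_ge0// divr_ge0// ltW.
rewrite /dom_fun -/d -/w -/e.
move: P0; set P := \prod_(i in S) _ => P0.
rewrite [leRHS]mulrA [leLHS](_ : _ = expR (- (norm2 (y - X *m bs) ^+ 2 / 2) + dot e w +
  dot (X *m (beta0 - bs)) w - norm2 w ^+ 2 / 2 - lam * norm1 b + lam / 8 * norm1_on S d) * P); last first.
  by rewrite mulrCA mulrC -expRD; congr (expR _ * _); ring.
apply: ler_wpM2r => //.
have -> : prior_floor * expR (- (norm2 (y - X *m bs) ^+ 2 / 2) - lam * norm1 bs) *
   (dom_const * (v #|S| * expR (8 * alpha * #|S|%:R * L)) *
   expR (dot e ((1 - alpha) *: w) - dot ((1 - alpha) *: w) ((1 - alpha) *: w) / 2)) =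
   v #|S| * expR (- (norm2 (y - X *m bs) ^+ 2 / 2) - lam * norm1 bs + (Delta ^+ 2 / alpha + Gamma + 8 * alpha * s%:R * L)
    + 8 * alpha * #|S|%:R * L + ((1 - alpha) * dot e w - (1 - alpha) ^+ 2 * norm2 w ^+ 2 / 2)).
  rewrite /dom_const; move: pf; set q := prior_floor; move: q => q pf.
  rewrite !dotZl !dotZr -norm2_sqr !expRD.
  have -> : (1 - alpha) * ((1 - alpha) * norm2 w ^+ 2) / 2 = (1 - alpha) ^+ 2 * norm2 w ^+ 2 / 2 by ring.
  by field; rewrite gt_eqF.
apply: le_trans (_ : 1 * _ <= _); first by rewrite mul1r.
apply: (le_trans (ler_wpM2r (expR_ge0 _) (HB S b bB bS))).
rewrite -/d -/w mulrAC mulrC ler_wpM2l// -expRD ler_expR.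
have cn := cone d; rewrite -/w in cn.
have n1 : norm1 bs - norm1 b <= norm1_on (supp bs) d - norm1_on (~: supp bs) d.
  rewrite -(norm1_on_supp (subxx (supp bs))) (norm1_split (supp bs) b) opprD addrA.
  apply: lerB; last first.
    rewrite le_eqVlt; apply/orP; left; apply/eqP; apply: eq_bigr => i; rewrite inE => iS.
    by rewrite /d !mxE (notin_supp (subxx _) iS) subr0.
  rewrite /norm1_on -sumrB; apply: ler_sum => i _; rewrite /d !mxE.
  by rewrite distrC; exact: lerB_dist.
have dS1 : norm1_on S d <= norm1 d by rewrite (norm1_split S) lerDl norm1_on_ge0.
have dd := norm1_split (supp bs) d.
have l1 : lam * (norm1 bs - norm1 b) <= lam * (norm1_on (supp bs) d - norm1_on (~: supp bs) d).
  by rewrite ler_pM2l.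
have l2 : lam * norm1_on S d <= lam * norm1 d by rewrite ler_pM2l.
have l3 : lam * norm1 d = lam * norm1_on (supp bs) d + lam * norm1_on (~: supp bs) d.
  by rewrite dd mulrDr.
have anz : alpha * dot e w <= alpha * (norm2 w ^+ 2 / 4 + 8 * (#|S|%:R + s%:R) * L) by rewrite ler_pM2l.
(* Quadratic budget: alpha - alpha^2/2 is available; the noise and the cross term take alpha/4 each,
   the cone and the gain alpha/8 each. Half of this expression is left over. *)
have w0 : 0 <= (1 / 2 - alpha) * alpha * norm2 w ^+ 2.
  by rewrite mulr_ge0 ?sqr_ge0// mulr_ge0//; lra.
nra.
Qed.

(** For fixed [b] the tilted Gaussian has mass one, so no trace of X remains; the number of models
    of size k then cancels the uniform choice of S. *)
Lemma expected_mass_dom_fun : (expected_mass X prior beta0 dom_fun =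
  (dom_const * \sum_(k < p.+1) prior k * (v k * (8 * expR (8 * alpha * L)) ^+ k))%:E)%E.
Proof.
rewrite /expected_mass.
have E (S : {set 'I_p}) : iint (enum S) (fun b => iint (enum 'I_n)
      (fun y => (gauss_density (X *m beta0) y * dom_fun S y b)%:E) 0) 0 =
    (dom_const * (v #|S| * (8 * expR (8 * alpha * L)) ^+ #|S|))%:E.
  set K := dom_const * (v #|S| * expR (8 * alpha * #|S|%:R * L)).
  have K0 : 0 <= K by rewrite mulr_ge0 ?(ltW dom_const_gt0)// mulr_ge0 ?expR_ge0.
  pose F i (x : R) := lam / 2 * expR (- (lam / 8 * `|x - bs i 0|)).
  have F0 i x : 0 <= F i x by rewrite mulr_ge0 ?expR_ge0// divr_ge0// ltW.
  transitivity (iint (enum S) (fun b => (K * \prod_(i <- enum S) F i (b i 0))%:E) 0).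
    apply: eq_iint => b; pose w := (1 - alpha) *: (X *m (b - bs)).
    rewrite big_enum/=; set P := \prod_(i in S) _.
    have P0 : 0 <= P by exact: prodr_ge0.
    transitivity (iint (enum 'I_n) (fun y => (K * P)%:E *
       (gauss_density (X *m beta0) y * expR (dot (y - X *m beta0) w - dot w w / 2))%:E)%E 0).
      by apply: eq_iint => y; rewrite -EFinM /dom_fun; congr EFin; rewrite -/K -/w -/P; ring.
    have KP : 0 <= K * P by exact: mulr_ge0.
    rewrite iintZl//.
    - by rewrite iint_gauss_exp mule1.
    - by move=> y; rewrite lee_fin mulr_ge0 ?expR_ge0 ?gauss_density_ge0.
    apply: rmeas_EFin; apply: rmeasM.
      by apply: rmeas_gauss; [exact: vecmeas_cst|exact: vecmeas_snd].
    apply: rmeas_expR; apply: rmeasD; last exact: rmeas_cst.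
    by apply: rmeas_dot; [apply: vecmeasB; [exact: vecmeas_snd|exact: vecmeas_cst]|exact: vecmeas_cst].
  rewrite (@iint_prod R p (enum S) (fun=> K) F (fun=> 8) 0) ?enum_uniq//.
  - rewrite big_enum/= prodr_const /K; congr EFin.
    have -> : expR (8 * alpha * #|S|%:R * L) = expR (8 * alpha * L) ^+ #|S|.
      by rewrite -expRM_natl; congr expR; ring.
    by rewrite exprMn; ring.
  - move=> i; apply: measurable_funM; first exact: measurable_cst.
    apply: (measurableT_comp (@measurable_expR R)).
    apply: (measurableT_comp (@oppr_measurable R setT)).
    apply: measurable_funM; first exact: measurable_cst.
    apply: (measurableT_comp (@normr_measurable R setT)).
    by apply: measurable_funB; [exact: measurable_id|exact: measurable_cst].
  - move=> i; rewrite /F; under eq_integral do rewrite EFinM.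
    rewrite ge0_integralZl_EFin//.
    + by rewrite integral_laplace ?divr_gt0// -EFinM; congr EFin; field; rewrite gt_eqF.
    + apply/measurable_EFinP; apply: (measurableT_comp (@measurable_expR R)).
      apply: (measurableT_comp (@oppr_measurable R setT)).
      apply: measurable_funM; first exact: measurable_cst.
      apply: (measurableT_comp (@normr_measurable R setT)).
      by apply: measurable_funB; [exact: measurable_id|exact: measurable_cst].
    + by rewrite divr_ge0// ltW.
under eq_bigr do rewrite E -EFinM.
rewrite sumEFin; congr EFin; rewrite mulr_sumr.
rewrite (sum_set_card p (fun k => prior k / 'C(p, k)%:R * (dom_const * (v k * (8 * expR (8 * alpha * L)) ^+ k)))).
apply: eq_bigr => k _.
have C0 : 'C(p, k)%:R != 0 :> R by rewrite pnatr_eq0 -lt0n bin_gt0 -ltnS.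
by field.
Qed.

End EvidenceBounds.

(** * Prior sums *)

Section Sums.
Context {R : realType}.

Lemma sum_half_le (q : R) (m n : nat) : 0 <= q <= 1 / 2 ->
  \sum_(m <= i < n) q ^+ i <= 2 * q ^+ m.
Proof.
move=> /andP[q0 q1]; have qm : 0 <= q ^+ m by exact: exprn_ge0.
have [nm|/ltnW mn] := leqP n m.
  by rewrite big_geq// mulr_ge0.
suff : \sum_(m <= i < n) q ^+ i <= 2 * q ^+ m - 2 * q ^+ n.
  by have : 0 <= q ^+ n by [exact: exprn_ge0|]; lra.
elim: n mn => [|n IH].
  by rewrite leqn0 => /eqP->; rewrite big_geq// subrr.
rewrite leq_eqVlt => /orP[/eqP<-|]; first by rewrite big_geq// subrr.
rewrite ltnS => mn; rewrite big_nat_recr//= exprS.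
by have := IH mn; have : 0 <= q ^+ n by [exact: exprn_ge0|]; nra.
Qed.

Lemma ffact_leX m k : (m ^_ k <= m ^ k)%N.
Proof.
elim: k m => [//|k IH] [|m]; first by rewrite ffact0n.
rewrite ffactSS expnS leq_mul2l (leq_trans (IH m))//.
by have [->|k0] := posnP k; rewrite ?expn0// leq_exp2r.
Qed.

(** Combines C(p, s) <= p^s / s! with s^s <= e^s s!. The factor s^s produced by box widths of order
    1/s is thus compensated by the binomial coefficient. *)
Lemma bin_exp_le p s : 'C(p, s)%:R * s%:R ^+ s <= (expR 1 * p%:R) ^+ s :> R.
Proof.
have h : s%:R ^+ s <= expR 1 ^+ s * (s`!)%:R :> R.
  rewrite -expRM_natl mulr1 -ler_pdivrMr ?ltr0n ?fact_gt0//.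
  case: s => [|s]; first by rewrite expr0 fact0 divr1 expR0.
  by apply: le_trans (expR_ge1Dxn s (ler0n R s.+1)); rewrite lerDr ler01.
apply: le_trans (ler_wpM2l _ h) _; first exact: ler0n.
rewrite exprMn mulrCA ler_wpM2l ?exprn_ge0 ?expR_ge0//.
by rewrite -natrM bin_ffact -natrX ler_nat ffact_leX.
Qed.

(** The C(p, k) <= p^k = exp (k L) models of size k turn the summand into a geometric one of ratio 2
    exp (- L) <= 1/2. *)
Lemma noise_sum_le p (L : R) : (0 < p)%N -> L = ln p%:R -> 4 <= expR L ->
  \sum_(S : {set 'I_p} | (0 < #|S|)%N) (2 * expR (- (2 * L))) ^+ #|S| <= 4 * expR (- L).
Proof.
move=> p0 LE L4; set q := 2 * expR (- (2 * L)).
have eL : expR L = p%:R by rewrite LE lnK// posrE ltr0n.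
have q0 : 0 <= q by rewrite mulr_ge0 ?expR_ge0.
rewrite big_mkcond/= (sum_set_card p (fun k => if (0 < k)%N then q ^+ k else 0)).
rewrite big_ord_recl [X in X + _]mulr0 add0r.
pose r := 2 * expR (- L).
have r0 : 0 <= r by rewrite mulr_ge0 ?expR_ge0.
have r1 : r <= 1 / 2.
  rewrite /r expRN mulrC ler_pdivrMl ?expR_gt0//; lra.
apply: (@le_trans _ _ (\sum_(i < p) r ^+ i.+1)).
  apply: ler_sum => i _; rewrite lift0 ltnS leq0n.
  have -> : r = p%:R * q.
    by rewrite /r /q -eL mulrCA -expRD; congr (_ * expR _); ring.
  rewrite (exprMn _ p%:R) ler_wpM2r ?exprn_ge0// -natrX ler_nat.
  by apply: leq_trans (ffact_leX _ _); rewrite -bin_ffact leq_pmulr// fact_gt0.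
have := @sum_half_le r 1 p.+1; rewrite r0 r1 => /(_ isT).
by rewrite big_add1/= big_mkord expr1 => h; apply: le_trans h _; rewrite /r; lra.
Qed.

End Sums.

(** * Decay of the prior on model sizes *)

Section PriorDecay.
Context {R : realType} (p : nat) (P : nat -> R) (A1 A2 A3 A4 L delta : R).
Hypothesis P_ge0 : forall k, (k <= p)%N -> 0 <= P k.
Hypothesis P_sum : \sum_(k < p.+1) P k = 1.
Hypothesis A_gt0 : [/\ 0 < A1, 0 < A2, 0 < A3 & 0 < A4].
Hypothesis P_ratio : forall k, (1 <= k <= p)%N ->
  A1 * expR (- A3 * L) * P k.-1 <= P k /\ P k <= A2 * expR (- A4 * L) * P k.-1.
Hypothesis delta_gt0 : 0 < delta.
Hypothesis L_ge1 : 1 <= L.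
Hypothesis A2_le : A2 <= expR (delta * L).
Hypothesis A1_ge : A1^-1 <= expR (delta * L).
Hypothesis two_le : 8 <= expR (delta * L).

(** If the mass at 0 vanished, the upper ratio bounds would kill all masses, against total mass one;
    the lower ratio bounds then propagate positivity. *)
Lemma prior_gt0 k : (k <= p)%N -> 0 < P k.
Proof.
have [A10 A20 A30 A40] := A_gt0.
have P0 : 0 < P 0.
  rewrite lt_def P_ge0// andbT; apply/eqP => P00.
  have Pz j : (j <= p)%N -> P j = 0.
    elim: j => [//|j IH] jp; have [_] := @P_ratio j.+1 jp.
    by rewrite /= IH ?(ltnW jp)// mulr0 => h; apply/eqP; rewrite eq_le h P_ge0.
  have := P_sum; rewrite big1 => [/eqP|[i ip] _ /=]; last exact: Pz.
  by rewrite eq_sym oner_eq0.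
elim: k => [//|k IH] kp; have [h _] := @P_ratio k.+1 kp.
apply: lt_le_trans h; rewrite /= mulr_gt0 ?IH ?(ltnW kp)//.
by rewrite mulr_gt0 ?expR_gt0.
Qed.

Lemma prior_up s j : (s + j <= p)%N -> P (s + j) <= expR ((delta - A4) * L) ^+ j * P s.
Proof.
have [A10 A20 A30 A40] := A_gt0.
elim: j => [|j IH]; first by rewrite addn0 expr0 mul1r.
rewrite addnS => sp; have [_ h] := @P_ratio (s + j).+1 sp; apply: le_trans h _ => /=.
rewrite exprS -[leRHS]mulrA; apply: ler_pM.
- by rewrite mulr_ge0 ?expR_ge0// ltW.
- by rewrite P_ge0// ltnW.
- by rewrite mulrBl expRD mulNr ler_wpM2r ?expR_ge0.
- exact: IH (ltnW sp).
Qed.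

(** The lower ratio bound read backwards: each removed coordinate costs at most p^(A3 + delta). *)
Lemma prior_down k j : (k + j <= p)%N -> P k <= expR ((delta + A3) * L) ^+ j * P (k + j).
Proof.
have [A10 A20 A30 A40] := A_gt0.
elim: j => [|j IH]; first by rewrite addn0 expr0 mul1r.
rewrite addnS => sp; have [h _] := @P_ratio (k + j).+1 sp.
apply: le_trans (IH (ltnW sp)) _; rewrite exprSr -mulrA ler_wpM2l ?exprn_ge0 ?expR_ge0//.
rewrite /= in h; have e0 : 0 < A1 * expR (- A3 * L) by rewrite mulr_gt0 ?expR_gt0.
move: h; rewrite -ler_pdivlMl// => /le_trans; apply.
rewrite ler_wpM2r ?P_ge0// invfM mulNr -expRN opprK mulrDl expRD.
by rewrite ler_wpM2r ?expR_ge0.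
Qed.

(** The sum is split at s. Above s it is geometric with ratio at most exp (- delta L) <= 1/8, thanks
    to eta + 2 delta <= A4. Below s there are s terms, each compared with P s by [prior_down], and s
    <= exp (s L) accounts for the extra 1 in the exponent. *)
Lemma prior_sum_le s eta : (s <= p)%N -> 0 <= eta -> eta + 2 * delta <= A4 ->
  \sum_(k < p.+1) P k * expR (eta * k%:R * L) <=
  3 * P s * expR ((eta + A3 + delta + 1) * s%:R * L).
Proof.
have [A10 A20 A30 A40] := A_gt0.
move=> sp eta0 etaA.
have dl := delta_gt0; have L1 := L_ge1; have t8 := two_le.
have L0 : 0 <= L by lra.
have Ps : 0 < P s by exact: prior_gt0.
have s0 : 0 <= s%:R :> R by exact: ler0n.
pose E := P s * expR (eta * s%:R * L).
have E0 : 0 <= E by rewrite mulr_ge0 ?expR_ge0// ltW.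
rewrite -(big_mkord xpredT (fun k => P k * expR (eta * k%:R * L))).
rewrite (big_cat_nat (n := s)) ?leqW//=.
have up : \sum_(s <= k < p.+1) P k * expR (eta * k%:R * L) <= 2 * E.
  pose r := expR ((delta + eta - A4) * L).
  have r12 : 0 <= r <= 1 / 2.
    rewrite expR_ge0/=; apply: (@le_trans _ _ (expR (- (delta * L)))).
      by rewrite ler_expR; have := ler_wpM2r L0 etaA; lra.
    by rewrite expRN -div1r ler_pdivrMr ?expR_gt0//; lra.
  have := @sum_half_le R r 0 (p.+1 - s) r12; rewrite expr0 mulr1 => h.
  rewrite -{1}[s]add0n big_addn (mulrC 2 E); apply: le_trans (ler_wpM2l E0 h).
  rewrite mulr_sumr !big_mkord; apply: ler_sum => i _.
  have ip : (s + i <= p)%N by have := ltn_ord i; rewrite ltn_subRL ltnS.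
  rewrite addnC; apply: le_trans (ler_wpM2r (expR_ge0 _) (prior_up ip)) _.
  rewrite /E /r -!expRM_natl mulrAC -expRD mulrC -[leRHS]mulrA -expRD natrD.
  rewrite le_eqVlt; apply/orP; left; apply/eqP; congr (_ * expR _); ring.
have down : \sum_(0 <= k < s) P k * expR (eta * k%:R * L) <=
    E * expR ((A3 + delta + 1) * s%:R * L).
  apply: (@le_trans _ _ (\sum_(0 <= k < s) E * expR ((A3 + delta) * s%:R * L))).
    rewrite !big_mkord; apply: ler_sum => k _.
    have ks := ltnW (ltn_ord k).
    have := @prior_down k (s - k); rewrite subnKC// => /(_ sp) h.
    apply: le_trans (ler_wpM2r (expR_ge0 _) h) _.
    rewrite /E -expRM_natl mulrAC -expRD mulrC -[leRHS]mulrA -expRD ler_wpM2l ?(ltW Ps)// ler_expR.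
    have k0 : 0 <= k%:R :> R by [].
    have k1 : k%:R <= s%:R :> R by rewrite ler_nat.
    rewrite natrB//.
    have h1 : 0 <= (delta + A3) * L * k%:R by rewrite !mulr_ge0//; lra.
    have h2 : 0 <= eta * L * (s%:R - k%:R) by rewrite !mulr_ge0//; lra.
    nra.
  rewrite sumr_const_nat subn0 -(mulr_natr (E * _)) -[leLHS]mulrA ler_wpM2l//.
  have -> : (A3 + delta + 1) * s%:R * L = (A3 + delta) * s%:R * L + s%:R * L by ring.
  rewrite expRD ler_wpM2l ?expR_ge0//.
  have := expR_ge1Dx (s%:R * L); have : s%:R <= s%:R * L by rewrite ler_peMr.
  lra.
have -> : 3 * P s * expR ((eta + A3 + delta + 1) * s%:R * L) = 3 * (E * expR ((A3 + delta + 1) * s%:R * L)).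
  by rewrite /E -!mulrA -expRD; congr (_ * (_ * expR _)); ring.
have : E <= E * expR ((A3 + delta + 1) * s%:R * L).
  rewrite ler_peMr// -[leLHS]expR0 ler_expR !mulr_ge0//; lra.
lra.
Qed.

(** Write k = s + i, so that i > (D - 1) s. A factor exp (- delta L i) is kept for summability; the
    remaining decay, of rate A4 - theta - 2 delta, is evaluated at i = (D - 1) s. *)
Lemma prior_tail_le s theta D : (s <= p)%N -> 0 <= theta -> 1 <= D -> theta + 2 * delta <= A4 ->
  \sum_(k < p.+1) P k * (if D * s%:R < k%:R then expR (theta * k%:R * L) else 0) <=
  2 * P s * expR ((theta - (A4 - theta - 2 * delta) * (D - 1)) * s%:R * L).
Proof.
have [A10 A20 A30 A40] := A_gt0.
move=> sp th0 D1 thA.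
have dl := delta_gt0; have L1 := L_ge1; have t8 := two_le.
have L0 : 0 <= L by lra.
have Ps : 0 < P s by exact: prior_gt0.
have s0 : 0 <= s%:R :> R by exact: ler0n.
pose E := P s * expR ((theta - (A4 - theta - 2 * delta) * (D - 1)) * s%:R * L).
have E0 : 0 <= E by rewrite mulr_ge0 ?expR_ge0// ltW.
rewrite -[leRHS]mulrA -/E.
rewrite -(big_mkord xpredT (fun k => P k * (if D * s%:R < k%:R then expR (theta * k%:R * L) else 0))).
rewrite (big_cat_nat (n := s)) ?leqW//= big_nat big1 ?add0r => [|k /andP[_ ks]]; last first.
  case: ifPn => [h|_]; last by rewrite mulr0.
  have : k%:R < s%:R :> R by rewrite ltr_nat.
  have : s%:R <= D * s%:R by rewrite ler_peMl.
  lra.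
pose r := expR (- (delta * L)).
have r12 : 0 <= r <= 1 / 2.
  rewrite expR_ge0/= /r expRN -div1r ler_pdivrMr ?expR_gt0//; lra.
have := @sum_half_le R r 0 (p.+1 - s) r12; rewrite expr0 mulr1 => h.
rewrite -{1}[s]add0n big_addn (mulrC 2 E); apply: le_trans (ler_wpM2l E0 h).
rewrite mulr_sumr !big_mkord; apply: ler_sum => i _.
have ip : (s + i <= p)%N by have := ltn_ord i; rewrite ltn_subRL ltnS.
rewrite addnC; case: ifPn => [hi|_]; last first.
  by rewrite mulr0 mulr_ge0// exprn_ge0 ?expR_ge0.
apply: le_trans (ler_wpM2r (expR_ge0 _) (prior_up ip)) _.
rewrite /E /r -!expRM_natl mulrAC -expRD mulrC -[leRHS]mulrA -expRD ler_wpM2l ?(ltW Ps)// ler_expR.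
rewrite natrD in hi *.
have h1 : 0 <= (A4 - theta - 2 * delta) * L by rewrite mulr_ge0//; lra.
have h2 : 0 <= i%:R - (D - 1) * s%:R by lra.
have := mulr_ge0 h1 h2.
nra.
Qed.

End PriorDecay.

(** * Size of the dominating constant *)

Section DomConst.
Context {R : realType} (n p : nat) (X : 'M[R]_(n, p)) (prior : nat -> R) (beta0 bs : 'cV[R]_p).
Notation L := (ln p%:R : R).
Notation s := #|supp bs|.

(** The factor [prior s] on the left is the one supplied by the prior sums. In 2 + 8 alpha + delta,
    the 2 counts one power of p per coordinate from the binomial and one from the box, and delta
    absorbs e^2 (1 + 8 L). *)
Lemma dom_const_le alpha Gamma delta : (0 < p)%N -> 0 < prior s ->
  expR 2 * (1 + 8 * L) <= expR (delta * L) ->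
  dom_const X prior beta0 bs alpha Gamma * prior s <=
  expR (2 + (alpha^-1 + 1 / 2) * norm2 (X *m (bs - beta0)) ^+ 2 + Gamma +
        (2 + 8 * alpha + delta) * s%:R * L).
Proof.
move=> p0 Ps hd; rewrite /dom_const; set Delta := norm2 _.
have L0 : 0 <= L by rewrite ln_ge0// ler1n.
have pR : 0 < p%:R :> R by rewrite ltr0n.
have sp : (s <= p)%N by rewrite -[X in (_ <= X)%N]card_ord max_card.
have C0 : 0 < 'C(p, s)%:R :> R by rewrite ltr0n bin_gt0.
have eL : expR L = p%:R by rewrite lnK// posrE.
have u0 : 0 < (expR (-1) / (p%:R * s%:R * (1 + 8 * L))) ^+ s :> R.
  have [->|s0] := posnP s; first by rewrite expr0.
  apply: exprn_gt0; apply: divr_gt0; first exact: expR_gt0.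
  by apply: mulr_gt0; [rewrite mulr_gt0 ?ltr0n|lra].
rewrite /set_weight; set u := (_ / _) ^+ s in u0 *.
have key : 'C(p, s)%:R / u <= expR ((2 + delta) * s%:R * L).
  have -> : 'C(p, s)%:R / u = ('C(p, s)%:R * s%:R ^+ s) * (expR 1 * p%:R * (1 + 8 * L)) ^+ s.
    rewrite /u -exprVn invf_div -[RHS]mulrA -exprMn; congr (_ * _ ^+ _).
    by rewrite expRN invrK; ring.
  apply: (@le_trans _ _ ((expR 1 * p%:R) ^+ s * (expR 1 * p%:R * (1 + 8 * L)) ^+ s)).
    by rewrite ler_wpM2r ?bin_exp_le// exprn_ge0// !mulr_ge0 ?expR_ge0//; lra.
  rewrite -exprMn (_ : (2 + delta) * s%:R * L = s%:R * ((2 + delta) * L)); last ring.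
  rewrite expRM_natl; apply: lerXn2r; rewrite ?nnegrE ?expR_ge0//.
    by rewrite !mulr_ge0 ?expR_ge0//; lra.
  rewrite (_ : (2 + delta) * L = L + L + delta * L); last ring.
  rewrite !expRD eL; have e2 : expR 2 = expR 1 * expR 1 :> R by rewrite -expRD.
  rewrite e2 in hd; apply: le_trans (ler_wpM2l _ hd); last by rewrite mulr_ge0// ltW.
  by rewrite le_eqVlt; apply/orP; left; apply/eqP; ring.
have -> : expR (Delta ^+ 2 / alpha + Gamma + 8 * alpha * s%:R * L) /
    (prior s / 'C(p, s)%:R * u * expR (- 2 - Delta ^+ 2 / 2)) * prior s =
    expR (Delta ^+ 2 / alpha + Gamma + 8 * alpha * s%:R * L + (2 + Delta ^+ 2 / 2)) * ('C(p, s)%:R / u).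
  rewrite [in RHS]expRD (_ : - 2 - Delta ^+ 2 / 2 = - (2 + Delta ^+ 2 / 2)); last ring.
  by rewrite expRN; field; rewrite !gt_eqF ?expR_gt0.
apply: le_trans (ler_wpM2l (expR_ge0 _) key) _; rewrite -expRD ler_expR.
by rewrite le_eqVlt; apply/orP; left; apply/eqP; ring.
Qed.

End DomConst.

(** * Posterior concentration *)

Section Cone.
Context {R : realType} (n p : nat) (X : 'M[R]_(n, p)) (N lam : R).

(* [f] is a lower bound for phi(S) (any positive [f] qualifies if S is empty). *)
Definition compat (S : {set 'I_p}) (f : R) := forall d : 'cV[R]_p,
  norm1_on (~: S) d <= 7 * norm1_on S d ->
  N * f * norm1_on S d <= norm2 (X *m d) * Num.sqrt #|S|%:R.

(** Outside the cone the left-hand side is nonpositive since 3/4 of 7 exceeds 5/4. Inside,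
    compatibility bounds it by a multiple of |X d|, and completing the square against alpha/8 |X
    d|^2 gives 2 (5/4)^2 = 25/8. *)
Lemma compat_cone (S : {set 'I_p}) f alpha : 0 < N -> 0 < f -> 0 < lam -> 0 < alpha -> compat S f ->
  forall d : 'cV[R]_p,
  lam * (5 / 4 * norm1_on S d - 3 / 4 * norm1_on (~: S) d)
  <= alpha / 8 * norm2 (X *m d) ^+ 2 + 25 / 8 * (lam ^+ 2 * #|S|%:R / (alpha * N ^+ 2 * f ^+ 2)).
Proof.
move=> N0 f0 l0 a0 cf d; set x := norm1_on S d; set y := norm1_on (~: S) d.
have x0 : 0 <= x by exact: norm1_on_ge0.
set G := 25 / 8 * _.
have G0 : 0 <= G by rewrite /G mulr_ge0// divr_ge0// ?mulr_ge0 ?sqr_ge0// ltW.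
have w0 : 0 <= alpha / 8 * norm2 (X *m d) ^+ 2 by rewrite mulr_ge0 ?sqr_ge0//; lra.
have [yx|yx] := leP y (7 * x); last first.
  apply: (@le_trans _ _ 0); last by rewrite addr_ge0.
  by rewrite pmulr_rle0//; lra.
have h := cf d yx; rewrite -/x in h.
have xle : x <= norm2 (X *m d) * Num.sqrt #|S|%:R / (N * f).
  by rewrite ler_pdivlMr ?mulr_gt0// mulrC.
apply: (@le_trans _ _ (lam * (5 / 4 * (norm2 (X *m d) * Num.sqrt #|S|%:R / (N * f))))).
  rewrite ler_pM2l//; have : 0 <= y by exact: norm1_on_ge0.
  lra.
have q2 : Num.sqrt #|S|%:R ^+ 2 = #|S|%:R :> R by rewrite sqr_sqrtr.
rewrite /G -[in X in _ <= _ + X]q2; move: (Num.sqrt #|S|%:R) (norm2 _) => q w.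
have := sqr_ge0 (alpha * w / 2 - lam * 5 / 2 * q / (N * f)).
have -> : (alpha * w / 2 - lam * 5 / 2 * q / (N * f)) ^+ 2 = 2 * alpha *
  (alpha / 8 * w ^+ 2 + 25 / 8 * (lam ^+ 2 * q ^+ 2 / (alpha * N ^+ 2 * f ^+ 2)) -
   lam * (5 / 4 * (w * q / (N * f)))).
  by field; rewrite !gt_eqF.
move=> h1; move: h1; rewrite pmulr_rge0; last by lra.
by rewrite subr_ge0.
Qed.

End Cone.

(** * Choice of constants and the two bad events *)

Section Concentration.
Context {R : realType}.

(** In units of [mA], 8 alpha = 4/48, delta = 1/48 and c = 12/48, so 8 alpha + c + 3 delta = 19/48
    stays below the prior exponent A4. In [CA], 50 / alpha pays for the shrinkage term when lam^2 <=
    16 N^2 L, and 1 / alpha for the cross term. *)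
Definition mA (A4 : R) := Num.min A4 1.
Definition alphaA (A4 : R) := mA A4 / 96.
Definition cA (A4 : R) := mA A4 / 4.
Definition deltaA (A4 : R) := mA A4 / 48.
Definition CA (A3 A4 : R) := 51 / alphaA A4 + 5 + A3.

Context (n p : nat) (X : 'M[R]_(n, p)) (prior : nat -> R) (lam : R) (A1 A2 A3 A4 N : R).
Notation L := (ln p%:R : R).
Notation alpha := (alphaA A4).
Notation c := (cA A4).
Notation delta := (deltaA A4).
Hypothesis prior_ge0 : forall s, (s <= p)%N -> 0 <= prior s.
Hypothesis prior_sum1 : \sum_(k < p.+1) prior k = 1.
Hypothesis A_gt0 : [/\ 0 < A1, 0 < A2, 0 < A3 & 0 < A4].
Hypothesis prior_ratio : forall k, (1 <= k <= p)%N ->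
  A1 * expR (- A3 * L) * prior k.-1 <= prior k /\ prior k <= A2 * expR (- A4 * L) * prior k.-1.
Hypothesis lam_gt0 : 0 < lam.
Hypothesis N_gt0 : 0 < N.
Hypothesis XN : forall j, norm2 (col j X) <= N.
Hypothesis p_gt0 : (0 < p)%N.
Hypothesis lam_lo : N / p%:R <= lam.
Hypothesis lam_hi : lam <= 4 * N * Num.sqrt L.
Hypothesis L_ge1 : 1 <= L.
Hypothesis A2_le : A2 <= expR (delta * L).
Hypothesis A1_ge : A1^-1 <= expR (delta * L).
Hypothesis eight_le : 8 <= expR (delta * L).
Hypothesis L_le : expR 2 * (1 + 8 * L) <= expR (delta * L).
Context (beta0 : 'cV[R]_p) (Us : {set 'I_p} -> seq 'cV[R]_n).
Hypothesis UsP : forall S, [/\ orthonormal_seq (Us S), (size (Us S) <= #|S|)%N &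
    forall (b : 'cV[R]_p) e, supp b \subset S ->
      dot e (X *m b) <= norm2 (X *m b) ^+ 2 / 4 + qform (Us S) e].

Lemma mA_bounds : [/\ 0 < mA A4, mA A4 <= 1 & mA A4 <= A4].
Proof.
have [_ _ _ A40] := A_gt0.
by rewrite /mA lt_min A40 ltr01 !ge_min lexx orbT lexx.
Qed.

Lemma prior_supp_gt0 (b : 'cV[R]_p) : 0 < prior #|supp b|.
Proof.
apply: (prior_gt0 prior_ge0 prior_sum1 A_gt0 prior_ratio).
by rewrite -[X in (_ <= X)%N]card_ord max_card.
Qed.

Lemma set_weight_gt0 (b : 'cV[R]_p) : 0 < set_weight prior (supp b).
Proof.
rewrite /set_weight divr_gt0 ?prior_supp_gt0// ltr0n bin_gt0.
by rewrite -[X in (_ <= X)%N]card_ord max_card.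
Qed.

Definition weighted_loss (bs b : 'cV[R]_p) : R :=
  alpha / 8 * norm2 (X *m (b - bs)) ^+ 2 + lam / 8 * norm1 (b - bs) + c * #|supp b|%:R * L.

Notation dominates := (dominates X prior lam beta0 Us).
Notation expected_mass := (expected_mass X prior beta0).

(** Markov's inequality with [v k = expR (c * k * L - Rr)]: enlarging S beyond the support of [b]
    only increases the weight, and the prior decay can afford the extra p^(c k). *)
Lemma dominate_loss (bs : 'cV[R]_p) Gamma Rr (B : set 'cV[R]_p) :
  (forall d : 'cV[R]_p,
   lam * (5 / 4 * norm1_on (supp bs) d - 3 / 4 * norm1_on (~: supp bs) d)
   <= alpha / 8 * norm2 (X *m d) ^+ 2 + Gamma) ->
  (forall b, B b -> Rr <= weighted_loss bs b) ->
  exists J, [/\ dominates B J, forall S y b, 0 <= J S y b, forall S, rmeas (J S) &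
    (expected_mass J <= (3 * expR (2 + (alpha^-1 + 5 + A3) *
      (#|supp bs|%:R * L + norm2 (X *m (bs - beta0)) ^+ 2) + Gamma - Rr))%:E)%E].
Proof.
move=> cone HB; pose v (k : nat) : R := expR (c * k%:R * L - Rr).
have v0 k : 0 <= v k by exact: expR_ge0.
have [m0 m1 mA4] := mA_bounds.
have [A10 A20 A30 A40] := A_gt0.
have L1 := L_ge1.
have w0 := set_weight_gt0 bs.
have a01 : 0 < alpha <= 1 / 2 by rewrite /alphaA; apply/andP; split; lra.
exists (dom_fun X prior lam beta0 bs alpha Gamma v); split.
- apply: (dominates_dom_fun prior_ge0 lam_gt0 UsP N_gt0 XN p_gt0 lam_lo lam_hi a01 v0 w0 cone).
  move=> S b /set_mem/HB hb bS; rewrite /v -expRD -[leLHS]expR0 ler_expR.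
  have : c * #|supp b|%:R * L <= c * #|S|%:R * L.
    rewrite ler_wpM2r ?(le_trans ler01)// ler_wpM2l ?ler_nat ?subset_leq_card// /cA; lra.
  by move: hb; rewrite /weighted_loss; lra.
- by move=> S y b; apply: dom_fun_ge0.
- by move=> S; exact: rmeas_dom_fun.
rewrite (expected_mass_dom_fun X beta0 lam_gt0 p_gt0 alpha Gamma v0 w0) lee_fin.
set K := dom_const _ _ _ _ _ _.
have sp : (#|supp bs| <= p)%N by rewrite -[X in (_ <= X)%N]card_ord max_card.
have K0 : 0 <= K by apply: ltW; exact: dom_const_gt0.
have d0 : 0 < delta by rewrite /deltaA; lra.
pose eta := 8 * alpha + c + delta.
have eta0 : 0 <= eta by rewrite /eta /alphaA /cA /deltaA; lra.
have etaA : eta + 2 * delta <= A4 by rewrite /eta /alphaA /cA /deltaA; lra.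
have ps := @prior_sum_le _ _ _ _ _ _ _ _ _ prior_ge0 prior_sum1 A_gt0 prior_ratio d0 L_ge1 A2_le A1_ge eight_le
  #|supp bs| eta sp eta0 etaA.
have dk := dom_const_le X beta0 alpha Gamma p_gt0 (prior_supp_gt0 bs) L_le.
rewrite -/K in dk.
apply: (@le_trans _ _ (K * (expR (- Rr) * \sum_(k < p.+1) prior k * expR (eta * k%:R * L)))).
  rewrite ler_wpM2l// mulr_sumr; apply: ler_sum => k _.
  rewrite [leRHS]mulrCA; apply: ler_wpM2l; first by rewrite prior_ge0// -ltnS.
  rewrite /v expRD [leRHS]mulrC (mulrAC (expR (c * k%:R * L))) ler_wpM2r ?expR_ge0// [leLHS]mulrC.
  apply: (@le_trans _ _ ((expR (delta * L) * expR (8 * alpha * L)) ^+ k * expR (c * k%:R * L))).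
    apply: ler_wpM2r; first exact: expR_ge0.
    by apply: lerXn2r; rewrite ?nnegrE ?mulr_ge0 ?expR_ge0// ler_wpM2r ?expR_ge0.
  rewrite -expRD -expRM_natl -expRD ler_expR /eta.
  by rewrite le_eqVlt; apply/orP; left; apply/eqP; ring.
apply: (le_trans (ler_wpM2l K0 (ler_wpM2l (expR_ge0 _) ps))).
set s := #|supp bs| in ps dk *; set De := norm2 _ in dk *.
have -> : K * (expR (- Rr) * (3 * prior s * expR ((eta + A3 + delta + 1) * s%:R * L))) =
  3 * (expR (- Rr + (eta + A3 + delta + 1) * s%:R * L) * (K * prior s)) by rewrite expRD; ring.
rewrite ler_pM2l//; apply: (le_trans (ler_wpM2l (expR_ge0 _) dk)).
rewrite -expRD ler_expR.
have sL : 0 <= s%:R * L by rewrite mulr_ge0 // (le_trans ler01 L1).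
have De0 : 0 <= De ^+ 2 by exact: sqr_ge0.
have aV : 0 <= alpha^-1 by rewrite invr_ge0; case/andP: a01 => /ltW.
have h1 : (2 + 8 * alpha + delta + (eta + A3 + delta + 1)) * (s%:R * L) <= (5 + A3) * (s%:R * L).
  by apply: ler_wpM2r => //; rewrite /eta /alphaA /cA /deltaA; lra.
have h2 : 0 <= alpha^-1 * (s%:R * L) by exact: mulr_ge0.
have h3 : 0 <= A3 * De ^+ 2 by rewrite mulr_ge0 ?(ltW A30).
lra.
Qed.

(** Here [v] is an indicator of large sizes and the centre is [beta0], so the approximation error
    disappears. The decay left over is A4 minus 7/48 of [mA], hence 41/48 of A4. *)
Lemma dominate_dimension Gamma D (B : set 'cV[R]_p) :
  (forall d : 'cV[R]_p,
   lam * (5 / 4 * norm1_on (supp beta0) d - 3 / 4 * norm1_on (~: supp beta0) d)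
   <= alpha / 8 * norm2 (X *m d) ^+ 2 + Gamma) -> 1 <= D ->
  (forall b, B b -> D * #|supp beta0|%:R < #|supp b|%:R) ->
  exists J, [/\ dominates B J, forall S y b, 0 <= J S y b, forall S, rmeas (J S) &
    (expected_mass J <= (2 * expR (2 + Gamma +
      (9 / 4 - 41 / 48 * A4 * (D - 1)) * (#|supp beta0|%:R * L)))%:E)%E].
Proof.
move=> cone D1 HB; pose v (k : nat) : R := if D * #|supp beta0|%:R < k%:R then 1 else 0.
have v0 k : 0 <= v k by rewrite /v; case: ifP.
have [m0 m1 mA4] := mA_bounds.
have [A10 A20 A30 A40] := A_gt0.
have L1 := L_ge1.
have w0 := set_weight_gt0 beta0.
have a01 : 0 < alpha <= 1 / 2 by rewrite /alphaA; apply/andP; split; lra.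
exists (dom_fun X prior lam beta0 beta0 alpha Gamma v); split.
- apply: (dominates_dom_fun prior_ge0 lam_gt0 UsP N_gt0 XN p_gt0 lam_lo lam_hi a01 v0 w0 cone).
  move=> S b /set_mem/HB hb bS; rewrite /v ifT; last first.
    by apply: lt_le_trans hb _; rewrite ler_nat subset_leq_card.
  rewrite mulr1 -[leLHS]expR0 ler_expR addr_ge0// mulr_ge0 ?norm1_ge0 ?sqr_ge0//.
    by rewrite /alphaA; lra.
  by rewrite divr_ge0// ltW.
- by move=> S y b; apply: dom_fun_ge0.
- by move=> S; exact: rmeas_dom_fun.
rewrite (expected_mass_dom_fun X beta0 lam_gt0 p_gt0 alpha Gamma v0 w0) lee_fin.
set K := dom_const _ _ _ _ _ _.
have sp : (#|supp beta0| <= p)%N by rewrite -[X in (_ <= X)%N]card_ord max_card.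
have K0 : 0 <= K by apply: ltW; exact: dom_const_gt0.
have d0 : 0 < delta by rewrite /deltaA; lra.
pose th := 8 * alpha + delta.
have th0 : 0 <= th by rewrite /th /alphaA /deltaA; lra.
have thA : th + 2 * delta <= A4 by rewrite /th /alphaA /deltaA; lra.
have ps := @prior_tail_le _ _ _ _ _ _ _ _ _ prior_ge0 prior_sum1 A_gt0 prior_ratio d0 L_ge1 A2_le eight_le
  #|supp beta0| th D sp th0 D1 thA.
have dk := dom_const_le X beta0 alpha Gamma p_gt0 (prior_supp_gt0 beta0) L_le.
rewrite -/K subrr mulmx0 norm2_0 expr0n mulr0 addr0 in dk.
apply: le_trans (ler_wpM2l K0 (_ : _ <= \sum_(k < p.+1) prior k *
    (if D * #|supp beta0|%:R < k%:R then expR (th * k%:R * L) else 0))) _.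
  apply: ler_sum => k _; apply: ler_wpM2l; first by rewrite prior_ge0// -ltnS.
  rewrite /v.
  case: ifPn => _; last by rewrite mul0r.
  rewrite mul1r.
  apply: (@le_trans _ _ ((expR (delta * L) * expR (8 * alpha * L)) ^+ k)).
    by apply: lerXn2r; rewrite ?nnegrE ?mulr_ge0 ?expR_ge0// ler_wpM2r ?expR_ge0.
  rewrite -expRD -expRM_natl ler_expR /th.
  by rewrite le_eqVlt; apply/orP; left; apply/eqP; ring.
apply: (le_trans (ler_wpM2l K0 ps)).
set s := #|supp beta0| in ps dk *.
rewrite (_ : K * _ = 2 * (expR ((th - (A4 - th - 2 * delta) * (D - 1)) * s%:R * L) * (K * prior s))); last ring.
rewrite ler_pM2l//; apply: (le_trans (ler_wpM2l (expR_ge0 _) dk)).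
rewrite -expRD ler_expR.
have sL : 0 <= s%:R * L by rewrite mulr_ge0 // (le_trans ler01 L1).
have h1 : (2 + 8 * alpha + delta + th) * (s%:R * L) <= 9 / 4 * (s%:R * L).
  by apply: ler_wpM2r => //; rewrite /th /alphaA /deltaA; lra.
have h2 : 41 / 48 * A4 * ((D - 1) * (s%:R * L)) <= (A4 - th - 2 * delta) * ((D - 1) * (s%:R * L)).
  apply: ler_wpM2r; first by rewrite mulr_ge0// subr_ge0.
  by rewrite /th /alphaA /deltaA; lra.
lra.
Qed.

Notation M1 := (2 * CA A3 A4).

Lemma lam_sqr_le : lam ^+ 2 <= 16 * N ^+ 2 * L.
Proof.
have L0 : 0 <= L by apply: le_trans L_ge1.
have -> : 16 * N ^+ 2 * L = (4 * N * Num.sqrt L) ^+ 2 by rewrite !exprMn sqr_sqrtr//; ring.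
by apply: lerXn2r; rewrite ?nnegrE ?(ltW lam_gt0)// !mulr_ge0 ?sqrtr_ge0// ltW.
Qed.

Lemma supp0 : supp (0 : 'cV[R]_p) = finset.set0.
Proof. by apply/setP => i; rewrite suppE mxE eqxx inE. Qed.

Lemma card_supp0 (b : 'cV[R]_p) : #|supp b| = 0%N -> b = 0.
Proof.
move=> /cards0_eq b0; apply/colP => i; rewrite mxE; apply/eqP/negPn.
by rewrite -suppE b0 inE.
Qed.

Definition radius2 (bs : 'cV[R]_p) (f : R) : R :=
  #|supp bs|%:R * L / f ^+ 2 + norm2 (X *m (bs - beta0)) ^+ 2.

Lemma CA_ge : 5 <= CA A3 A4 /\ c <= 1 / 4.
Proof.
have [m0 m1 mA4] := mA_bounds; have [A10 A20 A30 A40] := A_gt0.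
split; last by rewrite /cA; lra.
rewrite /CA; have : 0 <= 51 / alpha by rewrite divr_ge0// /alphaA; lra.
lra.
Qed.

Lemma radius2_ge bs f : 0 < f <= 1 -> #|supp bs|%:R * L <= radius2 bs f - norm2 (X *m (bs - beta0)) ^+ 2.
Proof.
move=> /andP[f0 f1]; rewrite /radius2 addrK ler_pdivlMr ?exprn_gt0//.
rewrite ler_piMr ?expr_le1 ?(ltW f0)// mulr_ge0// (le_trans _ L_ge1)//.
Qed.

Lemma dominate_bad (bs : 'cV[R]_p) f (B : set 'cV[R]_p) : 0 < f <= 1 -> compat X N (supp bs) f ->
  (forall b, B b -> M1 * radius2 bs f < weighted_loss bs b) ->
  exists J, [/\ dominates B J, forall S y b, 0 <= J S y b, forall S, rmeas (J S) &
    (expected_mass J <= (3 * expR (2 - c * L / 2))%:E)%E].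
Proof.
move=> f01 cf HB; have [f0 f1] := andP f01.
have [m0 m1 mA4] := mA_bounds; have [A10 A20 A30 A40] := A_gt0.
have [CA5 c4] := CA_ge.
have L0 : 0 <= L by apply: le_trans L_ge1.
have a0 : 0 < alpha by rewrite /alphaA; lra.
have c0 : 0 < c by rewrite /cA; lra.
have sr := radius2_ge bs f01.
have sL0 : 0 <= #|supp bs|%:R * L by rewrite mulr_ge0.
have D0 := sqr_ge0 (norm2 (X *m (bs - beta0))).
have r0 : 0 <= radius2 bs f by lra.
(* The radius can be 0, so the threshold alone gives no vanishing bound. Every [b] in [B] also has
   loss at least c L, and averaging both lower bounds lets half of [M1] cancel the exponent while c
   L / 2 survives. *)
set Rr := (M1 * radius2 bs f + c * L) / 2.
have HR b : B b -> Rr <= weighted_loss bs b.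
  move=> /HB hb; suff : c * L <= weighted_loss bs b by rewrite /Rr; lra.
  have [b0|b0] := posnP #|supp b|; last first.
    have cc : c * L <= c * #|supp b|%:R * L.
      by rewrite ler_wpM2r// ler_peMr ?ler1n// ltW.
    have h1 : 0 <= alpha / 8 * norm2 (X *m (b - bs)) ^+ 2 by rewrite mulr_ge0 ?sqr_ge0//; lra.
    have h2 : 0 <= lam / 8 * norm1 (b - bs) by rewrite mulr_ge0 ?norm1_ge0// divr_ge0// ltW.
    by rewrite /weighted_loss; lra.
  have [s0|s0] := posnP #|supp bs|.
    move: hb; rewrite (card_supp0 b0) (card_supp0 s0) /weighted_loss subrr mulmx0 norm2_0 expr0n/=.
    have -> : norm1 (0 : 'cV[R]_p) = 0 by rewrite /norm1 big1// => i _; rewrite mxE normr0.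
    rewrite supp0 cards0 !(mulr0, mul0r, addr0) -(card_supp0 s0) ltNge mulr_ge0//; lra.
  have : L <= #|supp bs|%:R * L by rewrite ler_peMl ?ler1n.
  move=> Ls; apply: le_trans (ltW hb); apply: (@le_trans _ _ (1 * L)); first by rewrite ler_wpM2r//; lra.
  by apply: ler_pM => //; lra.
have [J [d1 d2 d3 d4]] := dominate_loss (compat_cone N_gt0 f0 lam_gt0 a0 cf) HR.
exists J; split => //; apply: le_trans d4 _; rewrite lee_fin ler_pM2l// ler_expR.
set G := 25 / 8 * _.
have G1 : G <= 50 / alpha * (#|supp bs|%:R * L / f ^+ 2).
  rewrite /G (_ : 50 / alpha * _ = 25 / 8 * ((16 * N ^+ 2 * L) * #|supp bs|%:R / (alpha * N ^+ 2 * f ^+ 2))).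
    have den0 : 0 <= alpha * N ^+ 2 * f ^+ 2.
      by apply: mulr_ge0; [apply: mulr_ge0|]; rewrite ?sqr_ge0 ?(ltW a0).
    rewrite ler_pM2l//; apply: ler_wpM2r; first by rewrite invr_ge0.
    by apply: ler_wpM2r => //; exact: lam_sqr_le.
  by field; rewrite !gt_eqF.
have aV : 0 < alpha^-1 by rewrite invr_gt0.
have h1 : (alpha^-1 + 5 + A3) * (#|supp bs|%:R * L + norm2 (X *m (bs - beta0)) ^+ 2) <=
    (alpha^-1 + 5 + A3) * radius2 bs f by apply: ler_wpM2l; lra.
have h2 : 50 / alpha * (#|supp bs|%:R * L / f ^+ 2) <= 50 / alpha * radius2 bs f.
  by apply: ler_wpM2l; [rewrite divr_ge0// ltW|rewrite /radius2 lerDl].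
have : CA A3 A4 * radius2 bs f = (alpha^-1 + 5 + A3) * radius2 bs f + 50 / alpha * radius2 bs f.
  by rewrite /CA; field; rewrite gt_eqF.
rewrite /Rr; lra.
Qed.

(* The constant 33 of [psi_arg] leaves room for [Gamma] once lam is a small
   multiple (depending on A4) of lambda_bar. *)
Lemma dominate_large t f (B : set 'cV[R]_p) : 0 < f <= 1 -> compat X N (supp beta0) f ->
  (0 < #|supp beta0|)%N -> 0 <= t <= alpha * A4 -> lam ^+ 2 = 4 * t ^+ 2 * N ^+ 2 * L ->
  (forall b, B b -> (1 + 3 / A4 + 33 * t / f ^+ 2) * #|supp beta0|%:R < #|supp b|%:R) ->
  exists J, [/\ dominates B J, forall S y b, 0 <= J S y b, forall S, rmeas (J S) &
    (expected_mass J <= (2 * expR (2 - L / 4))%:E)%E].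
Proof.
move=> f01 cf s0 /andP[t0 tA] lE HB; have [f0 f1] := andP f01.
have [m0 m1 mA4] := mA_bounds; have [A10 A20 A30 A40] := A_gt0.
have L0 : 0 <= L by apply: le_trans L_ge1.
have a0 : 0 < alpha by rewrite /alphaA; lra.
have u0 : 0 <= t / f ^+ 2 by rewrite divr_ge0 ?sqr_ge0.
have D1 : 1 <= 1 + 3 / A4 + 33 * t / f ^+ 2.
  have : 0 <= 3 / A4 by rewrite divr_ge0// ltW.
  by rewrite -mulrA; lra.
have [J [d1 d2 d3 d4]] := dominate_dimension (compat_cone N_gt0 f0 lam_gt0 a0 cf) D1 HB.
exists J; split => //; apply: le_trans d4 _; rewrite lee_fin ler_pM2l// ler_expR.
set s := #|supp beta0|%:R.
have s1 : 1 <= s by rewrite ler1n.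
have sL : L <= s * L by rewrite ler_peMl.
rewrite lE.
have -> : 25 / 8 * (4 * t ^+ 2 * N ^+ 2 * L * s / (alpha * N ^+ 2 * f ^+ 2)) =
   25 / 2 * (t / alpha) * (t / f ^+ 2) * (s * L) by field; rewrite !gt_eqF.
(* The term 3 / A4 yields 123/48, which exceeds 9/4 by 15/48 and leaves the decay L / 4; the term in
   t outweighs the shrinkage cost. *)
have -> : 41 / 48 * A4 * (1 + 3 / A4 + 33 * t / f ^+ 2 - 1) =
   123 / 48 + 1353 / 48 * A4 * (t / f ^+ 2) by field; rewrite !gt_eqF.
have h1 : t / alpha <= A4 by rewrite ler_pdivrMr// mulrC.
have h2 : 25 / 2 * (t / alpha) * (t / f ^+ 2) <= 1353 / 48 * A4 * (t / f ^+ 2).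
  by apply: ler_wpM2r => //; lra.
have h3 := ler_wpM2r (le_trans L0 sL) h2.
lra.
Qed.

(** It involves only p and A4, which gives uniformity over [beta0] and [bs]. The 4 comes from the
    noise, the 5 = 3 + 2 from the two bad events. *)
Definition eps_bound := (4 + 5 * expR 2) * expR (- (delta * L)).

Lemma eps_boundP (x : \bar R) (J : {set 'I_p} -> 'cV[R]_n -> 'cV[R]_p -> R) :
  (x <= (\sum_(S : {set 'I_p} | (0 < #|S|)%N) (2 * expR (- (2 * L))) ^+ #|S|)%:E +
    expected_mass J)%E ->
  (expected_mass J <= (3 * expR (2 - c * L / 2) + 2 * expR (2 - L / 4))%:E)%E ->
  (x <= eps_bound%:E)%E.
Proof.
move=> xJ eJ; have [m0 m1 mA4] := mA_bounds; have L1 := L_ge1.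
have dL : delta * L <= L by rewrite ler_piMl// /deltaA; lra.
apply: (le_trans xJ); apply: (le_trans (leeD (le_refl _) eJ)); rewrite -EFinD lee_fin.
have n1 : \sum_(S : {set 'I_p} | (0 < #|S|)%N) (2 * expR (- (2 * L))) ^+ #|S| <= 4 * expR (- L).
  apply: noise_sum_le => //; have e0 : expR (delta * L) <= expR L by rewrite ler_expR.
  by have := eight_le; lra.
have e1 : expR (- L) <= expR (- (delta * L)) by rewrite ler_expR; lra.
have e2 : expR (2 - c * L / 2) <= expR 2 * expR (- (delta * L)).
  rewrite -expRD ler_expR; have : delta * L <= c / 2 * L by apply: ler_wpM2r; rewrite /deltaA /cA; lra.
  lra.
have e3 : expR (2 - L / 4) <= expR 2 * expR (- (delta * L)).
  rewrite -expRD ler_expR; have : delta * L <= 1 / 4 * L by apply: ler_wpM2r; rewrite /deltaA; lra.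
  lra.
rewrite /eps_bound; lra.
Qed.

Lemma concentration (bs : 'cV[R]_p) f (B : set 'cV[R]_p) : 0 < f <= 1 -> compat X N (supp bs) f ->
  (forall b, B b -> M1 * radius2 bs f < weighted_loss bs b) ->
  (post_expect X prior lam beta0 B <= eps_bound%:E)%E.
Proof.
move=> f01 cf HB; have [J [d1 d2 d3 d4]] := dominate_bad f01 cf HB.
apply: eps_boundP (post_expect_le prior_ge0 lam_gt0 UsP d2 d3 d1) _.
by apply: le_trans d4 _; rewrite lee_fin lerDl mulr_ge0 ?expR_ge0.
Qed.

(** The dominating functions of the two bad events, centred at [bs] and at [beta0], are simply
    added, so the noise event is paid for once. *)
Lemma concentration_sparse (bs : 'cV[R]_p) f t f0 (B : set 'cV[R]_p) :
  0 < f <= 1 -> compat X N (supp bs) f ->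
  0 < f0 <= 1 -> compat X N (supp beta0) f0 ->
  (0 < #|supp beta0|)%N -> 0 <= t <= alpha * A4 -> lam ^+ 2 = 4 * t ^+ 2 * N ^+ 2 * L ->
  (forall b, B b -> weighted_loss bs b <= M1 * radius2 bs f ->
    (1 + 3 / A4 + 33 * t / f0 ^+ 2) * #|supp beta0|%:R < #|supp b|%:R) ->
  (post_expect X prior lam beta0 B <= eps_bound%:E)%E.
Proof.
move=> f01 cf f001 cf0 s0 tA lE HB.
pose B1 := [set b | M1 * radius2 bs f < weighted_loss bs b].
pose B2 := [set b : 'cV[R]_p | (1 + 3 / A4 + 33 * t / f0 ^+ 2) * #|supp beta0|%:R < #|supp b|%:R].
have [J1 [d1 d2 d3 d4]] := @dominate_bad bs f B1 f01 cf (fun _ h => h).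
have [J2 [e1 e2 e3 e4]] := @dominate_large t f0 B2 f001 cf0 s0 tA lE (fun _ h => h).
have BU : B `<=` B1 `|` B2.
  move=> b Bb; have [h|h] := leP (weighted_loss bs b) (M1 * radius2 bs f); last by left.
  by right; exact: HB h.
have J0 S y b : 0 <= J1 S y b + J2 S y b by rewrite addr_ge0.
have mJ S : rmeas (fun y b => J1 S y b + J2 S y b) by exact: rmeasD.
apply: eps_boundP (post_expect_le prior_ge0 lam_gt0 UsP J0 mJ (dominatesU lam_gt0 BU d1 e1)) _.
by rewrite expected_massD// EFinD leeD.
Qed.

End Concentration.

(** * Compatibility numbers and sparsification *)

Section Compatibility.
Context {R : realType} (n p : nat) (X : 'M[R]_(n, p)).
Notation N := (normX X).

Lemma norm2D_sqr m (x y : 'cV[R]_m) :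
  norm2 (x + y) ^+ 2 = norm2 x ^+ 2 + 2 * dot x y + norm2 y ^+ 2.
Proof. by rewrite !norm2_sqr dotDl !dotDr (dotC y x); ring. Qed.

Lemma norm2_col j : norm2 (col j X) = Num.sqrt (\sum_(i < n) X i j ^+ 2).
Proof. by congr Num.sqrt; apply: eq_bigr => i _; rewrite mxE. Qed.

Lemma col_le_normX j : norm2 (col j X) <= N.
Proof. by rewrite norm2_col /normX; exact: (le_bigmax _ (fun j => Num.sqrt (\sum_(i < n) X i j ^+ 2))). Qed.

Lemma normX_attained : 0 < N -> exists j, norm2 (col j X) = N.
Proof.
move=> N0; apply: contrapT => /forallNP h.
have {}h j : norm2 (col j X) < N by rewrite lt_neqAle col_le_normX andbT; apply/eqP; exact: h.
suff : N < N by rewrite ltxx.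
rewrite {1}/normX; apply: (big_ind (fun x => x < N)) => // [x y|j _].
  by rewrite gt_max => -> ->.
by rewrite -norm2_col.
Qed.

Lemma delta_facts (j : 'I_p) : let b : 'cV[R]_p := delta_mx j 0 in
  [/\ #|supp b| = 1%N, norm1 b = 1, norm2 b = 1 & X *m b = col j X].
Proof.
move=> b; have bj i : b i 0 = (i == j)%:R by rewrite mxE eqxx andbT.
split.
- rewrite (_ : supp b = [set j]%SET) ?cards1//.
  by apply/setP => i; rewrite suppE bj inE; case: (i == j); rewrite ?oner_eq0 ?eqxx.
- rewrite /norm1 (bigD1 j)//= bj eqxx normr1 big1 ?addr0// => i /negPf ij.
  by rewrite bj ij normr0.
- rewrite /norm2 (bigD1 j)//= bj eqxx expr1n big1 ?addr0 ?sqrtr1// => i /negPf ij.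
  by rewrite bj ij expr0n.
- by rewrite colE.
Qed.

Hypothesis N_gt0 : 0 < N.

(** The coordinate vector of a column of maximal norm has ratio 1 and support of size one. Together
    with nonnegativity this makes the infimum an honest real number. *)
Lemma phibar_le1 (K : \bar R) : (1 <= K)%E -> (phibar X K <= 1)%E.
Proof.
move=> K1; have [j jN] := normX_attained N_gt0; have [s1 n1 n2 Xb] := delta_facts j.
apply: ereal_inf_lbound; exists (delta_mx j 0); first by rewrite /= s1.
by rewrite s1 n1 Xb jN sqrtr1 !mulr1 divff// gt_eqF.
Qed.

Lemma phitilde_le1 (K : \bar R) : (1 <= K)%E -> (phitilde X K <= 1)%E.
Proof.
move=> K1; have [j jN] := normX_attained N_gt0; have [s1 n1 n2 Xb] := delta_facts j.
apply: ereal_inf_lbound; exists (delta_mx j 0); first by rewrite /= s1.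
by rewrite n2 Xb jN !mulr1 divff// gt_eqF.
Qed.

Lemma norm2_mul_sqrt_ge0 (v : 'cV[R]_n) (k x : R) : 0 <= x -> 0 <= norm2 v * Num.sqrt k / (N * x).
Proof. by move=> x0; rewrite divr_ge0 ?mulr_ge0 ?norm2_ge0 ?sqrtr_ge0// ltW. Qed.

Lemma phi_ge0 S : (0 <= phi X S)%E.
Proof. by apply: le_ereal_inf_tmp => _ [b _ <-]; rewrite lee_fin norm2_mul_sqrt_ge0// norm1_on_ge0. Qed.

Lemma phibar_ge0 K : (0 <= phibar X K)%E.
Proof. by apply: le_ereal_inf_tmp => _ [b _ <-]; rewrite lee_fin norm2_mul_sqrt_ge0// norm1_ge0. Qed.

Lemma phitilde_ge0 K : (0 <= phitilde X K)%E.
Proof.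
apply: le_ereal_inf_tmp => _ [b _ <-].
by rewrite lee_fin divr_ge0 ?norm2_ge0// mulr_ge0 ?norm2_ge0// ltW.
Qed.

Lemma fin01 (x : \bar R) : (0 <= x)%E -> (x <= 1)%E -> exists2 r : R, x = r%:E & 0 <= r <= 1.
Proof. by case: x => [r| |]//; rewrite !lee_fin => r0 r1; exists r => //; rewrite r0. Qed.

(* Signs are chosen one column at a time so that each cross term is nonpositive. *)
Lemma sign_vector (r : seq 'I_p) : uniq r -> exists b : 'cV[R]_p,
  [/\ forall j, j \in r -> `|b j 0| = 1, forall j, j \notin r -> b j 0 = 0 &
      norm2 (X *m b) ^+ 2 <= (size r)%:R * N ^+ 2].
Proof.
elim: r => [_|j r IH /= /andP[jr /IH[b [b1 b0 bN]]]].
  by exists 0; split => // [j _|]; rewrite ?mxE// mulmx0 norm2_0 expr0n mul0r.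
pose s : R := if 0 <= dot (X *m b) (col j X) then -1 else 1.
have s1 : `|s| = 1 by rewrite /s; case: ifP; rewrite ?normrN1 ?normr1.
have sd : s * dot (X *m b) (col j X) <= 0.
  by rewrite /s; case: ifPn; rewrite -?ltNge ?mulN1r ?mul1r ?oppr_le0// => /ltW.
pose b' : 'cV[R]_p := b + s *: delta_mx j 0.
have b'E i : b' i 0 = b i 0 + s * (i == j)%:R by rewrite !mxE eqxx andbT.
exists b'; split.
- move=> i; rewrite inE b'E; have [->|ij] := eqVneq i j; first by rewrite b0// add0r mulr1 s1.
  by move=> /= ir; rewrite mulr0 addr0 b1.
- by move=> i; rewrite inE negb_or b'E => /andP[/negPf-> ir]; rewrite mulr0 addr0 b0.
have -> : X *m b' = X *m b + s *: col j X by rewrite mulmxDr -scalemxAr colE.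
rewrite norm2_sqr dotDl !dotDr !dotZr !dotZl (dotC (col j X)) -!norm2_sqr.
have -> : s * (s * norm2 (col j X) ^+ 2) = norm2 (col j X) ^+ 2.
  by rewrite mulrA -expr2 -real_normK ?num_real// s1 expr1n mul1r.
have cN : norm2 (col j X) ^+ 2 <= N ^+ 2.
  by apply: lerXn2r; rewrite ?nnegrE ?norm2_ge0 ?(ltW N_gt0)// col_le_normX.
rewrite /= -natr1 mulrDl mul1r; lra.
Qed.

(** Correlated columns could add up, so the test vector is a sign vector on S with image of norm at
    most sqrt |S| times N. S must be nonempty: otherwise the infimum is over the empty set and
    equals +oo. *)
Lemma phi_le1 (S : {set 'I_p}) : (0 < #|S|)%N -> (phi X S <= 1)%E.
Proof.
move=> S0; have [b [b1 b0 bN]] := sign_vector (enum_uniq S).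
have s0 : 0 < #|S|%:R :> R by rewrite ltr0n.
have bS : norm1_on S b = #|S|%:R.
  by rewrite /norm1_on -sumr_const; apply: eq_bigr => i iS; rewrite b1 ?mem_enum.
apply: le_trans (_ : ((norm2 (X *m b) * Num.sqrt #|S|%:R / (N * #|S|%:R))%:E <= 1)%E).
  apply: ereal_inf_lbound; exists b; last by rewrite bS.
  rewrite /= bS; split; last by rewrite gt_eqF.
  rewrite [X in X <= _]/norm1_on big1 ?mulr_ge0// => i.
  by rewrite inE => iS; rewrite b0 ?mem_enum ?normr0.
rewrite lee_fin ler_pdivrMr ?mulr_gt0// mul1r.
rewrite -cardE in bN.
have h : norm2 (X *m b) <= Num.sqrt #|S|%:R * N.
  rewrite -(@ler_pXn2r _ 2)// ?nnegrE ?norm2_ge0 ?mulr_ge0 ?sqrtr_ge0 ?(ltW N_gt0)//.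
  by rewrite exprMn (sqr_sqrtr (ltW s0)).
apply: le_trans (ler_wpM2r (sqrtr_ge0 _) h) _.
by rewrite mulrAC -expr2 sqr_sqrtr ?(ltW s0)// mulrC.
Qed.

Lemma phi_compat (S : {set 'I_p}) (f : R) : (f%:E <= phi X S)%E -> compat X N S f.
Proof.
move=> fS d dS; have [x0|x0] := eqVneq (norm1_on S d) 0.
  by rewrite x0 mulr0 mulr_ge0 ?norm2_ge0 ?sqrtr_ge0.
have xp : 0 < norm1_on S d by rewrite lt_def x0 norm1_on_ge0.
have : (f%:E <= (norm2 (X *m d) * Num.sqrt #|S|%:R / (N * norm1_on S d))%:E)%E.
  by apply: (le_trans fS); apply: ereal_inf_lbound; exists d => //; split.
by rewrite lee_fin ler_pdivlMr ?mulr_gt0// mulrA (mulrC f).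
Qed.

Lemma card_supp_gt0 m (d : 'cV[R]_m) : d != 0 -> (0 < #|supp d|)%N.
Proof. by move=> d0; rewrite lt0n; apply: contra d0 => /eqP/card_supp0->. Qed.

Lemma norm1_eq0 m (d : 'cV[R]_m) : norm1 d = 0 -> d = 0.
Proof.
move=> /psumr_eq0P d0; apply/colP => i; rewrite mxE; apply/eqP.
by rewrite -normr_eq0; apply/eqP; exact: d0.
Qed.

Lemma phibar_norm1 K (r : R) (d : 'cV[R]_p) : (r%:E <= phibar X K)%E -> (#|supp d|%:R%:E <= K)%E ->
  r * (N * norm1 d) <= norm2 (X *m d) * Num.sqrt #|supp d|%:R.
Proof.
move=> rK dK; have [->|d0] := eqVneq d 0.
  have -> : norm1 (0 : 'cV[R]_p) = 0 by rewrite /norm1 big1// => i _; rewrite mxE normr0.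
  by rewrite !mulr0 mulr_ge0 ?norm2_ge0 ?sqrtr_ge0.
have xp : 0 < norm1 d by rewrite lt_def norm1_ge0 andbT; apply: contra d0 => /eqP/norm1_eq0->.
rewrite -ler_pdivlMr ?mulr_gt0// -lee_fin; apply: (le_trans rK).
by apply: ereal_inf_lbound; exists d => //=; rewrite card_supp_gt0.
Qed.

Lemma phitilde_norm2 K (r : R) (d : 'cV[R]_p) : (r%:E <= phitilde X K)%E -> (#|supp d|%:R%:E <= K)%E ->
  r * (N * norm2 d) <= norm2 (X *m d).
Proof.
move=> rK dK; have [->|d0] := eqVneq d 0; first by rewrite norm2_0 !mulr0 norm2_ge0.
have xp : 0 < norm2 d by rewrite lt_def norm2_ge0 andbT; apply: contra d0 => /eqP/norm2_eq0->.
rewrite -ler_pdivlMr ?mulr_gt0// -lee_fin; apply: (le_trans rK).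
by apply: ereal_inf_lbound; exists d => //=; rewrite card_supp_gt0.
Qed.

Lemma norm1_delta (j : 'I_p) (a : R) : norm1 (a *: delta_mx j 0 : 'cV[R]_p) = `|a|.
Proof.
rewrite /norm1 (bigD1 j)//= !mxE !eqxx/= mulr1 big1 ?addr0// => i /negPf ij.
by rewrite !mxE ij mulr0 normr0.
Qed.

(* Maurey's empirical method, derandomised: greedily add the atom that makes a
   nonpositive angle with the current error; one exists since the errors average to 0. *)
Lemma greedy_atoms (rho : 'cV[R]_p) k : exists w : 'cV[R]_p,
  [/\ (#|supp w| <= k)%N, supp w \subset supp rho &
      norm2 (X *m w - k%:R *: (X *m rho)) ^+ 2 <= k%:R * (2 * (N * norm1 rho)) ^+ 2].
Proof.
have [->|rho0] := eqVneq rho 0.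
  exists 0; rewrite supp0 cards0 fintype.subxx !mulmx0 scaler0 subrr norm2_0 expr0n/=.
  by split => //; rewrite mulr_ge0 ?sqr_ge0.
set l1 := norm1 rho.
have l10 : 0 < l1 by rewrite lt_def norm1_ge0 andbT; apply: contra rho0 => /eqP/norm1_eq0->.
elim: k => [|k [w [wk wS wN]]].
  exists 0; rewrite supp0 cards0 finset.sub0set mulmx0 scale0r subrr norm2_0 expr0n/=.
  by split => //; rewrite mul0r.
set u := X *m w - _ in wN.
pose a j : 'cV[R]_p := (l1 * Num.sg (rho j 0)) *: delta_mx j 0.
have Xa j : X *m a j = (l1 * Num.sg (rho j 0)) *: col j X by rewrite -scalemxAr colE.
have [j jS ju] : exists2 j, rho j 0 != 0 & dot u (X *m a j - X *m rho) <= 0.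
  apply: contrapT => h.
  have pos j : rho j 0 != 0 -> 0 < dot u (X *m a j - X *m rho).
    by move=> j0; rewrite ltNge; apply/negP => hj; apply: h; exists j.
  have : \sum_(j < p) `|rho j 0| * dot u (X *m a j - X *m rho) = 0.
    transitivity (dot u (\sum_(j < p) `|rho j 0| *: (X *m a j - X *m rho))).
      by rewrite dot_sumr; apply: eq_bigr => j _; rewrite dotZr.
    under eq_bigr do rewrite scalerBr.
    rewrite sumrB -scaler_suml -/(norm1 rho) -/l1 [in X in _ - X]mulmx_colE scaler_sumr.
    rewrite (eq_bigr (fun j => l1 *: (rho j 0 *: col j X))) ?subrr; first by rewrite dotC dot0l.
    by move=> j _; rewrite Xa !scalerA; congr (_ *: _); rewrite mulrCA [_ * Num.sg _]mulrC -numEsg.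
  move=> /psumr_eq0P h0.
  have [j j0] : exists j, rho j 0 != 0.
    apply: contrapT => /forallNP hh; move/eqP: rho0; apply; apply/colP => i; rewrite mxE.
    by apply/eqP/negPn/negP; exact: hh.
  have : `|rho j 0| * dot u (X *m a j - X *m rho) = 0.
    apply: h0 => // i _; have [->|i0] := eqVneq (rho i 0) 0; first by rewrite normr0 mul0r.
    by rewrite mulr_ge0// ltW// pos.
  by apply/eqP; rewrite mulf_neq0 ?normr_eq0// gt_eqF// pos.
exists (w + a j); split.
- apply: (@leq_trans #|j |: supp w|); last by rewrite (leq_trans (leq_card_setU _ _))// cards1 add1n.
  apply: subset_leq_card; apply/fintype.subsetP => i; rewrite suppE !inE !mxE eqxx andbT.
  by have [//|ij] := eqVneq i j; rewrite mulr0 addr0.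
- apply/fintype.subsetP => i; rewrite suppE.
  have [->|ij] := eqVneq i j; first by rewrite suppE.
  by rewrite !mxE (negPf ij) mulr0 addr0 -suppE; exact: (fintype.subsetP wS).
have -> : X *m (w + a j) - k.+1%:R *: (X *m rho) = u + (X *m a j - X *m rho).
  by rewrite /u mulmxDr -natr1 scalerDl scale1r opprD addrACA.
have aN : norm2 (X *m a j - X *m rho) ^+ 2 <= (2 * (N * l1)) ^+ 2.
  apply: lerXn2r; rewrite ?nnegrE ?norm2_ge0 ?mulr_ge0 ?(ltW l10) ?(ltW N_gt0)//.
  rewrite -mulmxBr; apply: le_trans (norm2_mulmx_le _ col_le_normX) _.
  rewrite mulrCA ler_pM2l//; apply: le_trans (norm1_triangle _ _) _.
  have -> : norm1 (- rho) = l1 by rewrite -[- rho]sub0r norm1_sub subr0.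
  rewrite norm1_delta normrM normr_sg jS mulr1 gtr0_norm//; lra.
move: aN ju; set e := X *m a j - X *m rho => aN ju.
rewrite norm2D_sqr -natr1 mulrDl mul1r.
by move: wN aN ju; rewrite -/l1; lra.
Qed.

Definition restrict (T : {set 'I_p}) (d : 'cV[R]_p) : 'cV[R]_p := \col_i (if i \in T then d i 0 else 0).

(** Large coordinates of [d] are kept exactly; the rest is replaced by an average of at most K / 2
    atoms, so the surrogate is sparse enough for [phitilde]. The constant 6 is 4 from the sampling
    error plus 2 from the norm of the small coordinates. *)
Lemma phitilde_maurey (K r : R) (d : 'cV[R]_p) : 2 <= K -> 0 <= r <= 1 ->
  (r%:E <= phitilde X K%:E)%E ->
  r * (N * norm2 d) <= norm2 (X *m d) + 6 * (N * norm1 d) / Num.sqrt K.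
Proof.
move=> K2 /andP[r0 r1] rK.
have [->|d0] := eqVneq d 0.
  by rewrite mulmx0 !norm2_0 !mulr0 add0r divr_ge0 ?sqrtr_ge0// !mulr_ge0 ?norm1_ge0 ?(ltW N_gt0).
set l1 := norm1 d.
have l10 : 0 < l1 by rewrite lt_def norm1_ge0 andbT; apply: contra d0 => /eqP/norm1_eq0->.
have K0 : 0 < K by lra.
(* At this level at most K / 2 coordinates are large, and the small ones have squared norm at most
   tau * l1. *)
pose tau := 2 * l1 / K.
have tau0 : 0 < tau by rewrite divr_gt0// mulr_gt0.
pose T := [set i | tau < `|d i 0|]%SET.
have cT : #|T|%:R <= K / 2.
  have : #|T|%:R * tau <= l1.
    rewrite mulr_natl -sumr_const /l1 (norm1_split T) -[leLHS]addr0 lerD ?norm1_on_ge0//.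
    by apply: ler_sum => i; rewrite inE => /ltW.
  rewrite -ler_pdivlMr// => h; apply: le_trans h _.
  by rewrite /tau le_eqVlt; apply/orP; left; apply/eqP; field; rewrite !gt_eqF.
pose dT := restrict T d; pose rho := restrict (~: T) d.
have dE : d = dT + rho.
  by apply/colP => i; rewrite !mxE finset.in_setC; case: (i \in T); rewrite /= ?addr0 ?add0r.
have rho2 : norm2 rho <= 2 * l1 / Num.sqrt K.
  rewrite -(@ler_pXn2r _ 2)// ?nnegrE ?norm2_ge0 ?divr_ge0 ?sqrtr_ge0 ?mulr_ge0 ?(ltW l10)//.
  rewrite expr_div_n (sqr_sqrtr (ltW K0)).
  apply: (@le_trans _ _ (tau * l1)).
    rewrite norm2_sqr /dot /l1 /norm1 mulr_sumr; apply: ler_sum => j _.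
    rewrite !mxE inE; have [jT|] := boolP (j \in T); first by rewrite mulr0 mulr_ge0 ?(ltW tau0).
    rewrite inE -leNgt/= => h.
    by rewrite -expr2 -real_normK ?num_real// expr2 ler_wpM2r.
  rewrite /tau mulrAC ler_wpM2r ?invr_ge0 ?(ltW K0)//.
  by rewrite exprMn -mulrA -expr2 ler_wpM2r ?sqr_ge0//; lra.
have rho1 : norm1 rho <= l1.
  apply: ler_sum => i _; rewrite !mxE; case: ifP => // _; rewrite normr0//.
pose k := Num.truncn (K / 2).
have kK : k%:R <= K / 2 < k.+1%:R by apply: truncn_itv; lra.
have k1 : 1 <= k%:R :> R.
  have [k0|] := posnP k; first by move: kK; rewrite k0; lra.
  by rewrite -(ler_nat R).
have k4 : K / 4 <= k%:R by case/andP: kK => _; rewrite -[k.+1%:R]natr1; lra.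
have [w [wk wS wN]] := greedy_atoms rho k.
have kn0 : k%:R != 0 :> R by rewrite gt_eqF//; lra.
pose v := k%:R^-1 *: w.
have vS i : v i 0 != 0 -> i \notin T /\ i \in supp w.
  move=> h; have iw : i \in supp w by rewrite suppE; apply: contra h => /eqP h; rewrite mxE h mulr0.
  split => //; have := fintype.subsetP wS i iw; rewrite suppE !mxE inE.
  by case: (i \in T); rewrite ?eqxx.
have vrho : norm2 (X *m v - X *m rho) <= 4 * (N * l1) / Num.sqrt K.
  have -> : X *m v - X *m rho = k%:R^-1 *: (X *m w - k%:R *: (X *m rho)).
    by rewrite scalerBr scalerA mulVf// scale1r -scalemxAr.
  rewrite -(@ler_pXn2r _ 2)// ?nnegrE ?norm2_ge0 ?divr_ge0 ?sqrtr_ge0 ?mulr_ge0 ?(ltW l10) ?(ltW N_gt0)//.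
  rewrite norm2Z exprMn expr_div_n (sqr_sqrtr (ltW K0)) real_normK ?num_real//.
  apply: (@le_trans _ _ (k%:R^-1 ^+ 2 * (k%:R * (2 * (N * l1)) ^+ 2))).
    rewrite ler_wpM2l ?sqr_ge0//; apply: le_trans wN _; rewrite ler_wpM2l//.
    apply: lerXn2r; rewrite ?nnegrE ?mulr_ge0 ?norm1_ge0 ?(ltW l10) ?(ltW N_gt0)//.
    by rewrite !ler_wpM2l ?(ltW N_gt0).
  have -> : k%:R^-1 ^+ 2 * (k%:R * (2 * (N * l1)) ^+ 2) = (N * l1) ^+ 2 * (4 / k%:R) by field.
  have -> : (4 * (N * l1)) ^+ 2 / K = (N * l1) ^+ 2 * (16 / K) by field; rewrite gt_eqF.
  rewrite ler_wpM2l ?sqr_ge0// ler_pdivrMr; last lra.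
  by rewrite mulrAC ler_pdivlMr//; lra.
pose z := dT + v.
have zK : ((#|supp z|%:R)%:E <= K%:E)%E.
  rewrite lee_fin; apply: (@le_trans _ _ (#|T|%:R + k%:R)); last by case/andP: kK; lra.
  rewrite -natrD ler_nat; apply: (@leq_trans #|T :|: supp w|%SET).
    apply: subset_leq_card; apply/fintype.subsetP => i; rewrite suppE finset.in_setU.
    have [_|iT] := boolP (i \in T); first by rewrite orTb.
    rewrite /z mxE [dT i 0]mxE (negPf iT) add0r.
    by move=> /vS[_ ->].
  by rewrite (leq_trans (leq_card_setU _ _))// leq_add2l.
have h1 := phitilde_norm2 rK zK.
(* The atoms avoid T, so the two parts of [z] have disjoint supports and no cancellation occurs. *)
have dTz : norm2 dT <= norm2 z.
  apply: ler_wsqrtr; apply: ler_sum => i _; have -> : z i 0 = dT i 0 + v i 0 by rewrite [LHS]mxE.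
  have [v0|/eqP/vS[iT _]] := pselect (v i 0 = 0); first by rewrite v0 addr0.
  by rewrite [dT i 0]mxE (negPf iT) add0r expr0n sqr_ge0.
have Xz : norm2 (X *m z) <= norm2 (X *m d) + 4 * (N * l1) / Num.sqrt K.
  have -> : X *m z = X *m d + (X *m v - X *m rho).
    rewrite [in RHS]dE /z !mulmxDr -addrA; congr (_ + _).
    by rewrite [RHS]addrC subrK.
  by apply: le_trans (norm2_triangle _ _) _; rewrite lerD2l.
have dd : norm2 d <= norm2 z + 2 * l1 / Num.sqrt K.
  by rewrite {1}dE; apply: le_trans (norm2_triangle _ _) _; exact: lerD.
have e0 : 0 <= N * (2 * l1 / Num.sqrt K).
  by rewrite mulr_ge0 ?(ltW N_gt0)// divr_ge0 ?sqrtr_ge0// mulr_ge0 ?(ltW l10).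
have h2 : r * (N * norm2 d) <= r * (N * norm2 z) + r * (N * (2 * l1 / Num.sqrt K)).
  by rewrite -mulrDr -mulrDr ler_wpM2l// ler_wpM2l ?(ltW N_gt0).
have h3 : r * (N * (2 * l1 / Num.sqrt K)) <= N * (2 * l1 / Num.sqrt K) by rewrite ler_piMl.
have : 6 * (N * l1) / Num.sqrt K = 4 * (N * l1) / Num.sqrt K + N * (2 * l1 / Num.sqrt K) by ring.
lra.
Qed.

End Compatibility.

(** * Recovery *)

Section Recovery.
Context {R : realType}.

(** [c0] separates the two regimes of t and is at most alpha A4, as [dominate_large] requires. [Kb]
    majorises both factors of the product of prediction error and dimension in the sparse l1 bound.
    [Kd] results from dividing by lam = 2 t N sqrt L with t >= c0, and [Kc = 6 Kd / c0] carries the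
    sparsification constant 6. *)
Definition M1 (A3 A4 : R) := 2 * CA A3 A4.
Definition c0 (A4 : R) := alphaA A4 * mA A4.
Definition Ka (A3 A4 : R) := 8 * M1 A3 A4 / alphaA A4.
Definition Kb (A3 A4 : R) := Ka A3 A4 + M1 A3 A4 / cA A4 + 1.
Definition Kc (A3 A4 : R) := 24 * M1 A3 A4 / c0 A4 ^+ 2.
Definition Kd (A3 A4 : R) := 4 * M1 A3 A4 / c0 A4.
Definition Mconst (A3 A4 : R) := Ka A3 A4 + Kb A3 A4 + Kc A3 A4 + Kd A3 A4 + 1.

Lemma const_facts (A3 A4 : R) : 0 < A3 -> 0 < A4 ->
  [/\ 0 < alphaA A4, 0 < c0 A4 <= 1, 10 <= M1 A3 A4 & 0 < cA A4] /\
  [/\ 1 <= Ka A3 A4, 0 <= Kc A3 A4, 0 <= Kd A3 A4 & c0 A4 <= alphaA A4 * A4] /\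
  0 <= M1 A3 A4 / cA A4.
Proof.
move=> A30 A40.
have m0 : 0 < mA A4 by rewrite /mA lt_min A40 ltr01.
have m1 : mA A4 <= 1 by rewrite /mA ge_min lexx orbT.
have mA4 : mA A4 <= A4 by rewrite /mA ge_min lexx.
have a0 : 0 < alphaA A4 by rewrite /alphaA; lra.
have a1 : alphaA A4 <= 1 by rewrite /alphaA; lra.
have k0 : 0 < c0 A4 by exact: mulr_gt0.
have k1 : c0 A4 <= 1 by rewrite /c0 mulr_ile1// ltW.
have CA5 : 5 <= CA A3 A4.
  by rewrite /CA; have : 0 <= 51 / alphaA A4 by [rewrite divr_ge0// ltW|]; lra.
have M10 : 10 <= M1 A3 A4 by rewrite /M1; lra.
have cc : 0 < cA A4 by rewrite /cA; lra.
split; first by split => //; rewrite k0.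
split; last by rewrite divr_ge0//; lra.
split.
- by rewrite /Ka ler_pdivlMr//; lra.
- by rewrite /Kc divr_ge0 ?sqr_ge0//; lra.
- by rewrite /Kd divr_ge0//; lra.
- by rewrite /c0 ler_pM2l.
Qed.

Context (n p : nat) (X : 'M[R]_(n, p)) (prior : nat -> R) (lam : R) (A1 A2 A3 A4 : R).
Notation L := (ln p%:R : R).
Notation N := (normX X).
Notation alpha := (alphaA A4).
Notation delta := (deltaA A4).
Hypothesis prior_ge0 : forall s, (s <= p)%N -> 0 <= prior s.
Hypothesis prior_sum1 : \sum_(k < p.+1) prior k = 1.
Hypothesis A_gt0 : [/\ 0 < A1, 0 < A2, 0 < A3 & 0 < A4].
Hypothesis prior_ratio : forall k, (1 <= k <= p)%N ->
  A1 * expR (- A3 * L) * prior k.-1 <= prior k /\ prior k <= A2 * expR (- A4 * L) * prior k.-1.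
Hypothesis lam_gt0 : 0 < lam.
Hypothesis N_gt0 : 0 < N.
Hypothesis p_gt0 : (0 < p)%N.
Hypothesis lam_lo : N / p%:R <= lam.
Hypothesis lam_hi : lam <= 4 * N * Num.sqrt L.
Hypothesis L_ge1 : 1 <= L.
Hypothesis A2_le : A2 <= expR (delta * L).
Hypothesis A1_ge : A1^-1 <= expR (delta * L).
Hypothesis eight_le : 8 <= expR (delta * L).
Hypothesis L_le : expR 2 * (1 + 8 * L) <= expR (delta * L).
Context (beta0 bs : 'cV[R]_p).
Hypothesis bs_le : (#|supp bs| <= #|supp beta0|)%N.
Notation s := #|supp bs|.
Notation s0 := #|supp beta0|.
Notation Delta := (norm2 (X *m (bs - beta0))).
Notation t := (lam / lambda_bar X).
Notation eps := (eps_bound p A4).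
Notation loss := (weighted_loss X lam A4).
Notation rad := (radius2 X beta0).
Notation M1' := (M1 A3 A4).

Lemma concentration_inst (b' : 'cV[R]_p) f (B : set 'cV[R]_p) :
  0 < f <= 1 -> compat X N (supp b') f ->
  (forall b, B b -> loss b' b <= M1' * rad b' f -> False) ->
  (post_expect X prior lam beta0 B <= eps%:E)%E.
Proof.
move=> f01 cf HB; have [Us UsP] := column_projections X.
apply: (concentration prior_ge0 prior_sum1 A_gt0 prior_ratio lam_gt0 N_gt0 (col_le_normX X) p_gt0
  lam_lo lam_hi L_ge1 A2_le A1_ge eight_le L_le UsP f01 cf) => b /HB hb.
by rewrite ltNge; apply/negP.
Qed.

Let L0 : 0 < L. Proof. exact: lt_le_trans ltr01 L_ge1. Qed.
Let sL0 : 0 < Num.sqrt L. Proof. by rewrite sqrtr_gt0. Qed.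
Let sL2 : Num.sqrt L ^+ 2 = L. Proof. by rewrite sqr_sqrtr// ltW. Qed.

Lemma lam_t : lam = 2 * t * N * Num.sqrt L.
Proof. by rewrite /lambda_bar; field; rewrite !gt_eqF. Qed.

Lemma t_gt0 : 0 < t.
Proof. by rewrite divr_gt0// /lambda_bar !mulr_gt0. Qed.

Lemma compat0 : compat X N (supp (0 : 'cV[R]_p)) 1.
Proof.
move=> d _; rewrite supp0 cards0 sqrtr0 mulr0.
by rewrite /norm1_on big_set0 mulr0.
Qed.

(** Serves the case where the right-hand side of the event is +oo; the concentration bound at centre
    0 already covers it. *)
Lemma post_expect_void (B : set 'cV[R]_p) : (forall b, ~ B b) ->
  (post_expect X prior lam beta0 B <= eps%:E)%E.
Proof.
move=> HB; apply: (@concentration_inst 0 1) => //; last by move=> b /HB.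
  by rewrite ltr01 lexx.
exact: compat0.
Qed.

(** Of the 2 in [psi_arg], one unit is used by the dimension bound on [b] and the other by the
    support of the subtracted vector [d]. *)
Lemma concentration_dim (b' : 'cV[R]_p) f (B : set 'cV[R]_p) :
  0 < f <= 1 -> compat X N (supp b') f -> (0 < s0)%N -> t <= c0 A4 ->
  (forall b, B b -> loss b' b <= M1' * rad b' f ->
    (forall d : 'cV[R]_p, (#|supp d| <= s0)%N ->
      ((#|supp (b - d)|%:R)%:E <= psi_arg X A4 lam (supp beta0))%E) -> False) ->
  (post_expect X prior lam beta0 B <= eps%:E)%E.
Proof.
move=> f01 cf s00 tc HB.
have [A10 A20 A30 A40] := A_gt0.
have [_ [[_ _ _ cA4] _]] := const_facts A30 A40.
have s0R : 0 < s0%:R :> R by rewrite ltr0n.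
have cd (b d : 'cV[R]_p) : (#|supp (b - d)| <= #|supp b| + #|supp d|)%N.
  apply: (leq_trans _ (leq_card_setU _ _)); apply: subset_leq_card.
  by apply: supp_sub_subset; [exact: finset.subsetUl|exact: finset.subsetUr].
have [f0 fE /andP[f00 f01']] := fin01 (phi_ge0 N_gt0 (supp beta0)) (phi_le1 N_gt0 s00).
(* With phi(S0) = 0 the argument [psi_arg] is +oo and no bound on the dimension is required. *)
have [f0z|f0nz] := eqVneq f0 0.
  apply: (concentration_inst f01 cf) => b Bb lb; apply: HB Bb lb _ => d _.
  rewrite /psi_arg fE f0z mule0 inve0 mulry gtr0_sg ?mul1e; last by rewrite mulr_gt0// t_gt0.
  by rewrite addey// mulyr gtr0_sg// mul1e leey.
have f0p : 0 < f0 by rewrite lt_def f0nz.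
have [Us UsP] := column_projections X.
have f0c : compat X N (supp beta0) f0 by apply: phi_compat => //; rewrite fE.
have f01b : 0 < f0 <= 1 by rewrite f0p.
have tb : 0 <= t <= alpha * A4 by rewrite (ltW t_gt0) (le_trans tc).
have lE : lam ^+ 2 = 4 * t ^+ 2 * N ^+ 2 * L by rewrite {1}lam_t !exprMn sL2; ring.
apply: (concentration_sparse prior_ge0 prior_sum1 A_gt0 prior_ratio lam_gt0 N_gt0 (col_le_normX X) p_gt0
  lam_lo lam_hi L_ge1 A2_le A1_ge eight_le L_le UsP f01 cf f01b f0c s00 tb lE) => b Bb lb.
rewrite ltNge; apply/negP => hb; apply: HB Bb lb _ => d ds.
have e2 : (f0%:E * f0%:E)^-1%E = (f0 ^- 2)%:E.
  by rewrite -EFinM inver mulf_eq0 orbb (negPf f0nz) -expr2.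
rewrite /psi_arg fE e2 -!EFinM lee_fin.
have h1 : #|supp (b - d)|%:R <= #|supp b|%:R + s0%:R :> R.
  by rewrite -natrD ler_nat (leq_trans (cd b d))// leq_add2l.
by move: hb; rewrite -!mulrA; lra.
Qed.

Lemma sqrt_le (x y : R) : 0 <= y -> x ^+ 2 <= y ^+ 2 -> x <= y.
Proof.
move=> y0 h; apply: le_trans (ler_norm x) _.
by rewrite -(@ler_pXn2r _ 2)// ?nnegrE// real_normK ?num_real.
Qed.

Section GoodEvent.
Variables (b' b : 'cV[R]_p) (f : R).
Hypothesis f01 : 0 < f <= 1.
Hypothesis good : loss b' b <= M1' * rad b' f.

Lemma good_facts : [/\ norm2 (X *m (b - b')) ^+ 2 <= Ka A3 A4 * rad b' f,
  lam * norm1 (b - b') <= 8 * M1' * rad b' f,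
  #|supp b|%:R * L <= M1' / cA A4 * rad b' f & 0 <= rad b' f].
Proof.
have [A10 A20 A30 A40] := A_gt0.
have [[a0 c01 M10 cc] _] := const_facts A30 A40.
move: good; rewrite /weighted_loss => h.
have h1 : 0 <= alpha / 8 * norm2 (X *m (b - b')) ^+ 2 by rewrite mulr_ge0 ?sqr_ge0//; lra.
have h2 : 0 <= lam / 8 * norm1 (b - b') by rewrite mulr_ge0 ?norm1_ge0// divr_ge0// ltW.
have h3 : 0 <= cA A4 * #|supp b|%:R * L by rewrite mulr_ge0 ?(ltW L0)// mulr_ge0 ?(ltW cc).
split.
- by rewrite /Ka mulrAC ler_pdivlMr//; lra.
- lra.
- rewrite mulrAC ler_pdivlMr//; lra.
- by have := radius2_ge X L_ge1 beta0 b' f01; have := sqr_ge0 (norm2 (X *m (b' - beta0)));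
    have : 0 <= #|supp b'|%:R * L by [rewrite mulr_ge0 ?(ltW L0)|]; lra.
Qed.

Lemma good_norm1 : c0 A4 <= t -> N * norm1 (b - b') <= Kd A3 A4 * rad b' f / Num.sqrt L.
Proof.
move=> tc; have [A10 A20 A30 A40] := A_gt0.
have [[a0 /andP[c00 c01] M10 cc] _] := const_facts A30 A40.
have [_ h _ r0] := good_facts.
rewrite ler_pdivlMr// /Kd [leRHS]mulrAC ler_pdivlMr//.
have : c0 A4 * (N * norm1 (b - b') * Num.sqrt L) <= t * (N * norm1 (b - b') * Num.sqrt L).
  apply: ler_wpM2r => //; apply: mulr_ge0; last exact: ltW.
  by apply: mulr_ge0; [exact: ltW|exact: norm1_ge0].
have : lam * norm1 (b - b') = 2 * (t * (N * norm1 (b - b') * Num.sqrt L)) by rewrite {1}lam_t; ring.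
lra.
Qed.

(** Both |X d|^2 and |supp d| L are of order [rad], so the product of their square roots given by
    [phibar] is of order [rad], at the price of a single factor [r]. *)
Lemma good_norm1_sparse r : 0 <= r -> (r%:E <= psibar X A4 lam (supp beta0))%E ->
  ((#|supp (b - b')|%:R)%:E <= psi_arg X A4 lam (supp beta0))%E ->
  r * (N * norm1 (b - b')) <= Kb A3 A4 * rad b' f / Num.sqrt L.
Proof.
move=> r0 rp dK; have [A10 A20 A30 A40] := A_gt0.
have [[a0 c01 M10 cc] [[Ka1 _ _ _] Mc]] := const_facts A30 A40.
have [g1 _ g3 g4] := good_facts.
apply: (le_trans (phibar_norm1 N_gt0 rp dK)).
have cd : (#|supp (b - b')|%:R : R) <= #|supp b|%:R + #|supp b'|%:R.
  rewrite -natrD ler_nat; apply: (leq_trans _ (leq_card_setU _ _)); apply: subset_leq_card.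
  by apply: supp_sub_subset; [exact: finset.subsetUl|exact: finset.subsetUr].
have sr : #|supp b'|%:R * L <= rad b' f.
  by have := radius2_ge X L_ge1 beta0 b' f01; have := sqr_ge0 (norm2 (X *m (b' - beta0))); lra.
have cL : #|supp (b - b')|%:R * L <= (M1' / cA A4 + 1) * rad b' f.
  by have := ler_wpM2r (ltW L0) cd; lra.
have Kb0 : 0 <= Kb A3 A4 by rewrite /Kb; lra.
rewrite ler_pdivlMr// -mulrA -sqrtrM ?ler0n//.
apply: sqrt_le; first exact: mulr_ge0.
have cL0 : 0 <= #|supp (b - b')|%:R * L by apply: mulr_ge0; rewrite ?ler0n ?(ltW L0).
rewrite exprMn (sqr_sqrtr cL0).
apply: (@le_trans _ _ ((Ka A3 A4 * rad b' f) * ((M1' / cA A4 + 1) * rad b' f))).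
  by apply: ler_pM => //; exact: sqr_ge0.
have -> : Ka A3 A4 * rad b' f * ((M1' / cA A4 + 1) * rad b' f) =
  (Ka A3 A4 * (M1' / cA A4 + 1)) * rad b' f ^+ 2 by ring.
rewrite exprMn; apply: ler_wpM2r; first exact: sqr_ge0.
rewrite expr2; apply: ler_pM; rewrite /Kb; lra.
Qed.

Lemma good_pred y : 0 <= y -> rad b' f <= y ^+ 2 -> norm2 (X *m (b - b')) <= Ka A3 A4 * y.
Proof.
move=> y0 ry; have [A10 A20 A30 A40] := A_gt0.
have [_ [[Ka1 _ _ _] _]] := const_facts A30 A40.
have [g1 _ g3 g4] := good_facts.
apply: sqrt_le; first by apply: mulr_ge0 => //; lra.
apply: (le_trans g1); rewrite exprMn; apply: ler_pM => //; first lra.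
by rewrite expr2 ler_peMl//; lra.
Qed.

(** The l1 error is of order y^2 / sqrt L, so sparsification costs y^2 / sqrt (K L). As K is at
    least t s0 / f0^2 with t >= c0, the bound on y makes sqrt (K L) at least c0 y, and the cost is
    linear in y. *)
Lemma good_norm2 q f0 y : c0 A4 <= t -> 0 <= q <= 1 ->
  phi X (supp beta0) = f0%:E -> 0 < f0 -> (0 < s0)%N ->
  (q%:E <= psitilde X A4 lam (supp beta0))%E ->
  0 <= y <= Num.sqrt (s0%:R * L) / f0 -> rad b' f <= y ^+ 2 ->
  q * (N * norm2 (b - b')) <= (Ka A3 A4 + Kc A3 A4) * y.
Proof.
move=> tc q01 fE f0p s00 qp /andP[y0 yf] ry; have [A10 A20 A30 A40] := A_gt0.
have [[a0 /andP[c00 c01] M10 cc] [[Ka1 Kc0 Kd0 _] _]] := const_facts A30 A40.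
have s1 : 1 <= s0%:R :> R by rewrite ler1n.
pose K := (2 + 3 / A4 + 33 * t / f0 ^+ 2) * s0%:R.
have KE : psi_arg X A4 lam (supp beta0) = K%:E.
  have e2 : (f0%:E * f0%:E)^-1%E = (f0 ^- 2)%:E.
    by rewrite -EFinM inver mulf_eq0 orbb gt_eqF// -expr2.
  by rewrite /psi_arg fE e2 -!EFinM /K.
have A4V : 0 <= 3 / A4 by rewrite divr_ge0// ltW.
have tV : 0 <= t / f0 ^+ 2 by rewrite divr_ge0 ?sqr_ge0// ltW// t_gt0.
have K2 : 2 <= K.
  rewrite /K -[33 * t / _]mulrA; apply: (@le_trans _ _ (2 * s0%:R)); first lra.
  by rewrite ler_wpM2r//; lra.
have K0 : 0 < K by lra.
rewrite /psitilde KE in qp.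
have h := phitilde_maurey N_gt0 (b - b') K2 q01 qp.
have h1 := good_pred y0 ry.
have h2 := good_norm1 tc.
have KL : c0 A4 * y <= Num.sqrt K * Num.sqrt L.
  rewrite -sqrtrM ?(ltW K0)//; apply: sqrt_le; first exact: sqrtr_ge0.
  rewrite sqr_sqrtr; last by apply: mulr_ge0; apply: ltW.
  apply: (@le_trans _ _ (c0 A4 * (s0%:R * L / f0 ^+ 2))).
    rewrite exprMn; apply: ler_pM; rewrite ?sqr_ge0//; first by rewrite expr2 ler_piMl// ltW.
    have s0L : 0 <= s0%:R * L by apply: mulr_ge0; rewrite ?ler0n ?(ltW L0).
    rewrite -(sqr_sqrtr s0L) -expr_div_n; apply: lerXn2r; rewrite ?nnegrE//.
    exact: le_trans yf.
  rewrite /K -[33 * t / _]mulrA.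
  rewrite (_ : c0 A4 * (s0%:R * L / f0 ^+ 2) = (c0 A4 / f0 ^+ 2) * (s0%:R * L)); last ring.
  rewrite -[leRHS]mulrA; apply: ler_wpM2r.
    by apply: mulr_ge0; rewrite ?ler0n ?(ltW L0).
  have : c0 A4 / f0 ^+ 2 <= t / f0 ^+ 2 by rewrite ler_wpM2r// invr_ge0 sqr_ge0.
  lra.
have sK0 : 0 < Num.sqrt K by rewrite sqrtr_gt0.
have h3 : 6 * (N * norm1 (b - b')) / Num.sqrt K <= Kc A3 A4 * y.
  rewrite ler_pdivrMr//.
  have h4 : 6 * (N * norm1 (b - b')) <= 6 * (Kd A3 A4 * y ^+ 2 / Num.sqrt L).
    rewrite ler_pM2l//; apply: (le_trans h2).
    by rewrite ler_wpM2r ?invr_ge0 ?(ltW sL0)// ler_wpM2l.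
  apply: (le_trans h4).
  have -> : 6 * (Kd A3 A4 * y ^+ 2 / Num.sqrt L) = Kc A3 A4 * y * (c0 A4 * y / Num.sqrt L).
    by rewrite /Kd /Kc; field; rewrite !gt_eqF.
  by apply: ler_wpM2l; [exact: mulr_ge0|rewrite ler_pdivrMr].
lra.
Qed.

End GoodEvent.

Lemma rhs_cases :
  let phis := phi X (supp bs) in
  (exists f, [/\ 0 < f <= 1, compat X N (supp bs) f,
     ((Num.sqrt (s%:R * L))%:E * phis^-1 = (Num.sqrt (s%:R * L) / f)%:E)%E &
     ((s%:R * Num.sqrt L / N)%:E * (phis * phis)^-1 = (s%:R * Num.sqrt L / N / f ^+ 2)%:E)%E]) \/
  ((Num.sqrt (s%:R * L))%:E * phis^-1 = +oo /\ (s%:R * Num.sqrt L / N)%:E * (phis * phis)^-1 = +oo)%E.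
Proof.
move=> phis; have [sz|sp] := posnP s.
  left; exists 1; rewrite ltr01 lexx; split => //.
  - by rewrite (card_supp0 sz); exact: compat0.
  - by rewrite sz mul0r sqrtr0 mul0e mul0r.
  - by rewrite sz !mul0r mul0e.
have sR : 0 < s%:R :> R by rewrite ltr0n.
have [f fE /andP[f0 f1]] := fin01 (phi_ge0 N_gt0 (supp bs)) (phi_le1 N_gt0 sp).
have [fz|fnz] := eqVneq f 0.
  have p1 : 0 < Num.sqrt (s%:R * L) by rewrite sqrtr_gt0 mulr_gt0.
  have p2 : 0 < s%:R * Num.sqrt L / N by rewrite divr_gt0// mulr_gt0.
  right; rewrite /phis fE fz mule0 inve0; split.
    by rewrite mulry (gtr0_sg p1) mul1e.
  by rewrite mulry (gtr0_sg p2) mul1e.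
have fp : 0 < f by rewrite lt_def fnz.
left; exists f; rewrite fp f1; split => //.
- by apply: phi_compat => //; rewrite fE.
- by rewrite /phis fE inver (negPf fnz).
- by rewrite /phis fE -EFinM inver mulf_eq0 orbb (negPf fnz) -EFinM -expr2.
Qed.

Lemma psi_arg_ge1 : (0 < s0)%N -> (1 <= psi_arg X A4 lam (supp beta0))%E.
Proof.
move=> s00; have [_ _ _ A40] := A_gt0.
have s1 : 1 <= s0%:R :> R by rewrite ler1n.
have ph0 := phi_ge0 N_gt0 (supp beta0).
apply: (@le_trans _ _ ((2 + 3 / A4)%:E * s0%:R%:E)%E).
  rewrite -EFinM lee_fin; have : 0 <= 3 / A4 by rewrite divr_ge0// ltW.
  by nra.
rewrite /psi_arg; apply: lee_wpmul2r; first by rewrite lee_fin.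
rewrite leeDl// mule_ge0 ?lee_fin//; first by rewrite mulr_ge0// ltW// t_gt0.
by rewrite inve_ge0 mule_ge0.
Qed.

(** The events are stated with the psi factors multiplied to the left, which keeps them meaningful
    when these numbers are 0. *)
Theorem recovery_inst :
  let Xn := N in
  let psib := psibar X A4 lam (supp beta0) in
  let psit := psitilde X A4 lam (supp beta0) in
  let phis := phi X (supp bs) in
  let M := Mconst A3 A4 in
  [/\ (post_expect X prior lam beta0
         [set b | (psib * (norm2 (X *m (b - beta0)))%:E >
                   M%:E * (Delta%:E + (Num.sqrt (s%:R * L))%:E * phis^-1))%E]
        <= eps%:E)%E,
      (post_expect X prior lam beta0
         [set b | (psib * psib * (norm1 (b - beta0) - norm1 (bs - beta0))%:E >
                   M%:E * ((Delta ^+ 2 / (Xn * Num.sqrt L))%:E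
                           + (s%:R * Num.sqrt L / Xn)%:E * (phis * phis)^-1))%E]
        <= eps%:E)%E &
      (post_expect X prior lam beta0
         [set b | (Xn%:E * (psit * psit) * (norm2 (b - beta0))%:E >
                   M%:E * (Delta%:E + (Num.sqrt (s%:R * L))%:E * phis^-1))%E]
        <= eps%:E)%E].
Proof.
move=> Xn psib psit phis M.
have [A10 A20 A30 A40] := A_gt0.
have [[a0 /andP[c00 c01] M10 cc] [[Ka1 Kc0 Kd0 cA4] Mc]] := const_facts A30 A40.
have Kb1 : 1 <= Kb A3 A4 by rewrite /Kb; lra.
have M0 : 0 < M by rewrite /M /Mconst; lra.
have [[f [f01 cf E1 E2]]|[E1 E2]] := rhs_cases; last first.
  have Moo (x : R) : (M%:E * (x%:E + +oo) = +oo)%E by rewrite addey// mulry gtr0_sg// mul1e.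
  by split; apply: post_expect_void => b /=; rewrite ?E1 ?E2 Moo ltNge leey.
have [f0 f1] := andP f01.
have De0 : 0 <= Delta by exact: norm2_ge0.
have sLf : 0 <= Num.sqrt (s%:R * L) / f by rewrite divr_ge0 ?sqrtr_ge0// ltW.
set rr := Delta + Num.sqrt (s%:R * L) / f.
have rr0 : 0 <= rr by exact: addr_ge0.
have slL : 0 <= s%:R * L by apply: mulr_ge0; rewrite ?ler0n ?(ltW L0).
have radrr : rad bs f <= rr ^+ 2.
  rewrite /radius2 /rr sqrrD expr_div_n (sqr_sqrtr slL).
  have : 0 <= Delta * (Num.sqrt (s%:R * L) / f) by exact: mulr_ge0.
  by rewrite mulr2n; lra.
have E2r : Delta ^+ 2 / (N * Num.sqrt L) + s%:R * Num.sqrt L / N / f ^+ 2 = rad bs f / (N * Num.sqrt L).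
  have h (w l : R) : 0 < w -> w ^+ 2 = l ->
      Delta ^+ 2 / (N * w) + s%:R * w / N / f ^+ 2 = (s%:R * l / f ^+ 2 + Delta ^+ 2) / (N * w).
    by move=> w0 <-; field; rewrite !gt_eqF.
  exact: h.
rewrite E1 E2 -!EFinD -/rr E2r -!EFinM.
have NsL : 0 < N * Num.sqrt L by exact: mulr_gt0.
have rad0 : 0 <= rad bs f.
  by rewrite /radius2 addr_ge0 ?sqr_ge0// divr_ge0 ?sqr_ge0.
(* If [beta0 = 0] then [bs = 0] and the radius is 0, so any nonzero [b] has too large a loss, while
   [b = 0] violates none of the three bounds. *)
have [s0z|s0p] := posnP s0.
  have sz : s = 0%N by apply/eqP; rewrite -leqn0 -s0z.
  have b00 := card_supp0 s0z; have bs0 := card_supp0 sz.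
  have H (b : 'cV[R]_p) : b != 0 -> loss bs b <= M1' * rad bs f -> False.
    move=> /card_supp_gt0 bp; rewrite leNgt => /negP; apply.
    have -> : rad bs f = 0 by rewrite /radius2 sz bs0 b00 subrr mulmx0 norm2_0 expr0n !mul0r addr0.
    have h3 : 0 < cA A4 * #|supp b|%:R * L by rewrite mulr_gt0 ?L0// mulr_gt0// ltr0n.
    have h1 : 0 <= alpha / 8 * norm2 (X *m (b - bs)) ^+ 2 by rewrite mulr_ge0 ?sqr_ge0//; lra.
    have h2 : 0 <= lam / 8 * norm1 (b - bs) by rewrite mulr_ge0 ?norm1_ge0// divr_ge0// ltW.
    by rewrite mulr0 /weighted_loss; lra.
  have z0 (x : R) : (0 <= x)%R -> ~ (x%:E < 0)%E by rewrite lte_fin; lra.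
  split; apply: (concentration_inst f01 cf) => b /= Bb; apply: H; apply/eqP => bz; move: Bb;
    rewrite bz b00 ?bs0 subrr ?mulmx0 ?norm2_0 ?subrr mule0; apply: z0.
  - by rewrite mulr_ge0 ?(ltW M0).
  - rewrite mulr_ge0 ?(ltW M0)// divr_ge0 ?(ltW NsL)// /radius2 addr_ge0 ?sqr_ge0//.
    rewrite divr_ge0 ?sqr_ge0//; apply: mulr_ge0; [exact: ler0n|exact: ltW].
  - by rewrite mulr_ge0 ?(ltW M0).
have [r rE /andP[r0 r1]] : exists2 r : R, psib = r%:E & 0 <= r <= 1.
  by apply: fin01; [exact: phibar_ge0|apply: phibar_le1 => //; exact: psi_arg_ge1].
have [q qE /andP[q0 q1]] : exists2 q : R, psit = q%:E & 0 <= q <= 1.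
  by apply: fin01; [exact: phitilde_ge0|apply: phitilde_le1 => //; exact: psi_arg_ge1].
have rp : (r%:E <= psibar X A4 lam (supp beta0))%E by rewrite -/psib rE.
have qp : (q%:E <= psitilde X A4 lam (supp beta0))%E by rewrite -/psit qE.
rewrite rE qE -!EFinM.
have tri (b : 'cV[R]_p) : norm2 (X *m (b - beta0)) <= norm2 (X *m (b - bs)) + Delta.
  have -> : X *m (b - beta0) = X *m (b - bs) + X *m (bs - beta0) by rewrite -mulmxDr addrA subrK.
  exact: norm2_triangle.
have predict (b : 'cV[R]_p) : loss bs b <= M1' * rad bs f -> norm2 (X *m (b - beta0)) <= M * rr.
  move=> lb; apply: (le_trans (tri b)).
  have := good_pred f01 lb rr0 radrr.
  have : Delta <= 1 * rr by rewrite mul1r /rr lerDl.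
  have : 0 <= (Kb A3 A4 + Kc A3 A4 + Kd A3 A4) * rr by apply: mulr_ge0 => //; lra.
  by rewrite /M /Mconst; lra.
have l1tri (b : 'cV[R]_p) : norm1 (b - beta0) - norm1 (bs - beta0) <= norm1 (b - bs).
  rewrite lerBlDr; have := norm1_triangle (b - bs) (bs - beta0).
  by rewrite addrA subrK.
split.
(* Prediction holds without any psi factor; since [r] is at most 1, multiplying by it only helps. *)
- apply: (concentration_inst f01 cf) => b /=; rewrite -EFinM lte_fin => Bb /predict h.
  have : r * norm2 (X *m (b - beta0)) <= norm2 (X *m (b - beta0)) by rewrite ler_piMl ?norm2_ge0.
  lra.
- have fin2 (b : 'cV[R]_p) : r * (N * norm1 (b - bs)) <= (Kb A3 A4 + Kd A3 A4) * rad bs f / Num.sqrt L ->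
    M * (rad bs f / (N * Num.sqrt L)) < r * r * (norm1 (b - beta0) - norm1 (bs - beta0)) -> False.
    move=> h1 h2.
    have h3 : r * r * (norm1 (b - beta0) - norm1 (bs - beta0)) <= r * norm1 (b - bs).
      apply: (@le_trans _ _ (r * r * norm1 (b - bs))); first by rewrite ler_wpM2l ?mulr_ge0.
      by rewrite -mulrA ler_piMl ?mulr_ge0 ?norm1_ge0.
    have h4 : r * norm1 (b - bs) <= (Kb A3 A4 + Kd A3 A4) * (rad bs f / (N * Num.sqrt L)).
      have -> : (Kb A3 A4 + Kd A3 A4) * (rad bs f / (N * Num.sqrt L)) =
         ((Kb A3 A4 + Kd A3 A4) * rad bs f / Num.sqrt L) / N by field; rewrite !gt_eqF.
      by rewrite ler_pdivlMr// -[leLHS]mulrA [X in r * X]mulrC.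
    have h5 : (Kb A3 A4 + Kd A3 A4) * (rad bs f / (N * Num.sqrt L)) <= M * (rad bs f / (N * Num.sqrt L)).
      by apply: ler_wpM2r; [rewrite divr_ge0// ltW|rewrite /M /Mconst; lra].
    lra.
  have w0 : 0 <= rad bs f / Num.sqrt L by rewrite divr_ge0// ltW.
  have mono a : a <= Kb A3 A4 + Kd A3 A4 ->
      a * rad bs f / Num.sqrt L <= (Kb A3 A4 + Kd A3 A4) * rad bs f / Num.sqrt L.
    by move=> h; rewrite -[leLHS]mulrA -[leRHS]mulrA; exact: ler_wpM2r.
  have [tc|tc] := leP t (c0 A4).
    apply: (concentration_dim f01 cf s0p tc) => b /=; rewrite -?EFinM lte_fin => Bb lb dK.
    apply: fin2 Bb; apply: le_trans (good_norm1_sparse f01 lb r0 rp (dK bs bs_le)) _.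
    by apply: mono; lra.
  apply: (concentration_inst f01 cf) => b /=; rewrite -?EFinM lte_fin => Bb lb.
  apply: fin2 Bb; apply: (@le_trans _ _ (N * norm1 (b - bs))).
    by rewrite ler_piMl// mulr_ge0 ?norm1_ge0// ltW.
  apply: le_trans (good_norm1 f01 lb (ltW tc)) _.
  by apply: mono; lra.
have fin3 (b : 'cV[R]_p) : q * (N * norm2 (b - beta0)) <= M * rr ->
    M * rr < N * (q * q) * norm2 (b - beta0) -> False.
  move=> h1 h2; have : N * (q * q) * norm2 (b - beta0) = q * (q * (N * norm2 (b - beta0))) by ring.
  have : q * (q * (N * norm2 (b - beta0))) <= q * (N * norm2 (b - beta0)).
    apply: ler_piMl => //; apply: mulr_ge0 => //.
    by apply: mulr_ge0; [exact: ltW|exact: norm2_ge0].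
  lra.
have [tc|tc] := leP t (c0 A4).
  (* The dimension bound is applied with d = [beta0], so the l2 error follows from the prediction
     error directly, without a triangle inequality through [bs]. *)
  apply: (concentration_dim f01 cf s0p tc) => b /=; rewrite -?EFinM lte_fin => Bb lb dK.
  apply: fin3 Bb; apply: le_trans (phitilde_norm2 N_gt0 qp (dK beta0 (leqnn _))) _.
  exact: predict.
have [h0 hE /andP[h00 h01]] := fin01 (phi_ge0 N_gt0 (supp beta0)) (phi_le1 N_gt0 s0p).
have s0R : 0 < s0%:R :> R by rewrite ltr0n.
have [hz|hnz] := eqVneq h0 0.
  apply: (concentration_inst f01 cf) => b /=; rewrite -?EFinM lte_fin => Bb lb.
  apply: fin3 Bb; apply: le_trans (phitilde_norm2 N_gt0 qp _) (predict b lb).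
  rewrite /psi_arg hE hz mule0 inve0 mulry gtr0_sg ?mul1e; last by rewrite mulr_gt0// t_gt0.
  by rewrite addey// mulyr gtr0_sg// mul1e leey.
have hp : 0 < h0 by rewrite lt_def hnz.
(* Sparsification needs a radius at most sqrt (s0 L) / phi(S0). If the radius at [bs] is larger,
   [bs] is a worse centre than [beta0], and concentration around [beta0] itself gives the claim. *)
have [rr_le|rr_gt] := leP rr (Num.sqrt (s0%:R * L) / h0).
  apply: (concentration_inst f01 cf) => b /=; rewrite -?EFinM lte_fin => Bb lb.
  apply: fin3 Bb.
  have yb : 0 <= rr <= Num.sqrt (s0%:R * L) / h0 by rewrite rr0.
  have q01 : 0 <= q <= 1 by rewrite q0.
  have g1 := good_norm2 f01 lb (ltW tc) q01 hE hp s0p qp yb radrr.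
  have g2 : q * (N * norm2 (bs - beta0)) <= Delta.
    apply: (phitilde_norm2 N_gt0 qp).
    have e2 : (h0%:E * h0%:E)^-1%E = (h0 ^- 2)%:E.
      by rewrite -EFinM inver mulf_eq0 orbb (negPf hnz) -expr2.
    rewrite /psi_arg hE e2 -!EFinM lee_fin.
    have cd : (#|supp (bs - beta0)|%:R : R) <= s%:R + s0%:R.
      rewrite -natrD ler_nat; apply: (leq_trans _ (leq_card_setU _ _)); apply: subset_leq_card.
      by apply: supp_sub_subset; [exact: finset.subsetUl|exact: finset.subsetUr].
    have ss0 : s%:R <= s0%:R :> R by rewrite ler_nat.
    have A4V : 0 <= 3 / A4 by rewrite divr_ge0// ltW.
    have tV : 0 <= 33 * t / h0 ^+ 2 by rewrite divr_ge0 ?sqr_ge0// mulr_ge0// ltW// t_gt0.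
    by have := mulr_ge0 (addr_ge0 A4V tV) (ltW s0R); lra.
  have g3 : norm2 (b - beta0) <= norm2 (b - bs) + norm2 (bs - beta0).
    by have := norm2_triangle (b - bs) (bs - beta0); rewrite addrA subrK.
  have g4 : q * (N * norm2 (b - beta0)) <= q * (N * (norm2 (b - bs) + norm2 (bs - beta0))).
    by apply: ler_wpM2l => //; apply: ler_wpM2l => //; exact: ltW.
  have g5 : Delta <= 1 * rr by rewrite mul1r /rr lerDl.
  have : 0 <= (Kb A3 A4 + Kd A3 A4) * rr by apply: mulr_ge0 => //; lra.
  by rewrite /M /Mconst; lra.
have hc : compat X N (supp beta0) h0 by apply: phi_compat => //; rewrite hE.
have h01b : 0 < h0 <= 1 by rewrite hp.
apply: (concentration_inst h01b hc) => b /=; rewrite -?EFinM lte_fin => Bb lb.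
apply: fin3 Bb.
set y := Num.sqrt (s0%:R * L) / h0 in rr_gt *.
have y0 : 0 <= y by rewrite divr_ge0 ?sqrtr_ge0.
have yb : 0 <= y <= Num.sqrt (s0%:R * L) / h0 by rewrite y0 lexx.
have q01 : 0 <= q <= 1 by rewrite q0.
have ry : rad beta0 h0 <= y ^+ 2.
  rewrite /radius2 subrr mulmx0 norm2_0 expr0n addr0 /y expr_div_n sqr_sqrtr//.
  by apply: mulr_ge0; rewrite ?ler0n ?(ltW L0).
have g1 := good_norm2 h01b lb (ltW tc) q01 hE hp s0p qp yb ry.
apply: (le_trans g1); apply: ler_pM => //.
- lra.
- by rewrite /M /Mconst; lra.
- exact: ltW.
Qed.

End Recovery.

(** * The asymptotic regime *)

(** The square of exp (delta l / 2) is at least (delta l / 2)^2, which beats e^2 (1 + 8 l) <= 9 e^2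
    l as soon as delta^2 l >= 36 e^2. *)
Lemma exp_eventually (R : realType) (delta T : R) : 0 < delta -> 0 <= T ->
  exists l0 : R, forall l, l0 <= l ->
  [/\ 1 <= l, T <= expR (delta * l) & expR 2 * (1 + 8 * l) <= expR (delta * l)].
Proof.
move=> d0 T0; have e0 : 0 < expR 2 :> R by exact: expR_gt0.
have c0 : 0 <= 36 * expR 2 / delta ^+ 2 by rewrite divr_ge0 ?sqr_ge0// mulr_ge0// ltW.
have t0 : 0 <= T / delta by rewrite divr_ge0// ltW.
exists (1 + T / delta + 36 * expR 2 / delta ^+ 2) => l hl.
have l1 : 1 <= l by lra.
have d20 : 0 < delta ^+ 2 by exact: exprn_gt0.
split => //.
  apply: le_trans (expR_ge1Dx _); have : T <= delta * l by rewrite [leRHS]mulrC -ler_pdivrMr//; lra.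
  lra.
have -> : delta * l = delta * l / 2 + delta * l / 2 by field.
have h : delta * l / 2 <= expR (delta * l / 2) by have := expR_ge1Dx (delta * l / 2); lra.
have h0 : 0 <= delta * l / 2 by rewrite divr_ge0// mulr_ge0; lra.
rewrite (expRD (delta * l / 2)); apply: le_trans (ler_pM h0 h0 h h).
have h2 : 36 * expR 2 <= delta ^+ 2 * l by rewrite [leRHS]mulrC -ler_pdivrMr//; lra.
have h3 : expR 2 * 36 * l <= delta ^+ 2 * l * l by rewrite ler_wpM2r//; lra.
have h4 : expR 2 * (1 + 8 * l) <= expR 2 * (9 * l) by rewrite ler_pM2l//; lra.
have -> : delta * l / 2 * (delta * l / 2) = delta ^+ 2 * l * l / 4 by field.
lra.
Qed.

Theorem theorem3 (R : realType)
  (n p : nat -> nat)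
  (X : forall k : nat, 'M[R]_(n k, p k))
  (lam : nat -> R)
  (pi_p : nat -> nat -> R)
  (A1 A2 A3 A4 : R)
  (* asymptotic regime n, p -> oo *)
  (Hn : forall N, exists K, forall k, (K <= k)%N -> (N <= n k)%N)
  (Hp : forall N, exists K, forall k, (K <= k)%N -> (N <= p k)%N)
  (* the Laplace slab parameter is a genuine (positive) rate *)
  (Hlam0 : forall k, 0 < lam k)
  (* pi_p is a probability distribution on {0, ..., p} *)
  (Hpi0 : forall k s, (s <= p k)%N -> 0 <= pi_p k s)
  (Hpi1 : forall k, \sum_(s < (p k).+1) pi_p k s = 1)
  (* ||X||/p <= lambda <= 2 bar lambda *)
  (Hlam : forall k, normX (X k) / (p k)%:R <= lam k /\ lam k <= 2 * lambda_bar (X k))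
  (HA : 0 < A1 /\ 0 < A2 /\ 0 < A3 /\ 0 < A4)
  (Hprior : forall k s, (1 <= s <= p k)%N ->
      A1 * (p k)%:R `^ (- A3) * pi_p k s.-1 <= pi_p k s /\
      pi_p k s <= A2 * (p k)%:R `^ (- A4) * pi_p k s.-1) :
  exists M : R, 0 < M /\
  forall eps : R, 0 < eps -> exists K, forall k, (K <= k)%N ->
  forall beta0 betas : 'cV[R]_(p k),
  (#|supp betas| <= #|supp beta0|)%N ->
  let S0 := supp beta0 in
  let Ss := supp betas in
  let Xn := normX (X k) in
  let lp := ln (p k)%:R in
  let psib := psibar (X k) A4 (lam k) S0 in
  let psit := psitilde (X k) A4 (lam k) S0 in
  let phis := phi (X k) Ss in
  [/\ (post_expect (X k) (pi_p k) (lam k) beta0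
         [set b | (psib * (norm2 (X k *m (b - beta0)))%:E >
                   M%:E * ((norm2 (X k *m (betas - beta0)))%:E
                           + (Num.sqrt (#|Ss|%:R * lp))%:E * phis^-1))%E]
        <= eps%:E)%E,
      (post_expect (X k) (pi_p k) (lam k) beta0
         [set b | (psib * psib * (norm1 (b - beta0) - norm1 (betas - beta0))%:E >
                   M%:E * ((norm2 (X k *m (betas - beta0)) ^+ 2 / (Xn * Num.sqrt lp))%:E
                           + (#|Ss|%:R * Num.sqrt lp / Xn)%:E * (phis * phis)^-1))%E]
        <= eps%:E)%E &
      (post_expect (X k) (pi_p k) (lam k) beta0
         [set b | (Xn%:E * (psit * psit) * (norm2 (b - beta0))%:E >
                   M%:E * ((norm2 (X k *m (betas - beta0)))%:E
                           + (Num.sqrt (#|Ss|%:R * lp))%:E * phis^-1))%E]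
        <= eps%:E)%E].
Proof.
have [A10 [A20 [A30 A40]]] := HA.
have [[a0 c01 M10 cc] [[Ka1 Kc0 Kd0 cA4] Mc]] := const_facts A30 A40.
have d0 : 0 < deltaA A4 by move: a0; rewrite /alphaA /deltaA; lra.
exists (Mconst A3 A4); split; first by rewrite /Mconst /Kb; lra.
move=> eps eps0.
have e2 : 0 <= 4 + 5 * expR 2 :> R by have := expR_gt0 (2 : R); lra.
have T1 : 0 <= (4 + 5 * expR 2) / eps by rewrite divr_ge0// ltW.
have T2 : 0 < A1^-1 by rewrite invr_gt0.
have T0 : 0 <= A2 + A1^-1 + 8 + (4 + 5 * expR 2) / eps by lra.
have [l0 hl0] := exp_eventually d0 T0.
(* All requirements are lower bounds on log p, so K is fixed before [beta0] and [betas] are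
   introduced. *)
have [K HK] := Hp (Num.truncn (expR l0)).+1.
exists K => k /HK pk beta0 betas sle S0 Ss Xn lp psib psit phis.
have p0 : (0 < p k)%N by exact: leq_ltn_trans pk.
have pR : 0 < (p k)%:R :> R by rewrite ltr0n.
have lL : l0 <= ln (p k)%:R.
  rewrite -ler_expR lnK ?posrE//; apply: le_trans (ltW (truncnS_gt _)) _.
  by rewrite ler_nat.
have [L1 TL eL] := hl0 _ lL.
have [lo hi] := Hlam k.
have hi' : lam k <= 4 * normX (X k) * Num.sqrt (ln (p k)%:R).
  by move: hi; rewrite /lambda_bar; lra.
(* A zero design would force [lam k <= 0] through the upper bound on the rate. *)
have N0 : 0 < normX (X k).
  rewrite ltNge; apply/negP => N0; have := lt_le_trans (Hlam0 k) hi'.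
  rewrite ltNge => /negP; apply; rewrite mulr_le0_ge0 ?sqrtr_ge0//.
  by rewrite mulr_ge0_le0.
have pE (A : R) : (p k)%:R `^ (- A) = expR (- A * ln (p k)%:R) by rewrite /powR (gt_eqF pR).
have A4' : [/\ 0 < A1, 0 < A2, 0 < A3 & 0 < A4] by [].
have ratio s : (1 <= s <= p k)%N ->
    A1 * expR (- A3 * ln (p k)%:R) * pi_p k s.-1 <= pi_p k s /\
    pi_p k s <= A2 * expR (- A4 * ln (p k)%:R) * pi_p k s.-1.
  by rewrite -!pE; exact: Hprior.
have b1 : A2 <= expR (deltaA A4 * ln (p k)%:R) by lra.
have b2 : A1^-1 <= expR (deltaA A4 * ln (p k)%:R) by lra.
have b3 : 8 <= expR (deltaA A4 * ln (p k)%:R) by lra.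
have b4 : (4 + 5 * expR 2) / eps <= expR (deltaA A4 * ln (p k)%:R) by lra.
have eps_le : (eps_bound (p k) A4 <= eps).
  by rewrite /eps_bound expRN ler_pdivrMr ?expR_gt0// [leRHS]mulrC -ler_pdivrMr.
have [c1 c2 c3] := recovery_inst (Hpi0 k) (Hpi1 k) A4' ratio (Hlam0 k) N0 p0 lo hi' L1 b1 b2 b3 eL sle.
have le_eps (x : \bar R) : (x <= (eps_bound (p k) A4)%:E)%E -> (x <= eps%:E)%E.
  by move=> h; apply: (le_trans h); rewrite lee_fin.
by split; apply: le_eps; [exact: c1|exact: c2|exact: c3].
Qed.
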